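(* Let $\tilde\Omega\subset\mathbb{R}^3$ be a bounded domain, let $\Omega\subset\tilde\Omega$ be a smoothly bounded connected domain with $\partial\tilde\Omega\cap\partial\Omega=\emptyset$ and outward unit normal $\boldsymbol{n}$, and let $\boldsymbol{w}\in C^\infty(\tilde\Omega)$ be a smooth vector field satisfying $\boldsymbol{n}\cdot\boldsymbol{w}=0$ on $\partial\Omega$. Assume $|h|=|\boldsymbol{w}\cdot\nabla\times\boldsymbol{w}|\ge\delta>0$ in $\tilde\Omega$ for some constant $\delta$. Put $\hat{\boldsymbol{w}}=\boldsymbol{w}/|\boldsymbol{w}|$, $\epsilon=\inf_{\overline{\Omega}}|h|$ and $M=\sup_{\overline{\Omega}}|\boldsymbol{w}|$. Then there exists a vector field $\boldsymbol{a}_\perp\in C^\infty(\overline{\Omega})$ satisfying, in $\Omega$, $\boldsymbol{a}_\perp\cdot\boldsymbol{w}=0$ and $\nabla\cdot\boldsymbol{a}_\perp=|\nabla\times\hat{\boldsymbol{w}}|\ge M^{-2}\epsilon>0$, such that, with $\nu=\sup_{\overline{\Omega}}|\boldsymbol{a}_\perp|$, the following estimate holds: $$\|\nabla_\perp u\|\ge\frac{\epsilon}{2M^2\nu}\,\|u\|\qquad\forall u\in\mathcal{H}^\perp_0(\Omega).$$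
   Context: Functions are real valued; $\|\cdot\|$ is the $L^2(\Omega)$ norm. ''Smoothly bounded'' means bounded with smooth boundary. For $u\in C^1(\Omega)$ the orthogonal gradient is $\nabla_\perp u=\boldsymbol{w}\times(\nabla u\times\boldsymbol{w})/|\boldsymbol{w}|^2$, the component of $\nabla u$ orthogonal to $\boldsymbol{w}$. $\mathcal{H}^\perp(\Omega)$ is the Hilbert space obtained by completing $C^1(\Omega)$ (functions of finite norm) in the norm $\|u\|_{\mathcal{H}^\perp}^2=\|u\|^2+\|\nabla_\perp u\|^2$; it is a subspace of $L^2(\Omega)$, and for its elements $\nabla_\perp u\in L^2$ is understood in the sense of distributions: $\int_\Omega(\nabla_\perp u)^i\varphi\,dV=-\int_\Omega u\left[(\nabla_\perp\varphi)^i-\nabla\cdot(\hat w^i\hat{\boldsymbol{w}})\varphi\right]dV$ for all $\varphi\in C_0^\infty(\Omega)$. Since $\boldsymbol{n}\cdot\boldsymbol{w}=0$ on $\partial\Omega$, there is a bounded linear trace operator $T:\mathcal{H}^\perp(\Omega)\to L^2(\partial\Omega)$ with $Tu=u|_{\partial\Omega}$ for $u\in\mathcal{H}^\perp(\Omega)\cap C^1(\overline{\Omega})$, given in general by $Tu=\lim_m u_m|_{\partial\Omega}$ in $L^2(\partial\Omega)$ for $u_m\in C^1(\overline{\Omega})$ converging to $u$ in $\mathcal{H}^\perp(\Omega)$. Then $\mathcal{H}^\perp_0(\Omega)=\ker T$. *)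

(* Defs.v *)
From HB Require Import structures.
From mathcomp Require Import all_boot all_order all_algebra.
From mathcomp Require Import all_classical all_reals all_analysis.

Set Implicit Arguments.
Unset Strict Implicit.
Unset Printing Implicit Defensive.

Import Order.TTheory GRing.Theory Num.Theory.
Import numFieldNormedType.Exports.

Local Open Scope classical_set_scope.
Local Open Scope ring_scope.

(* Points and vectors of R^n are row vectors 'rV[R]_n; Euclidean quantities are
   written with [dot] and [enorm], since the library norm on 'rV[R]_n is the
   sup norm (it induces the same topology). *)

Section euclidean_space.
Context {R : realType}.

Definition dot n (a b : 'rV[R]_n) : R := \sum_i a 0 i * b 0 i.

Definition enorm n (a : 'rV[R]_n) : R := Num.sqrt (dot a a).

(* Indices in 'I_3 are added modulo 3, so i, i + 1, i + 2 is a cyclic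
   permutation of the axes. *)
Definition cross (a b : 'rV[R]_3) : 'rV[R]_3 :=
  \row_(i < 3) (a 0 (i + 1) * b 0 (i + 2) - a 0 (i + 2) * b 0 (i + 1)).

Definition pd n (i : 'I_n) (f : 'rV[R]_n -> R) (x : 'rV[R]_n) : R :=
  'D_(delta_mx 0 i) f x.

Definition component n m (F : 'rV[R]_n -> 'rV[R]_m) (j : 'I_m) :
  'rV[R]_n -> R := fun x => F x 0 j.

Definition grad n (f : 'rV[R]_n -> R) (x : 'rV[R]_n) : 'rV[R]_n :=
  \row_i pd i f x.

Definition divergence n (F : 'rV[R]_n -> 'rV[R]_n) (x : 'rV[R]_n) : R :=
  \sum_i pd i (component F i) x.

Definition curl (F : 'rV[R]_3 -> 'rV[R]_3) (x : 'rV[R]_3) : 'rV[R]_3 :=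
  \row_(i < 3) (pd (i + 1) (component F (i + 2)) x
                - pd (i + 2) (component F (i + 1)) x).

Definition unit_field n (w : 'rV[R]_n -> 'rV[R]_n) (x : 'rV[R]_n) : 'rV[R]_n :=
  (enorm (w x))^-1 *: w x.

Definition grad_perp (w : 'rV[R]_3 -> 'rV[R]_3) (u : 'rV[R]_3 -> R)
    (x : 'rV[R]_3) : 'rV[R]_3 :=
  (enorm (w x) ^+ 2)^-1 *: cross (w x) (cross (grad u x) (w x)).

(* C^k on an open set U: all partial derivatives up to order k exist and are
   continuous at every point of U. *)
Fixpoint Ck_on n (k : nat) (U : set 'rV[R]_n) (f : 'rV[R]_n -> R) : Prop :=
  (forall x, U x -> {for x, continuous f}) /\
  if k is k'.+1 then
    forall i : 'I_n, (forall x, U x -> derivable f x (delta_mx 0 i)) /\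
                     Ck_on k' U (pd i f)
  else True.

(* C^k up to the boundary of an open set U: f is C^k in U, and f and each
   partial derivative of order at most k extend continuously to the closure.
   The boundary values of f itself are part of the data of f. *)
Fixpoint Ck_closure n (k : nat) (U : set 'rV[R]_n) (f : 'rV[R]_n -> R) : Prop :=
  {within closure U, continuous f} /\
  if k is k'.+1 then
    forall i : 'I_n, (forall x, U x -> derivable f x (delta_mx 0 i)) /\
      exists2 g, Ck_closure k' U g & forall x, U x -> g x = pd i f x
  else True.

Definition smooth_on n (U : set 'rV[R]_n) (f : 'rV[R]_n -> R) : Prop :=
  forall k, Ck_on k U f.

Definition smooth_closure n (U : set 'rV[R]_n) (f : 'rV[R]_n -> R) : Prop :=
  forall k, Ck_closure k U f.

Definition smooth_field_on n m (U : set 'rV[R]_n)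
    (F : 'rV[R]_n -> 'rV[R]_m) : Prop :=
  forall j, smooth_on U (component F j).

Definition smooth_field_closure n m (U : set 'rV[R]_n)
    (F : 'rV[R]_n -> 'rV[R]_m) : Prop :=
  forall j, smooth_closure U (component F j).

Definition test_function n (U : set 'rV[R]_n) (phi : 'rV[R]_n -> R) : Prop :=
  smooth_on setT phi /\
  exists K, [/\ compact K, K `<=` U & forall x, ~ K x -> phi x = 0].

End euclidean_space.

Section domains.
Context {R : realType}.

Definition bounded_domain n (U : set 'rV[R]_n) : Prop :=
  [/\ open U, connected U, U !=set0 & bounded_set U].

Definition boundary n (U : set 'rV[R]_n) : set 'rV[R]_n :=
  closure U `\` interior U.

(* The function s * (x_k - gamma(x')), where s = 1 or -1 (for b = false or
   true) and x' is x without its k-th coordinate. *)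
Definition graph_fun (k : 'I_3) (b : bool) (gamma : 'rV[R]_2 -> R)
    (x : 'rV[R]_3) : R :=
  (-1) ^+ b * (x 0 k - gamma (col' k x)).

(* Near p, after choosing the axis k and its orientation, U is the region
   strictly below the graph of a smooth function. *)
Definition boundary_chart (U : set 'rV[R]_3) (p : 'rV[R]_3)
    (k : 'I_3) (b : bool) (gamma : 'rV[R]_2 -> R) : Prop :=
  smooth_on setT gamma /\
  \forall x \near p, U x <-> graph_fun k b gamma x < 0.

Definition smooth_boundary (U : set 'rV[R]_3) : Prop :=
  forall p, boundary U p -> exists k b gamma, boundary_chart U p k b gamma.

(* U is locally a strict sublevel set of [graph_fun k b gamma], whose gradient
   does not vanish and hence points out of U. *)
Definition outward_unit_normal (U : set 'rV[R]_3) (n : 'rV[R]_3 -> 'rV[R]_3) :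
    Prop :=
  forall p, boundary U p -> exists k b gamma,
    boundary_chart U p k b gamma /\
    n p = unit_field (grad (graph_fun k b gamma)) p.

End domains.

Section integration.
Context {R : realType}.

(* The library's measurable structure and Lebesgue measure live on R and its
   products; [pt2] and [pt3] identify these products with row vectors. *)
Definition pt2 (q : R * R) : 'rV[R]_2 := \row_(i < 2) [:: q.1; q.2]`_i.

Definition pt3 (q : R * R * R) : 'rV[R]_3 :=
  \row_(i < 3) [:: q.1.1; q.1.2; q.2]`_i.

Definition lebesgue2 :=
  ((@lebesgue_measure R) \x (@lebesgue_measure R))%E.

Definition lebesgue3 := (lebesgue2 \x (@lebesgue_measure R))%E.

Definition L2norm (U : set 'rV[R]_3) (f : 'rV[R]_3 -> R) : \bar R :=
  'N[lebesgue3]_2%:E [EFin \o ((f \o pt3) \_ (pt3 @^-1` U))].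

Definition L2norm_field (U : set 'rV[R]_3) (F : 'rV[R]_3 -> 'rV[R]_3) : \bar R :=
  L2norm U (fun x => enorm (F x)).

Definition L2 (U : set 'rV[R]_3) (f : 'rV[R]_3 -> R) : Prop :=
  measurable_fun (pt3 @^-1` U) (f \o pt3) /\ (L2norm U f < +oo)%E.

Definition L2_field (U : set 'rV[R]_3) (F : 'rV[R]_3 -> 'rV[R]_3) : Prop :=
  forall i, L2 U (component F i).

(* An injectively parametrized piece phi(D) of a surface S. *)
Definition surface_patch (S : set 'rV[R]_3) (D : set 'rV[R]_2)
    (phi : 'rV[R]_2 -> 'rV[R]_3) : Prop :=
  [/\ measurable (pt2 @^-1` D), smooth_field_on setT phi,
      set_inj D phi & phi @` D `<=` S].

Definition area_element (phi : 'rV[R]_2 -> 'rV[R]_3) (y : 'rV[R]_2) : R :=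
  enorm (cross (\row_j pd 0 (component phi j) y)
               (\row_j pd 1 (component phi j) y)).

Definition patch_integral (D : set 'rV[R]_2) (phi : 'rV[R]_2 -> 'rV[R]_3)
    (f : 'rV[R]_3 -> R) : \bar R :=
  (\int[lebesgue2]_(q in pt2 @^-1` D)
     (f (phi (pt2 q)) * area_element phi (pt2 q))%:E)%E.

(* Surface integral of a nonnegative Borel function f over a compact smooth
   surface S.  S is a finite disjoint union of patches, and for such an
   exhausting family the sum below is the usual surface integral; since f is
   nonnegative, other families give at most that value, so the supremum is the
   integral and does not depend on a choice of atlas. *)
Definition surface_integral (S : set 'rV[R]_3) (f : 'rV[R]_3 -> R) : \bar R :=
  ereal_sup [set s | exists (N : nat) (D : 'I_N -> set 'rV[R]_2)
                            (phi : 'I_N -> 'rV[R]_2 -> 'rV[R]_3),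
    [/\ forall j, surface_patch S (D j) (phi j),
        trivIset setT (fun j => phi j @` D j) &
        s = (\sum_(j < N) patch_integral (D j) (phi j) f)%E]].

Definition L2_surface (S : set 'rV[R]_3) (g : 'rV[R]_3 -> R) : Prop :=
  measurable_fun (pt3 @^-1` S) (g \o pt3) /\
  (surface_integral S (fun x => (g x ^+ 2)%R) < +oo)%E.

End integration.

Section perp_space.
Context {R : realType}.
Context (U : set 'rV[R]_3) (w : 'rV[R]_3 -> 'rV[R]_3).
Implicit Types (u g : 'rV[R]_3 -> R) (G : 'rV[R]_3 -> 'rV[R]_3).

(* G is the orthogonal gradient of u in the sense of distributions. *)
Definition weak_grad_perp u G : Prop :=
  L2_field U G /\
  forall (i : 'I_3) phi, test_function U phi ->
    \int[lebesgue3]_(q in pt3 @^-1` U) (G (pt3 q) 0 i * phi (pt3 q)) =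
    - \int[lebesgue3]_(q in pt3 @^-1` U)
        (u (pt3 q) *
         (grad_perp w phi (pt3 q) 0 i
          - divergence (fun y => unit_field w y 0 i *: unit_field w y) (pt3 q)
            * phi (pt3 q))).

(* The square of the norm of u when G is its orthogonal gradient. *)
Definition Hperp_sqnorm u G : \bar R :=
  (L2norm U u ^+ 2 + L2norm_field U G ^+ 2)%E.

Definition Hperp_cvg (um : nat -> 'rV[R]_3 -> R) u G : Prop :=
  (fun m => Hperp_sqnorm (fun x => um m x - u x)
                         (fun x => grad_perp w (um m) x - G x))
    @ \oo --> 0%E.

(* u belongs to the completion of C^1(U) in the above norm, and G is its
   orthogonal gradient, which is determined by u almost everywhere. *)
Definition Hperp u G : Prop :=
  [/\ L2 U u, weak_grad_perp u G &
      exists2 um : nat -> 'rV[R]_3 -> R,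
        (forall m, Ck_on 1 U (um m) /\
                   (Hperp_sqnorm (um m) (grad_perp w (um m)) < +oo)%E) &
        Hperp_cvg um u G].

(* The graph of the trace operator T: g = Tu in L^2 of the boundary.  As T is
   bounded, the limit does not depend on the approximating sequence. *)
Definition is_trace u G g : Prop :=
  L2_surface (boundary U) g /\
  exists um : nat -> 'rV[R]_3 -> R,
    [/\ forall m, Ck_closure 1 U (um m), Hperp_cvg um u G &
        (fun m => surface_integral (boundary U) (fun x => (um m x - g x) ^+ 2))
          @ \oo --> 0%E].

Definition Hperp0 u G : Prop := Hperp u G /\ is_trace u G (cst 0).

End perp_space.

(* Main.v *)
From HB Require Import structures.
Require Import Defs.
From mathcomp Require Import all_boot all_order all_algebra.
From mathcomp Require Import all_classical all_reals all_analysis.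
From mathcomp Require Import measurable_realfun ring lra.
Import Order.TTheory GRing.Theory Num.Theory.
Import numFieldNormedType.Exports.
Local Open Scope classical_set_scope.
Local Open Scope ring_scope.

Set Implicit Arguments.
Unset Strict Implicit.
Unset Printing Implicit Defensive.

(** Suppose that [a] is horizontal (orthogonal to [w]) and that its divergence is at
least [c0 > 0] on [Omega].  For [u] vanishing on the boundary, the divergence theorem
for the field [u ^+ 2 *: a] gives
[0 = \int u^2 div a + 2 \int u (a . grad u)], and [a . grad u = a . grad_perp u] because
[a] is horizontal.  Hence [c0 |u|^2 <= 2 nu |u| |grad_perp u|] by Hoelder's inequality,
which is the estimate with constant [c0 / (2 nu)].

The field [a] ([horizontal_potential]).  Given any smooth [f], integrating a cut off
copy of [f] in a fixed direction yields a field [v] with divergence [f].  The correction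
[a = v - curl (c *: w)] has the same divergence, since second derivatives commute
([pdC]), and [curl (c *: w) . w = c h] with [h = w . curl w], so [c = (v . w) / h] makes
[a] horizontal; this is where [h <> 0] enters.  It is applied to
[f = |curl (w / |w|)|], which is bounded below because the component of that curl along
[w / |w|] is [h / |w|^2] ([le_curl_unit]); in particular it does not vanish, so [f] is
smooth.

The boundary term ([divergence_trace_bound]).  An inequality is enough: for every
[v >= 0] that is C^1 up to the boundary, [|\int div (v *: a)|] is at most a constant,
independent of [v], times the surface integral of [v].  After localization by bump
functions this concerns either a function of compact support in [Omega], whose partial
derivatives integrate to zero by Fubini's theorem ([integral_pd_eq0]), or a function
supported near a boundary point, where [Omega] lies below a graph.  In that case
the function is multiplied by a step function of [m] times the defining function of the
graph.  The product has compact support, so only the derivative of the step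
function contributes; it lives in a layer of thickness [1 / m], has size [m], and in
the limit is controlled by the integral of [v] over the graph
([layer_integral_bound]).  Since the surface integral is a supremum over disjoint
families of patches, a single graph patch bounds it from below ([le_chart_surface]).

The limit ([Hperp0_poincare]).  With [v = u_m ^+ 2] for approximations [u_m] of [u] whose
boundary values tend to zero in L^2 of the boundary, the estimate holds up to an error
that tends to zero with the surface integral of [u_m ^+ 2], and all terms pass to the
limit. *)

(** * Calculus of C^k functions *)

Section chain_rule.
Context {R : realType} {V : normedModType R}.
Implicit Types (f : V -> R) (x v : V).

Lemma derive_line (f : V -> R) x v :
  'D_v f x = 'D_1 (fun h : R => f (h *: v + x)) 0.
Proof.
rewrite /derive; set g1 := fun h => h^-1 *: _; set g2 := fun h => h^-1 *: _.
suff -> : g1 = g2 by [].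
by rewrite funeqE /g1 /g2 => h /=; rewrite addr0 scale0r add0r [_%:A]mulr1.
Qed.

(** On the line through [x] with direction [v] this is the chain rule in one variable. *)
Lemma is_derive_comp (g : R -> R) f x v (g' : R) :
  is_derive (f x) 1 g g' -> derivable f x v ->
  is_derive x v (g \o f) (g' * 'D_v f x).
Proof.
move=> [dg <-] df.
have df1 := (derivable1P _ _ _).1 df.
have dg1 : derivable g (f (0 *: v + x)) 1 by rewrite scale0r add0r.
apply: DeriveDef.
  apply/derivable1P/derivable1_diffP.
  apply: (@differentiable_comp _ _ _ _ (fun h : R => f (h *: v + x)) g);
    exact/derivable1_diffP.
rewrite derive_line -derive1E (derive1_comp df1 dg1).
by rewrite !derive1E scale0r add0r -derive_line.
Qed.

End chain_rule.

Section line.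
Context {R : realType} {V : normedModType R}.
Implicit Types (f : V -> R) (x v : V).

Lemma is_derive_along f x v (h : R) :
  derivable f (h *: v + x) v ->
  is_derive h 1 (fun h : R => f (h *: v + x)) ('D_v f (h *: v + x)).
Proof.
move=> df.
have E : (fun k : R => k^-1 *: (((fun t : R => f (t *: v + x)) \o shift h) (k *: 1)
             - f (h *: v + x))) =
         (fun k : R => k^-1 *: ((f \o shift (h *: v + x)) (k *: v) - f (h *: v + x))).
  by apply/funext => k /=; rewrite [_%:A]mulr1 addrA -scalerDl.
by apply: DeriveDef; rewrite /derivable /derive E.
Qed.

End line.

Section Ck_calculus.
Context {R : realType} {n : nat}.
Implicit Types (U V : set 'rV[R]_n) (f g : 'rV[R]_n -> R) (x : 'rV[R]_n).

Lemma open_near_eq U f g x : open U -> U x ->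
  (forall y, U y -> f y = g y) -> \forall y \near x, f y = g y.
Proof.
move=> oU Ux fg; have : nbhs x U by exact: open_nbhs_nbhs.
by apply: filterS => y /fg.
Qed.

Lemma pd_ext U f g x (i : 'I_n) : open U -> U x ->
  (forall y, U y -> f y = g y) -> pd i f x = pd i g x.
Proof.
by move=> oU Ux fg; apply: near_eq_derive; exact: open_near_eq oU Ux fg.
Qed.

Lemma derivable_ext U f g x v : open U -> U x ->
  (forall y, U y -> f y = g y) -> derivable f x v -> derivable g x v.
Proof.
by move=> oU Ux fg; apply: near_eq_derivable; exact: open_near_eq oU Ux fg.
Qed.

Lemma continuous_ext U f g x : open U -> U x ->
  (forall y, U y -> f y = g y) ->
  {for x, continuous f} -> {for x, continuous g}.
Proof.
move=> oU Ux fg; rewrite /prop_for /continuous_at -fg// => fx.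
exact: cvg_trans (@near_eq_cvg _ _ (nbhs x) _ _ _ (open_near_eq oU Ux fg)) fx.
Qed.

Lemma Ck_continuous k U f x : Ck_on k U f -> U x -> {for x, continuous f}.
Proof. by case: k => [|k] [cf _]; exact: cf. Qed.

Lemma Ck_derivable k U f x i : Ck_on k.+1 U f -> U x ->
  derivable f x (delta_mx 0 i).
Proof. by move=> [_ /(_ i)[df _]]; exact: df. Qed.

Lemma Ck_pd k U f i : Ck_on k.+1 U f -> Ck_on k U (pd i f).
Proof. by move=> [_ /(_ i)[]]. Qed.

Lemma Ck_ext k U f g : open U -> (forall x, U x -> f x = g x) ->
  Ck_on k U f -> Ck_on k U g.
Proof.
move=> oU; elim: k f g => [|k IH] f g fg [cf df]; split => //.
- by move=> x Ux; apply: (continuous_ext oU Ux fg); exact: cf.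
- by move=> x Ux; apply: (continuous_ext oU Ux fg); exact: cf.
- move=> i; have [dfi Cfi] := df i; split.
    by move=> x Ux; apply: (derivable_ext oU Ux fg); exact: dfi.
  by apply: IH Cfi => x Ux; exact: (pd_ext _ oU Ux fg).
Qed.

Lemma CkW k U f : Ck_on k.+1 U f -> Ck_on k U f.
Proof.
elim: k f => [|k IH] f [cf df]; split => // i.
by have [dfi Cfi] := df i; split => //; exact: IH.
Qed.

Lemma Ck_subset k U V f : V `<=` U -> Ck_on k U f -> Ck_on k V f.
Proof.
move=> VU; elim: k f => [|k IH] f [cf df]; split => //.
- by move=> x /VU; exact: cf.
- by move=> x /VU; exact: cf.
- move=> i; have [dfi Cfi] := df i; split; last exact: IH.
  by move=> x /VU; exact: dfi.
Qed.

Lemma Ck_setU k U V f : Ck_on k U f -> Ck_on k V f -> Ck_on k (U `|` V) f.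
Proof.
elim: k f => [|k IH] f [cU dU] [cV dV]; split => //.
- by move=> x [/cU|/cV].
- by move=> x [/cU|/cV].
- move=> i; have [dUi CUi] := dU i; have [dVi CVi] := dV i; split.
    by move=> x [/dUi|/dVi].
  exact: IH.
Qed.

Lemma Ck_cst k U (c : R) : Ck_on k U (cst c).
Proof.
have Hc (d : R) x : U x -> {for x, continuous (cst d : 'rV[R]_n -> R)}.
  by move=> _; exact: (@cst_continuous 'rV[R]_n R d x).
elim: k c => [|k IH] c; first by split; first exact: Hc.
split; first exact: Hc.
move=> i; split.
  by move=> x _; exact: derivable_cst.
rewrite (_ : pd i (cst c) = cst 0)//.
by apply/funext => x; exact: derive_cst.
Qed.

Lemma is_derive_coord x v (j : 'I_n) :
  is_derive x v (fun y : 'rV[R]_n => y 0 j) (v 0 j).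
Proof.
apply: DeriveDef; first exact/diff_derivable/differentiable_coord.
apply: cvg_lim => //; apply: (@cvg_trans _ ((fun _ : R => v 0 j) @ 0^')); last exact: cvg_cst.
apply: near_eq_cvg; near=> h => /=.
rewrite /shift/= !mxE addrK scalerA mulVf ?scale1r//.
by near: h; exact: nbhs_dnbhs_neq.
Unshelve. all: by end_near. Qed.

Lemma Ck_coord k U (j : 'I_n) : Ck_on k U (fun x => x 0 j).
Proof.
case: k => [|k]; split => //.
- by move=> x _; exact: coord_continuous.
- by move=> x _; exact: coord_continuous.
- move=> i; split; first by move=> x _; have [] := is_derive_coord x (delta_mx 0 i) j.
  rewrite (_ : pd i _ = cst ((delta_mx 0 i : 'rV[R]_n) 0 j)); first exact: Ck_cst.
  by apply/funext => x; rewrite /pd; have [_ ->] := is_derive_coord x (delta_mx 0 i) j.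
Qed.

Lemma CkD k U f g : open U -> Ck_on k U f -> Ck_on k U g ->
  Ck_on k U (fun x => f x + g x).
Proof.
move=> oU; elim: k f g => [|k IH] f g Cf Cg; split => //.
- by move=> x Ux; apply: continuousD; [exact: Ck_continuous Cf Ux|exact: Ck_continuous Cg Ux].
- by move=> x Ux; apply: continuousD; [exact: Ck_continuous Cf Ux|exact: Ck_continuous Cg Ux].
- move=> i; split.
    by move=> x Ux; apply: derivableD; [exact: Ck_derivable Cf Ux|exact: Ck_derivable Cg Ux].
  apply: Ck_ext oU _ (IH _ _ (Ck_pd i Cf) (Ck_pd i Cg)) => x Ux.
  by apply/esym/deriveD; [exact: Ck_derivable Cf Ux|exact: Ck_derivable Cg Ux].
Qed.

Lemma pdM f g x i : derivable f x (delta_mx 0 i) -> derivable g x (delta_mx 0 i) ->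
  pd i (fun x => f x * g x) x = f x * pd i g x + g x * pd i f x.
Proof. by move=> df dg; exact: deriveM. Qed.

Lemma CkM k U f g : open U -> Ck_on k U f -> Ck_on k U g ->
  Ck_on k U (fun x => f x * g x).
Proof.
move=> oU; elim: k f g => [|k IH] f g Cf Cg; split => //.
- by move=> x Ux; apply: continuousM; [exact: Ck_continuous Cf Ux|exact: Ck_continuous Cg Ux].
- by move=> x Ux; apply: continuousM; [exact: Ck_continuous Cf Ux|exact: Ck_continuous Cg Ux].
- move=> i; split.
    by move=> x Ux; apply: derivableM; [exact: Ck_derivable Cf Ux|exact: Ck_derivable Cg Ux].
  have := CkD oU (IH _ _ (CkW Cf) (Ck_pd i Cg)) (IH _ _ (CkW Cg) (Ck_pd i Cf)).
  apply: Ck_ext oU _ => x Ux.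
  by apply/esym/pdM; [exact: Ck_derivable Cf Ux|exact: Ck_derivable Cg Ux].
Qed.

Lemma CkN k U f : open U -> Ck_on k U f -> Ck_on k U (fun x => - f x).
Proof.
move=> oU Cf; apply: (Ck_ext oU _ (CkM oU (Ck_cst k U (-1)) Cf)) => x _.
by rewrite /= mulN1r.
Qed.

Lemma CkB k U f g : open U -> Ck_on k U f -> Ck_on k U g ->
  Ck_on k U (fun x => f x - g x).
Proof. by move=> oU Cf Cg; apply: CkD => //; exact: CkN. Qed.

Lemma Ck_sum k U m (F : 'I_m -> 'rV[R]_n -> R) : open U ->
  (forall i, Ck_on k U (F i)) -> Ck_on k U (fun x => \sum_i F i x).
Proof.
move=> oU CF; rewrite (_ : (fun x => _) = \sum_i F i); last first.
  by apply/funext => x; rewrite fct_sumE.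
elim/big_ind : _ => // [|f g Cf Cg]; first exact: Ck_cst.
exact: (CkD oU Cf Cg).
Qed.

(** A family [G] of functions of one variable that is stable under differentiation
consists of smooth functions, and the derivative of [g \o f] is [g' \o f] times that of
[f]; so the induction on [k] runs over all members of [G] at once. *)
Lemma Ck_comp k U f (D : set R) (G : set (R -> R)) (g : R -> R) :
  open U -> (forall g : R -> R, G g -> exists2 g', G g' & forall t, D t -> is_derive t 1 g (g' t)) ->
  G g -> (forall x, U x -> D (f x)) -> Ck_on k U f -> Ck_on k U (g \o f).
Proof.
move=> oU HG Gg fD Cf; elim: k g Gg Cf => [|k IH] g Gg Cf; split => //.
- have [g' _ dg] := HG _ Gg; move=> x Ux; apply: continuous_comp.
    exact: Ck_continuous Cf Ux.
  by apply/differentiable_continuous/derivable1_diffP; have [] := dg _ (fD _ Ux).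
- have [g' _ dg] := HG _ Gg; move=> x Ux; apply: continuous_comp.
    exact: Ck_continuous Cf Ux.
  by apply/differentiable_continuous/derivable1_diffP; have [] := dg _ (fD _ Ux).
- have [g' Gg' dg] := HG _ Gg.
  move=> i; have dgf x : U x -> is_derive x (delta_mx 0 i : 'rV_n) (g \o f)
      (g' (f x) * pd i f x).
    by move=> Ux; apply: is_derive_comp; [exact/dg/fD|exact: Ck_derivable Cf Ux].
  split => [x Ux|]; first by have [] := dgf _ Ux.
  apply: Ck_ext oU _ (CkM oU (IH _ Gg' (CkW Cf)) (Ck_pd i Cf)) => x Ux.
  by rewrite /= /pd; have [_ ->] := dgf _ Ux.
Qed.

(** The multiples of powers form a family stable under differentiation. *)
Lemma Ck_powR k U f (p : R) : open U -> (forall x, U x -> 0 < f x) ->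
  Ck_on k U f -> Ck_on k U (fun x => f x `^ p).
Proof.
move=> oU f0 Cf.
apply: (@Ck_comp k U f [set t | 0 < t]
  [set h | exists c q : R, h = (fun t => c * t `^ q)] (fun t => t `^ p)) => //.
- move=> _ [c [q ->]]; exists (fun t => c * q * t `^ (q - 1)); first by exists (c * q), (q - 1).
  move=> t t0; have H := is_derive1_powR q t0.
  apply: is_derive_eq (is_deriveZ c H) _.
  by rewrite /GRing.scale/= mulrA.
- by exists 1, p; apply/funext => t; rewrite mul1r.
Qed.

(** Powers are smooth on positive bases only, hence the detour by [f * (f ^+ 2)^-1]. *)
Lemma CkV k U f : open U -> (forall x, U x -> f x != 0) ->
  Ck_on k U f -> Ck_on k U (fun x => (f x)^-1).
Proof.
move=> oU f0 Cf.
have f2 x : U x -> 0 < f x * f x.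
  by move=> /f0 ?; rewrite -expr2 exprn_even_gt0.
have := CkM oU Cf (Ck_powR (-1) oU f2 (CkM oU Cf Cf)).
apply: Ck_ext => // x Ux; rewrite powRN powRr1 ?ltW ?f2//.
by rewrite invfM mulVKf ?f0.
Qed.

Lemma Ck_sqrt k U f : open U -> (forall x, U x -> 0 < f x) ->
  Ck_on k U f -> Ck_on k U (fun x => Num.sqrt (f x)).
Proof.
move=> oU f0 Cf; apply: Ck_ext oU _ (Ck_powR (2^-1) oU f0 Cf) => x Ux.
by rewrite powR12_sqrt// ltW// f0.
Qed.

Lemma smooth_pd U f i : smooth_on U f -> smooth_on U (pd i f).
Proof. by move=> sf k; exact: Ck_pd (sf k.+1). Qed.

(** Differentiability on a neighbourhood of the closure is more than
differentiability up to the boundary. *)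
Lemma Ck_closureW k U V f : open U -> U `<=` V -> closure U `<=` V -> open V ->
  Ck_on k V f -> Ck_closure k U f.
Proof.
move=> oU UV cUV oV; elim: k f => [|k IH] f Cf; split => //.
- apply: continuous_in_subspaceT => x /set_mem /cUV Vx.
  exact: Ck_continuous Cf Vx.
- apply: continuous_in_subspaceT => x /set_mem /cUV Vx.
  exact: Ck_continuous Cf Vx.
- move=> i; split; first by move=> x /UV; exact: Ck_derivable Cf.
  by exists (pd i f) => //; exact/IH/Ck_pd.
Qed.

End Ck_calculus.

(** * Symmetry of second derivatives *)

Section schwarz.
Context {R : realType} {V : normedModType R}.
Implicit Types (f : V -> R) (x d e : V) (U : set V).

Lemma line_MVT f x e (h : R) : 0 < h ->
  (forall s, 0 <= s <= h -> derivable f (s *: e + x) e) ->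
  exists2 s, 0 <= s <= h & f (h *: e + x) - f x = h * 'D_e f (s *: e + x).
Proof.
move=> h0 df.
have dline s : 0 <= s <= h ->
  is_derive s 1 (fun s : R => f (s *: e + x)) ('D_e f (s *: e + x)).
  by move=> sh; apply: is_derive_along; exact: df.
have [s||s sh] := @MVT _ (fun s : R => f (s *: e + x))
    (fun s => 'D_e f (s *: e + x)) 0 h h0.
- by rewrite in_itv/= => /andP[s0 sh]; apply: dline; rewrite !ltW.
- apply: derivable_within_continuous => s.
  by rewrite in_itv/= => sh; have [] := dline s sh.
rewrite subr0 scale0r add0r => E; exists s.
  by move: sh; rewrite in_itv/= => /andP[s0 sh]; rewrite !ltW.
by rewrite E mulrC.
Qed.

(** The second difference quotient along [e] and [d] tends to the mixed
derivative; it is symmetric in [e] and [d], hence so is the derivative. *)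
Lemma second_difference f x d e U (eps : R) : open U -> U x -> 0 < eps ->
  (forall y, U y -> derivable f y e) ->
  (forall y, U y -> derivable ('D_e f) y d) ->
  {for x, continuous ('D_d ('D_e f))} ->
  \forall h \near 0^'+,
    `|f (h *: e + (h *: d + x)) - f (h *: d + x) - (f (h *: e + x) - f x)
      - h ^+ 2 * 'D_d ('D_e f) x| <= eps * h ^+ 2.
Proof.
move=> oU Ux eps0 df ddf cdf.
have : nbhs x (U `&` [set y | `|'D_d ('D_e f) x - 'D_d ('D_e f) y| < eps]).
  apply: filterI; first exact: open_nbhs_nbhs.
  by move/cvgrPdist_lt : cdf; apply.
move=> /nbhs_normP[r /= r0 Br].
have k0 : 0 < r / (`|d| + `|e| + 1) by rewrite divr_gt0// ltr_wpDl// addr_ge0.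
near=> h.
have h0 : 0 < h by near: h; exact: nbhs_right_gt.
have hr : h * (`|d| + `|e| + 1) < r.
  by rewrite -ltr_pdivlMr ?ltr_wpDl ?addr_ge0//; near: h; exact: nbhs_right_lt.
have small s t : 0 <= s <= h -> 0 <= t <= h ->
  (U `&` [set y | `|'D_d ('D_e f) x - 'D_d ('D_e f) y| < eps])
    (t *: d + (s *: e + x)).
  move=> /andP[s0 sh] /andP[t0 th]; apply: Br => /=.
  rewrite addrA opprD [- _ - x]addrC addrA subrr sub0r normrN.
  apply: le_lt_trans (ler_normD _ _) _; rewrite !normrZ !ger0_norm//.
  apply: le_lt_trans hr; apply: (@le_trans _ _ (h * `|d| + h * `|e|)).
    by rewrite lerD// ler_wpM2r.
  by rewrite !mulrDr mulr1 lerDl ltW.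
have zh : 0 <= (0 : R) <= h by rewrite lexx ltW.
have Us s : 0 <= s <= h -> U (s *: e + x).
  by move=> sh; have [] := small _ _ sh zh; rewrite scale0r add0r.
have Ush s : 0 <= s <= h -> U (h *: d + (s *: e + x)).
  by move=> sh; have [] := small _ h sh; rewrite ?lexx ?ltW.
pose g := fun y => f (h *: d + y) - f y.
have shift_line (F : V -> R) y v (c : V) :
    derivable F (c + y) v -> is_derive y v (fun y => F (c + y)) ('D_v F (c + y)).
  move=> dF.
  have E : (fun t : R => F (c + (t *: v + y))) = (fun t : R => F (t *: v + (c + y))).
    by apply/funext => t /=; congr F; rewrite addrCA.
  apply: DeriveDef.
    by apply/derivable1P; rewrite E; exact: (derivable1P _ _ _).1.
  by rewrite derive_line E [RHS]derive_line.
have dg y : U y -> U (h *: d + y) ->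
    is_derive y e g ('D_e f (h *: d + y) - 'D_e f y).
  move=> Uy Uhy; have H1 := shift_line f y e (h *: d) (df _ Uhy).
  by have H2 := derivableP (df _ Uy); exact: is_deriveB.
have [s sh gE] : exists2 s, 0 <= s <= h &
    g (h *: e + x) - g x = h * 'D_e g (s *: e + x).
  apply: (@line_MVT g x e) => // s sh.
  by have [] := dg _ (Us _ sh) (Ush _ sh).
have [t th fE] : exists2 t, 0 <= t <= h &
    'D_e f (h *: d + (s *: e + x)) - 'D_e f (s *: e + x) =
    h * 'D_d ('D_e f) (t *: d + (s *: e + x)).
  apply: (@line_MVT ('D_e f) (s *: e + x) d _ h0).
  move=> t th.
  exact: ddf (small _ _ sh th).1.
have [_ E2] := dg _ (Us _ sh) (Ush _ sh).
move: gE; rewrite E2 fE /g addrCA => E.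
have -> : f (h *: e + (h *: d + x)) - f (h *: d + x) - (f (h *: e + x) - f x) =
  h ^+ 2 * 'D_d ('D_e f) (t *: d + (s *: e + x)).
  by rewrite expr2 -mulrA -E; ring.
rewrite -mulrBr normrM ger0_norm ?sqr_ge0// mulrC ler_wpM2r ?sqr_ge0//.
by rewrite distrC; exact/ltW/(small _ _ sh th).2.
Unshelve. all: by end_near. Qed.

End schwarz.

Lemma pdC {R : realType} n (U : set 'rV[R]_n) f x i j : open U -> U x ->
  Ck_on 2 U f -> pd i (pd j f) x = pd j (pd i f) x.
Proof.
move=> oU Ux Cf; set a := pd i _ x; set b := pd j _ x.
have H (k l : 'I_n) eps : 0 < eps -> \forall h \near 0^'+,
   let e := delta_mx 0 k in let d := delta_mx 0 l in
    `|f (h *: e + (h *: d + x)) - f (h *: d + x) - (f (h *: e + x) - f x)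
      - h ^+ 2 * pd l (pd k f) x| <= eps * h ^+ 2.
  move=> eps0; apply: (second_difference oU) => //.
  - by move=> y; exact: Ck_derivable (CkW Cf).
  - by move=> y; exact: Ck_derivable (Ck_pd _ Cf).
  - exact: Ck_continuous (Ck_pd _ (Ck_pd _ Cf)) Ux.
apply/eqP; rewrite -subr_eq0 -normr_le0; apply/ler_addgt0Pr => eps eps0.
have e20 : 0 < eps / 2 by rewrite divr_gt0.
have [h [h0 [/= H1 H2]]] :=
  filter_ex (filterI (nbhs_right_gt 0) (filterI (H j i _ e20) (H i j _ e20))).
rewrite /= in h0.
rewrite add0r -(ler_pM2r (exprn_gt0 2 h0)).
rewrite -[h ^+ 2 in leLHS](ger0_norm (sqr_ge0 h)) -normrM.
move: H1 H2; rewrite -/a -/b.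
rewrite [h *: delta_mx 0 j + _]addrCA.
set B := f (_ + (_ + _)); set C := f (h *: delta_mx 0 i + x).
set D := f (h *: delta_mx 0 j + x) => H1 H2.
have -> : (a - b) * h ^+ 2 = (B - D - (C - f x) - h ^+ 2 * b)
    - (B - C - (D - f x) - h ^+ 2 * a) by ring.
apply: le_trans (ler_normB _ _) _.
rewrite [eps]splitr mulrDl; exact: lerD H2 H1.
Qed.

(** * Smooth cutoff functions *)

Section flat_function.
Context {R : realType}.
Implicit Types (p : {poly R}) (t : R).

(** Polynomials in 1/t times exp(-1/t), extended by zero to t <= 0. *)
Definition flat p t : R := if 0 < t then p.[t^-1] * expR (- t^-1) else 0.

Lemma exprn_le_expR (y : R) n : 0 <= y -> y ^+ n <= n`!%:R * expR y.
Proof.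
case: n => [|n] y0; first by rewrite mul1r expr0; apply: le_trans (expR_ge1Dx y); rewrite lerDl.
have := expR_ge1Dxn n y0; rewrite -(ler_pM2l (_ : 0 < n.+1`!%:R)) ?ltr0n ?fact_gt0//.
apply: le_trans; rewrite mulrDr mulr1 mulrC divfK ?lerDr// pnatr_eq0 -lt0n fact_gt0//.
Qed.

(** The exponent 2 makes [flat p] flat enough at the origin for its derivative to
vanish there. *)
Lemma flat_bound p : exists2 C, 0 <= C & forall t, 0 < t -> `|flat p t| <= C * t ^+ 2.
Proof.
(* From y ^+ (i + 2) <= (i + 2)! * expR y at y = t^-1, coefficient by coefficient. *)
exists (\sum_(i < size p) `|p`_i| * (i + 2)`!%:R).
  by apply: sumr_ge0 => i _; rewrite mulr_ge0.
move=> t t0; rewrite /flat t0 normrM (ger0_norm (expR_ge0 _)).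
have y0 : 0 < t^-1 by rewrite invr_gt0.
rewrite -[t in leRHS]invrK exprVn expRN ler_pdivlMr ?exprn_gt0//.
rewrite mulrAC ler_pdivrMr ?expR_gt0// mulr_suml.
apply: (@le_trans _ _ ((\sum_(i < size p) `|p`_i * t^-1 ^+ i|) * t^-1 ^+ 2)).
  by rewrite ler_wpM2r ?exprn_ge0 ?(ltW y0)// horner_coef ler_norm_sum.
rewrite mulr_suml ler_sum// => i _; rewrite normrM normrX (ger0_norm (ltW y0)).
rewrite -!mulrA ler_wpM2l// -exprD; exact/exprn_le_expR/ltW.
Qed.

(** The family of all [flat p] is stable under differentiation, as [Ck_comp] requires. *)
Lemma is_derive_flat p t :
  is_derive t 1 (flat p) (flat ('X^2 * (p - p^`())) t).
Proof.
have [t0|t0|->] := ltgtP t 0.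
- rewrite [X in is_derive _ _ _ X]/flat ltNge ltW//=.
  apply: (@near_eq_is_derive _ _ _ (cst 0)).
  near=> s; rewrite /flat ltNge ltW//.
  by near: s; exact: lt_nbhsl.
- rewrite [X in is_derive _ _ _ X]/flat t0.
  have tn0 : t != 0 by rewrite gt_eqF.
  have near_flat : \forall s \near t, p.[s^-1] * expR (- s^-1) = flat p s.
    near=> s; rewrite /flat ifT//.
    by near: s; exact: lt_nbhsr.
  have dV : is_derive t 1 (fun s : R => s^-1) (- t ^- 2).
    apply: DeriveDef; first by apply: derivableV => //; exact: derivable_id.
    rewrite (deriveV tn0 (@derivable_id _ _ t 1)).
    by rewrite derive_id /GRing.scale/= mulr1.
  have dp : is_derive t 1 ((horner p) \o (fun s : R => s^-1)) (p^`().[t^-1] * - t ^- 2).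
    have dp : is_derive t^-1 1 (horner p) (p^`().[t^-1]).
      by rewrite derivE derive1E; apply/derivableP/derivable_horner.
    exact: (is_derive1_comp dp dV).
  have de : is_derive t 1 (expR \o (fun s : R => - s^-1)) (expR (- t^-1) * t ^- 2).
    have dN : is_derive t 1 (fun s : R => - s^-1) (t ^- 2).
      by rewrite -[t ^- 2]opprK; exact: is_deriveN.
    exact: (@is_derive1_comp _ expR (fun s : R => - s^-1) t _ _ (is_derive_expR _) dN).
  apply: (near_eq_is_derive near_flat).
  apply: is_derive_eq (is_deriveM dp de) _.
  rewrite /= !hornerE /GRing.scale/=.
  by rewrite exprVn; ring.
- rewrite [X in is_derive _ _ _ X]/flat ltxx.
  have [C C0 HC] := flat_bound p.
  suff H : h^-1 *: ((flat p \o shift 0) (h *: 1) - flat p 0) @[h --> 0^'] --> (0 : R).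
    by apply: DeriveDef; [apply/cvg_ex; exists 0|exact: cvg_lim H].
  apply/cvgrPdist_le => e e0; near=> h.
  rewrite /shift/= addr0 [flat p 0]/flat ltxx subr0 sub0r normrN.
  rewrite /GRing.scale/= mulr1 normrM.
  have hn0 : h != 0 by near: h; exact: nbhs_dnbhs_neq.
  have [h0|h0] := ltP 0 h; last by rewrite [flat p h]/flat ltNge h0 normr0 mulr0 ltW.
  rewrite normfV (gtr0_norm h0) mulrC ler_pdivrMr//.
  apply: le_trans (HC _ h0) _; rewrite expr2 mulrA ler_pM2r//.
  apply: (@le_trans _ _ (h * (C + 1))).
    by rewrite mulrC ler_wpM2l ?lerDl// ltW.
  rewrite -ler_pdivlMr ?ltr_wpDl//; apply: le_trans (ler_norm _) _.
  by near: h; apply: dnbhs0_le; rewrite divr_gt0// ltr_wpDl.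
Unshelve. all: by end_near. Qed.

Lemma Ck_flat k n (U : set 'rV[R]_n) f p : open U ->
  Ck_on k U f -> Ck_on k U (fun x => flat p (f x)).
Proof.
move=> oU; apply: (@Ck_comp _ _ _ _ _ setT (range flat) (flat p)) => //.
move=> _ [q _ <-]; exists (flat ('X^2 * (q - q^`()))) => // t _.
exact: is_derive_flat.
Qed.

Lemma flat1_gt0 t : 0 < t -> 0 < flat 1 t.
Proof. by move=> t0; rewrite /flat t0 hornerC mul1r expR_gt0. Qed.

Lemma flat1_ge0 t : 0 <= flat 1 t.
Proof. by rewrite /flat; case: ifP => // _; rewrite hornerC mul1r expR_ge0. Qed.

Lemma flat_le0 p t : t <= 0 -> flat p t = 0.
Proof. by move=> t0; rewrite /flat ltNge t0. Qed.

End flat_function.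

Section cutoff.
Context {R : realType} {n : nat}.
Implicit Types (U K : set 'rV[R]_n) (p x : 'rV[R]_n).

Lemma sqdist_smooth p k : Ck_on k setT (fun x => \sum_i (x 0 i - p 0 i) ^+ 2).
Proof.
apply: Ck_sum => [|i]; first exact: openT.
have H : Ck_on k setT (fun x : 'rV[R]_n => x 0 i - p 0 i).
  by apply: CkB; [exact: openT|exact: Ck_coord|exact: Ck_cst].
exact: (CkM openT H H).
Qed.

(** With [q] the squared distance to [p], the quotient of [flat 1 (s - q)] by
[flat 1 (s - q) + flat 1 (q - s / 4)] is 1 where [q <= s / 4] and 0 where [s <= q]; the
denominator is positive because [s / 4 < s]. *)
Lemma bump_exists U p : open U -> U p -> exists b : 'rV[R]_n -> R,
  [/\ smooth_on setT b, \forall x \near p, b x = 1 &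
      closure [set x | b x != 0] `<=` U].
Proof.
move=> oU Up; have [r /= r0 pr] : nbhs_ball p U.
  by apply/nbhs_ballP; exact: open_nbhs_nbhs.
pose q x := \sum_i (x 0 i - p 0 i) ^+ 2.
have q0 x : 0 <= q x by apply: sumr_ge0 => i _; exact: sqr_ge0.
pose s := (r / 2) ^+ 2.
have s0 : 0 < s by rewrite exprn_gt0// divr_gt0.
have Cq k : Ck_on k setT q := sqdist_smooth p k.
have cq : continuous q by move=> x; exact: Ck_continuous (Cq 0%N) I.
pose den x := flat 1 (s - q x) + flat 1 (q x - s / 4).
have den0 x : 0 < den x.
  have [qs|sq] := ltP (q x) s.
    by rewrite ltr_pwDl// ?flat1_ge0// flat1_gt0// subr_gt0.
  rewrite ltr_wpDl ?flat1_ge0// flat1_gt0// subr_gt0; apply: lt_le_trans sq.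
  by rewrite ltr_pdivrMr// ltr_pMr// ltr1n.
exists (fun x => flat 1 (s - q x) * (den x)^-1); split.
- move=> k.
  have C1 : Ck_on k setT (fun x => flat 1 (s - q x)).
    apply: Ck_flat; first exact: openT.
    by apply: CkB; [exact: openT|exact: Ck_cst|].
  apply: CkM; [exact: openT|by []|].
  apply: CkV; [exact: openT|by move=> x _; rewrite gt_eqF|].
  apply: CkD; [exact: openT|by []|].
  apply: Ck_flat; first exact: openT.
  by apply: CkB; [exact: openT|by []|exact: Ck_cst].
- have : \forall x \near p, q x < s / 4.
    apply: (cvgr_lt _ (cq p)).
    rewrite /q big1 ?divr_gt0// => i _; by rewrite subrr expr0n.
  apply: filterS => x qx; rewrite /den.
  rewrite [flat 1 (q x - s / 4)]flat_le0 ?subr_le0 ?ltW// addr0 divff//.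
  rewrite gt_eqF// flat1_gt0// subr_gt0 (lt_le_trans qx)//.
  by rewrite ler_pdivrMr// ler_pMr// ler1n.
- have sub : closure [set x | flat 1 (s - q x) * (den x)^-1 != 0]
      `<=` [set x | q x <= s].
    have cl : closed [set x | q x <= s].
      exact: (closed_comp (fun x _ => cq x) (@closed_le _ s)).
    rewrite [X in _ `<=` X]((closure_id _).1 cl).
    apply: closure_subset => x /=; rewrite leNgt; apply: contraNN => sq.
    by rewrite flat_le0 ?mul0r// subr_le0 ltW.
  apply: subset_trans sub _ => x /= qs; apply: pr; split=> // i j.
  rewrite ord1 /ball/= distrC.
  have : (x 0 j - p 0 j) ^+ 2 <= s.
    apply: le_trans qs; rewrite /q (bigD1 j)//= lerDl.
    by apply: sumr_ge0 => k _; exact: sqr_ge0.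
  rewrite -[leLHS]real_normK ?num_real// /s ler_sqr ?nnegrE//; last first.
    by rewrite divr_ge0// ltW.
  by move/le_lt_trans; apply; rewrite ltr_pdivrMr// ltr_pMr// ltr1n.
Qed.

Lemma compact_nbhs_cover (K : set 'rV[R]_n) (N : 'rV[R]_n -> set 'rV[R]_n) :
  compact K -> (forall p, K p -> nbhs p (N p)) ->
  exists2 s : seq 'rV[R]_n, (forall p, p \in s -> K p) &
    forall x, K x -> exists2 p, p \in s & N p x.
Proof.
rewrite compact_cover => cK KN.
have [||D DK KD] := cK _ K (fun p => (N p)^°).
- by move=> p _; exact: open_interior.
- by move=> p Kp; exists p => //; exact: KN.
exists (finmap.enum_fset D); first by move=> p /DK /set_mem.
by move=> x /KD[p pD /interior_subset Npx]; exists p.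
Qed.

(** Starting from 0, replace [g] by [b f + (1 - b) g] for each bump function [b] of a
finite cover of [K]: this creates the value [f] where [b = 1] and keeps it wherever it
was reached before. *)
Lemma smooth_extension U K (f : 'rV[R]_n -> R) : open U -> compact K ->
  K `<=` U -> smooth_on U f ->
  exists g, [/\ smooth_on setT g, forall x, K x -> g x = f x &
                forall x, ~ U x -> g x = 0].
Proof.
move=> oU cK KU sf.
have /choice[b bP] p : exists b : 'rV[R]_n -> R, K p ->
  [/\ smooth_on setT b, \forall x \near p, b x = 1 &
      closure [set x | b x != 0] `<=` U].
  have [Kp|nKp] := pselect (K p); last by exists (cst 0).
  by have [b bP] := bump_exists oU (KU _ Kp); exists b.
have [s sK Ks] := compact_nbhs_cover (N := fun p => [set x | b p x = 1]) cK
  (fun p Kp => let: And3 _ H _ := bP p Kp in H).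
suff [g [sg gf g0]] : exists g, [/\ smooth_on setT g,
    forall x p, p \in s -> b p x = 1 -> g x = f x & forall x, ~ U x -> g x = 0].
  by exists g; split=> // x /Ks[p ps bpx]; exact: gf bpx.
elim: s sK {Ks} => [_|p s IH sK].
  by exists (cst 0); split=> // k; exact: Ck_cst.
have [|g [sg gf g0]] := IH; first by move=> x xs; apply: sK; rewrite in_cons xs orbT.
have [sb _ bU] := bP p (sK _ (mem_head _ _)).
exists (fun x => b p x * f x + (1 - b p x) * g x); split.
- move=> k; apply: CkD; first exact: openT; last first.
    apply: CkM; [exact: openT| |exact: sg].
    by apply: CkB; [exact: openT|exact: Ck_cst|exact: sb].
  pose W := ~` closure [set x | b p x != 0].
  have oW : open W by exact/closed_openC/closed_closure.
  rewrite (_ : setT = U `|` W); last first.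
    apply/esym/seteqP; split=> // x _.
    by have [/bU|] := pselect (closure [set x | b p x != 0] x); [left|right].
  apply: Ck_setU.
    by apply: CkM => //; exact: Ck_subset (sb k).
  apply: (Ck_ext oW _ (Ck_cst k W 0)) => x Wx.
  have [->|bx] := eqVneq (b p x) 0; first by rewrite mul0r.
  by exfalso; apply: Wx; exact: subset_closure.
- move=> x q; rewrite in_cons => /predU1P[->|qs] bx; first by rewrite bx subrr mul0r addr0 mul1r.
  by rewrite (gf _ q)//; ring.
- move=> x nUx; rewrite g0// mulr0 addr0.
  have [->|bx] := eqVneq (b p x) 0; first by rewrite mul0r.
  by exfalso; apply/nUx/bU/subset_closure.
Qed.

End cutoff.

(** * Integrals along a direction *)

Section line_integral.
Context {R : realType} {n : nat} (e : 'rV[R]_n) (S : R) (S0 : 0 < S).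
Implicit Types (g : 'rV[R]_n -> R) (x d : 'rV[R]_n).
Let mu := @lebesgue_measure R.

Lemma line_MVT_signed g x d (h : R) : (forall y, derivable g y d) ->
  exists2 t, `|t| <= `|h| & g (h *: d + x) - g x = h * 'D_d g (t *: d + x).
Proof.
move=> dg; have [h0|h0|->] := ltgtP h 0.
- have [||s /andP[s0 sh] E] := @line_MVT _ _ g (h *: d + x) d (- h).
  + by rewrite oppr_gt0.
  + by move=> s _; exact: dg.
  exists (s + h).
    rewrite (ltr0_norm h0) ler0_norm; last by rewrite -lerBrDr sub0r.
    by rewrite opprD gerDr oppr_le0.
  move: E; rewrite addrA -scalerDl addNr scale0r add0r addrA -scalerDl => E.
  by rewrite -[LHS]opprB E mulNr opprK.
- have [|s /andP[s0 sh] E] := @line_MVT _ _ g x d h h0.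
    by move=> s _; exact: dg.
  by exists s => //; rewrite !ger0_norm// ltW.
- by exists 0 => //; rewrite !scale0r add0r subrr mul0r.
Qed.

Lemma line_continuous g x : continuous g ->
  continuous (fun s : R => g (s *: e + x)).
Proof.
move=> cg s; apply: (@continuous_comp _ _ _ (fun s : R => s *: e + x) g).
  by apply: cvgD; [apply: cvgZr_tmp; exact: cvg_id|exact: cvg_cst].
exact: cg.
Qed.

(** Compactness of the segment [[0, S]]. *)
Lemma line_uniform g x eps : continuous g -> 0 < eps ->
  \forall y \near x, forall s, 0 <= s <= S ->
    `|g (s *: e + y) - g (s *: e + x)| < eps.
Proof.
move=> cg e0; have e20 : 0 < eps / 2 by rewrite divr_gt0.
have /compact_near_coveringP cK := @segment_compact R 0 S.
have := cK _ (nbhs x) (fun y s => `|g (s *: e + y) - g (s *: e + x)| < eps) _.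
move=> /(_ _) H; have {}H := H _.
suff : \forall y \near x,
    `[0, S] `<=` (fun s => `|g (s *: e + y) - g (s *: e + x)| < eps).
  by apply: filterS => y yS s sS; apply: yS; rewrite /= in_itv.
apply: H => s _.
have cgs : continuous (fun p : R * 'rV[R]_n => g (p.1 *: e + p.2)).
  move=> p; apply: (@continuous_comp _ _ _ (fun p : R * 'rV[R]_n => p.1 *: e + p.2) g).
    by apply: cvgD; [apply: cvgZr_tmp; exact: cvg_fst|exact: cvg_snd].
  exact: cg.
have /cvgrPdist_lt/(_ _ e20)[[A B] /= [As Bx] AB] := cgs (s, x).
have cl : (fun s : R => g (s *: e + x)) @ s --> g (s *: e + x).
  exact: (line_continuous (x := x) cg).
have /cvgrPdist_lt/(_ _ e20) H2 := cl.
exists (A `&` [set t | `|g (s *: e + x) - g (t *: e + x)| < eps / 2], B) => /=.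
  by split => //; exact: filterI.
move=> [t y] /= [[At H3] By].
have -> : g (t *: e + y) - g (t *: e + x) =
  (g (s *: e + x) - g (t *: e + x)) - (g (s *: e + x) - g (t *: e + y)) by ring.
apply: le_lt_trans (ler_normB _ _) _; rewrite [eps]splitr ltrD//.
exact: (AB (t, y)).
Qed.

Definition line_integral g x := \int[mu]_(s in `[0, S]) g (s *: e + x).

Lemma line_integrable g x : continuous g ->
  mu.-integrable `[0, S] (EFin \o (fun s => g (s *: e + x))).
Proof.
move=> cg; apply: continuous_compact_integrable; first exact: segment_compact.
exact/continuous_subspaceT/line_continuous.
Qed.

Lemma line_integral_dist (F G : R -> R) eps : 0 <= eps ->
  mu.-integrable `[0, S] (EFin \o F) -> mu.-integrable `[0, S] (EFin \o G) ->
  (forall s, 0 <= s <= S -> `|F s - G s| <= eps) ->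
  `|\int[mu]_(s in `[0, S]) F s - \int[mu]_(s in `[0, S]) G s| <= eps * S.
Proof.
move=> e0 iF iG FG; rewrite -RintegralB//.
have iFG : mu.-integrable `[0, S] (EFin \o (fun s => F s - G s)).
  rewrite (_ : _ \o _ = (EFin \o F) \- (EFin \o G))%E//; exact: integrableB.
apply: le_trans (le_normr_Rintegral _ iFG) _ => //.
have -> : eps * S = \int[mu]_(s in `[0, S]) eps.
  by rewrite Rintegral_cst//= lebesgue_measure_itv/= lte_fin S0 oppr0 adde0.
apply: le_Rintegral => //.
- exact: (integrable_norm iFG).
- apply: continuous_compact_integrable; first exact: segment_compact.
  by apply: continuous_subspaceT => ?; exact: cvg_cst.
Qed.

Lemma line_integral_continuous g : continuous g -> continuous (line_integral g).
Proof.
move=> cg x; apply/(@cvgrPdist_le _ _ _ (nbhs x)) => eps e0.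
have e1 : 0 < eps / S by rewrite divr_gt0.
have := line_uniform x cg e1; apply: filterS => y xy.
rewrite -[eps](divfK (lt0r_neq0 S0)) distrC; apply: line_integral_dist.
- exact: ltW.
- exact: line_integrable.
- exact: line_integrable.
- by move=> s sS; exact/ltW/xy.
Qed.

(** By the mean value theorem the difference quotients of [g] are values of ['D_d g] at
nearby points, so they converge uniformly along the segment ([line_uniform]). *)
Lemma line_integral_derive g x d : continuous g -> (forall y, derivable g y d) ->
  continuous ('D_d g) -> is_derive x d (line_integral g) (line_integral ('D_d g) x).
Proof.
move=> cg dg cdg.
suff H : (fun h : R => h^-1 * (line_integral g (h *: d + x) - line_integral g x)) @ 0^'
    --> line_integral ('D_d g) x.
  by apply: DeriveDef; [apply/cvg_ex; exists (line_integral ('D_d g) x)|exact: cvg_lim H].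
apply/cvgrPdist_le => eps e0.
have e1 : 0 < eps / S by rewrite divr_gt0.
have /nbhs_normP[r /= r0 Br] := line_uniform x cdg e1.
near=> h.
have hn0 : h != 0 by near: h; exact: nbhs_dnbhs_neq.
pose F1 s := g (s *: e + (h *: d + x)); pose F2 s := g (s *: e + x).
rewrite -RintegralB//; [|exact: line_integrable..].
have iF : mu.-integrable `[0, S] ((EFin \o F1) \- (EFin \o F2))%E.
  by apply: integrableB => //; exact: line_integrable.
rewrite -RintegralZl//.
rewrite -[eps](divfK (lt0r_neq0 S0)); apply: line_integral_dist.
- exact: ltW.
- exact: (line_integrable x cdg).
- by apply: (integrableZl _ h^-1 iF); exact: measurable_itv.
move=> s sS; rewrite [s *: e + (h *: d + x)]addrCA.
have [t th ->] := line_MVT_signed (s *: e + x) h dg.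
rewrite mulKf// distrC addrCA; apply/ltW/Br => //=.
rewrite opprD addrCA subrr addr0 normrN normrZ.
apply: (@le_lt_trans _ _ (`|h| * (`|d| + 1))).
  by apply: ler_pM => //; rewrite lerDl.
rewrite -ltr_pdivlMr ?ltr_wpDl//.
by near: h; apply: dnbhs0_lt; rewrite divr_gt0// ltr_wpDl.
Unshelve. all: by end_near. Qed.

Lemma Ck_line_integral k g : Ck_on k setT g -> Ck_on k setT (line_integral g).
Proof.
elim: k g => [|k IH] g Cg.
  split => // x _; apply: line_integral_continuous => y.
  exact: Ck_continuous Cg I.
have cg : continuous g by move=> y; exact: Ck_continuous Cg I.
have H (i : 'I_n) x := @line_integral_derive g x (delta_mx 0 i) cg
  (fun y => Ck_derivable Cg I)
  (fun y => Ck_continuous (Ck_pd i Cg) I).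
split; first by move=> x _; exact: line_integral_continuous.
move=> i; split; first by move=> x _; have [] := H i x.
apply: (Ck_ext openT _ (IH _ (Ck_pd i Cg))) => x _.
by rewrite [RHS]/pd; have [_ ->] := H i x.
Qed.

Lemma line_integral_FTC g x : continuous g -> (forall y, derivable g y e) ->
  continuous ('D_e g) -> line_integral ('D_e g) x = g (S *: e + x) - g x.
Proof.
move=> cg dg cdg.
have dl (s : R) : is_derive s 1 (fun s : R => g (s *: e + x)) ('D_e g (s *: e + x)).
  exact: is_derive_along.
have cl : continuous (fun s : R => g (s *: e + x)) by exact: line_continuous.
have := @continuous_FTC2 _ (fun s => 'D_e g (s *: e + x))
  (fun s => g (s *: e + x)) 0 S S0.
rewrite scale0r add0r /line_integral /Rintegral => -> //.
- apply: continuous_subspaceT.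
  exact: (@line_continuous ('D_e g) x cdg).
- split.
  + by move=> s _; have [] := dl s.
  + by apply: cvg_at_right_filter; exact: cl.
  + by apply: cvg_at_left_filter; exact: cl.
- by move=> s _; rewrite derive1E; have [_ ->] := dl s.
Qed.

End line_integral.

(** * Vector algebra and vector calculus *)

Section vector_algebra.
Context {R : realType}.

Lemma sum3 (V : nmodType) (F : 'I_3 -> V) : \sum_i F i = F 0 + F 1 + F 2.
Proof.
rewrite !big_ord_recl big_ord0 addr0 addrA.
by congr (_ + _ + _); congr F; apply/val_inj.
Qed.

Lemma I3E : ((0 + 1 : 'I_3) = 1) * ((0 + 2 : 'I_3) = 2) * ((1 + 1 : 'I_3) = 2) *
  ((1 + 2 : 'I_3) = 0) * ((2 + 1 : 'I_3) = 0) * ((2 + 2 : 'I_3) = 1).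
Proof. by do !split; apply/val_inj. Qed.

Lemma dot3 (a b : 'rV[R]_3) : dot a b = a 0 0 * b 0 0 + a 0 1 * b 0 1 + a 0 2 * b 0 2.
Proof. exact: sum3. Qed.

Section any_dimension.
Context {n : nat}.
Implicit Types a b c : 'rV[R]_n.

Lemma dotC a b : dot a b = dot b a.
Proof. by apply: eq_bigr => i _; rewrite mulrC. Qed.

Lemma dotDl a b c : dot (a + b) c = dot a c + dot b c.
Proof. by rewrite -big_split/=; apply: eq_bigr => i _; rewrite mxE mulrDl. Qed.

Lemma dotZl (t : R) a b : dot (t *: a) b = t * dot a b.
Proof. by rewrite /dot mulr_sumr; apply: eq_bigr => i _; rewrite mxE mulrA. Qed.

Lemma dotBl a b c : dot (a - b) c = dot a c - dot b c.
Proof. by rewrite -scaleN1r dotDl dotZl mulN1r. Qed.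

Lemma dotDr a b c : dot a (b + c) = dot a b + dot a c.
Proof. by rewrite dotC dotDl !(dotC a). Qed.

Lemma dotZr (t : R) a b : dot a (t *: b) = t * dot a b.
Proof. by rewrite dotC dotZl dotC. Qed.

Lemma dot_ge0 a : 0 <= dot a a.
Proof. by apply: sumr_ge0 => i _; rewrite -expr2 sqr_ge0. Qed.

Lemma dot0r a b : dot b b = 0 -> dot a b = 0.
Proof.
move=> b0; rewrite /dot big1// => i _.
have : b 0 i * b 0 i == 0.
  move/eqP: b0; rewrite psumr_eq0; last by move=> j _; rewrite -expr2 sqr_ge0.
  by move=> /allP/(_ i); rewrite mem_index_enum => /(_ isT).
by rewrite mulf_eq0 orbb => /eqP ->; rewrite mulr0.
Qed.

Lemma enorm_ge0 a : 0 <= enorm a.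
Proof. exact: sqrtr_ge0. Qed.

Lemma enorm_sqr a : enorm a ^+ 2 = dot a a.
Proof. by rewrite sqr_sqrtr// dot_ge0. Qed.

Lemma cauchy_schwarz a b : `|dot a b| <= enorm a * enorm b.
Proof.
rewrite -ler_sqr ?nnegrE ?mulr_ge0 ?enorm_ge0// real_normK ?num_real//.
rewrite exprMn !enorm_sqr.
have [b0|b0] := eqVneq (dot b b) 0.
  by rewrite dot0r// expr0n b0 mulr0.
have {}b0 : 0 < dot b b by rewrite lt_def b0 dot_ge0.
rewrite -subr_ge0 -(pmulr_rge0 _ b0).
have := dot_ge0 (dot b b *: a - dot a b *: b).
rewrite -scaleNr !(dotDl, dotDr, dotZl, dotZr) (dotC b a).
by congr (0 <= _); ring.
Qed.

Lemma enormZ (t : R) a : enorm (t *: a) = `|t| * enorm a.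
Proof.
by rewrite /enorm dotZl dotZr mulrA -expr2 sqrtrM ?sqr_ge0// sqrtr_sqr.
Qed.

Lemma ler_enormD a b : enorm (a + b) <= enorm a + enorm b.
Proof.
rewrite -ler_sqr ?nnegrE ?addr_ge0 ?enorm_ge0// sqrrD !enorm_sqr.
rewrite dotDl !dotDr (dotC b a).
have := cauchy_schwarz a b; have := ler_norm (dot a b); lra.
Qed.

Lemma ler_coord_enorm a i : `|a 0 i| <= enorm a.
Proof.
rewrite -sqrtr_sqr ler_wsqrtr// /dot (bigD1 i)//= -expr2 lerDl.
by apply: sumr_ge0 => j _; rewrite -expr2 sqr_ge0.
Qed.

End any_dimension.

Lemma cross_cross (a b : 'rV[R]_3) :
  cross a (cross b a) = dot a a *: b - dot a b *: a.
Proof.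
rewrite !dot3; apply/rowP => i; rewrite !mxE.
have [->|->|->] : [\/ i = 0, i = 1 | i = 2].
  case: i => -[|[|[|//]]] h; [apply: Or31|apply: Or32|apply: Or33]; exact: val_inj.
- by rewrite !I3E; ring.
- by rewrite !I3E; ring.
- by rewrite !I3E; ring.
Qed.

End vector_algebra.

Section vector_calculus.
Context {R : realType}.
Implicit Types (U : set 'rV[R]_3) (F w : 'rV[R]_3 -> 'rV[R]_3)
  (c f : 'rV[R]_3 -> R) (x : 'rV[R]_3).

Lemma curl_smooth U w : open U -> smooth_field_on U w -> smooth_field_on U (curl w).
Proof.
move=> oU sw i k; rewrite (_ : component _ i = fun x =>
  pd (i + 1) (component w (i + 2)) x - pd (i + 2) (component w (i + 1)) x).
  by apply: CkB => //; exact: smooth_pd.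
by apply/funext => x; rewrite /component mxE.
Qed.

Lemma dot_smooth n U (F G : 'rV[R]_3 -> 'rV[R]_n) : open U -> smooth_field_on U F ->
  smooth_field_on U G -> smooth_on U (fun x => dot (F x) (G x)).
Proof.
by move=> oU sF sG k; apply: Ck_sum => // i; apply: CkM => //; [exact: sF|exact: sG].
Qed.

Lemma scale_smooth n U c (F : 'rV[R]_3 -> 'rV[R]_n) : open U -> smooth_on U c ->
  smooth_field_on U F -> smooth_field_on U (fun x => c x *: F x).
Proof.
move=> oU sc sF j k; rewrite (_ : component _ j = fun x => c x * component F j x).
  by apply: CkM => //; exact: sF.
by apply/funext => x; rewrite /component mxE.
Qed.

Lemma smooth_derivable U f x i : smooth_on U f -> U x -> derivable f x (delta_mx 0 i).
Proof. by move=> sf; exact: (Ck_derivable (sf 1%N)). Qed.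

(** The term with the gradient of [c] drops out as it is orthogonal to [w]. *)
Lemma dot_curl_scale U w c x : open U -> U x -> smooth_on U c ->
  smooth_field_on U w ->
  dot (curl (fun y => c y *: w y) x) (w x) = c x * dot (curl w x) (w x).
Proof.
move=> oU Ux sc sw.
have E i j : pd i (component (fun y => c y *: w y) j) x =
    c x * pd i (component w j) x + w x 0 j * pd i c x.
  rewrite -[w x 0 j]/(component w j x) -pdM.
  - by congr (pd i _ x); apply/funext => y; rewrite /component mxE.
  - exact: smooth_derivable sc Ux.
  - exact: smooth_derivable (sw j) Ux.
by rewrite !dot3 !mxE !E !I3E; ring.
Qed.

Lemma divergence_curl U w x : open U -> U x -> smooth_field_on U w ->
  divergence (curl w) x = 0.
Proof.
move=> oU Ux sw.
have E i : pd i (component (curl w) i) x =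
    pd i (pd (i + 1) (component w (i + 2))) x - pd i (pd (i + 2) (component w (i + 1))) x.
  rewrite (_ : component _ i = (pd (i + 1) (component w (i + 2)) -
     pd (i + 2) (component w (i + 1)))); last first.
    by apply/funext => y; rewrite /component mxE.
  by apply: deriveB; apply: smooth_derivable Ux; exact: smooth_pd.
have S i j k : pd i (pd j (component w k)) x = pd j (pd i (component w k)) x.
  exact: pdC oU Ux (sw k 2%N).
rewrite /divergence sum3 !E !I3E (S 1 0) (S 2 0) (S 2 1).
move: (pd 0 (pd 1 (component w 2)) x) (pd 0 (pd 2 (component w 1)) x)
  (pd 1 (pd 2 (component w 0)) x) => A B C.
by ring.
Qed.

Lemma divergenceB U F G x : U x -> smooth_field_on U F -> smooth_field_on U G ->
  divergence (fun y => F y - G y) x = divergence F x - divergence G x.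
Proof.
move=> Ux sF sG; rewrite /divergence -sumrB; apply: eq_bigr => i _.
rewrite (_ : component _ i = component F i - component G i); last first.
  by apply/funext => y; rewrite /component !mxE.
by apply: deriveB; [exact: smooth_derivable (sF i) Ux|exact: smooth_derivable (sG i) Ux].
Qed.

End vector_calculus.

(** * Horizontal fields with prescribed divergence *)

Section horizontal_potential.
Context {R : realType}.
Implicit Types (U K : set 'rV[R]_3) (w : 'rV[R]_3 -> 'rV[R]_3)
  (f g : 'rV[R]_3 -> R) (x : 'rV[R]_3).

Lemma ler_coord_norm n (x : 'rV[R]_n) i : `|x 0 i| <= `|x|.
Proof. by rewrite [leRHS]mx_normrE; exact: (le_bigmax _ _ (0, i)). Qed.

Lemma smooth_continuous g : smooth_on setT g -> continuous g.
Proof. by move=> sg x; exact: (Ck_continuous (sg 0%N)). Qed.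

(** The derivative in the first direction of the integral of [g] along the segment
from [x] to [S *: e + x] is [g (S *: e + x) - g x]; the length [S] exceeds the diameter of
[U], so that the segment ends outside [U], where [g] vanishes. *)
Lemma divergence_preimage U g : bounded_set U -> smooth_on setT g ->
  (forall x, ~ U x -> g x = 0) ->
  exists v : 'rV[R]_3 -> 'rV[R]_3, smooth_field_on setT v /\
    forall x, U x -> divergence v x = g x.
Proof.
move=> [M [_ MU]] sg g0; pose e : 'rV[R]_3 := delta_mx 0 0.
pose L := `|M| + 1; have ML : M < L by rewrite ltr_pwDr// ler_norm.
have L0 : 0 < L by rewrite ltr_wpDl.
pose S := L + L + 1; have S0 : 0 < S by rewrite ltr_wpDl// addr_ge0 ?ltW.
have cg := smooth_continuous sg.
have sI : smooth_on setT (line_integral e S g).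
  by move=> k; exact: Ck_line_integral.
have dI x : U x -> pd 0 (line_integral e S g) x = - g x.
  move=> Ux; have cpd : continuous ('D_e g).
    exact: (smooth_continuous (smooth_pd 0 sg)).
  have dg y : derivable g y e by exact: smooth_derivable sg I.
  have [_ E] := @line_integral_derive R 3 e S S0 g x e cg dg cpd.
  rewrite /pd E line_integral_FTC// g0 ?sub0r// => US.
  have := MU _ ML _ Ux; have := MU _ ML _ US.
  have := ler_coord_norm x 0; have := ler_coord_norm (S *: e + x) 0.
  rewrite !mxE/= mulr1 => /le_trans H1 /le_trans H2 /H1 + /H2.
  rewrite !ler_norml /S => /andP[_ A] /andP[B _]; move: A B L0; lra.
pose v x : 'rV[R]_3 := (- line_integral e S g x) *: e.
have vE j : component v j = fun x => - (e 0 j) * line_integral e S g x.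
  by apply/funext => x; rewrite /component mxE mulrC mulrN mulNr.
exists v; split.
  move=> j k; rewrite vE; apply: CkM; first exact: openT.
    exact: Ck_cst.
  exact: sI.
move=> x Ux.
have pdv j : pd j (component v j) x = - (e 0 j) * pd j (line_integral e S g) x.
  rewrite vE; have dIj := smooth_derivable (i := j) sI (I : setT x).
  exact: (deriveMl (- e 0 j) dIj).
rewrite /divergence sum3 !pdv (dI _ Ux).
have [-> -> ->] : [/\ e 0 0 = 1, e 0 1 = 0 & e 0 2 = 0] by split; rewrite mxE.
move: (pd 1 _ x) (pd 2 _ x) => A B.
by rewrite oppr0 !mul0r !addr0 mulrN mulNr mul1r opprK.
Qed.

(** Subtracting [curl (c *: w)] changes no divergence, and
[c = (v . w) / (w . curl w)] removes the component of [v] along [w]. *)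
Lemma horizontal_potential U K w f : open U -> bounded_set U -> compact K ->
  K `<=` U -> smooth_field_on U w ->
  (forall x, U x -> dot (curl w x) (w x) != 0) -> smooth_on U f ->
  exists a, [/\ smooth_field_on U a, forall x, U x -> dot (a x) (w x) = 0 &
                forall x, K x -> divergence a x = f x].
Proof.
move=> oU bU cK KU sw h0 sf.
have [g [sg gf g0]] := smooth_extension oU cK KU sf.
have [v [sv dv]] := divergence_preimage bU sg g0.
have {}sv : smooth_field_on U v by move=> j k; exact: Ck_subset (sv j k).
pose c x := dot (v x) (w x) * (dot (curl w x) (w x))^-1.
have sc : smooth_on U c.
  move=> k; apply: CkM => //; first exact: dot_smooth.
  by apply: CkV => //; apply: dot_smooth => //; exact: curl_smooth.
have scw := scale_smooth oU sc sw.
exists (fun x => v x - curl (fun y => c y *: w y) x); split.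
- move=> j k; rewrite (_ : component _ j = fun x => component v j x -
    component (curl (fun y => c y *: w y)) j x).
    by apply: CkB => //; [exact: sv|exact: curl_smooth].
  by apply/funext => x; rewrite /component !mxE.
- move=> x Ux; rewrite dotBl (dot_curl_scale oU)// /c divfK ?subrr//.
  exact: h0.
- move=> x Kx; have Ux := KU _ Kx.
  rewrite (divergenceB Ux sv (curl_smooth oU scw)) (divergence_curl oU Ux scw).
  by rewrite subr0 dv// gf.
Qed.

Lemma enorm_smooth n U (F : 'rV[R]_3 -> 'rV[R]_n) : open U ->
  smooth_field_on U F -> (forall x, U x -> 0 < dot (F x) (F x)) ->
  smooth_on U (fun x => enorm (F x)).
Proof. by move=> oU sF F0 k; apply: Ck_sqrt => //; exact: dot_smooth. Qed.

Section contact_field.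
Variables (U : set 'rV[R]_3) (w : 'rV[R]_3 -> 'rV[R]_3).
Hypotheses (oU : open U) (sw : smooth_field_on U w).
Hypothesis h0 : forall x, U x -> dot (w x) (curl w x) != 0.

Lemma contact_dot_gt0 x : U x -> 0 < dot (w x) (w x).
Proof.
move=> Ux; rewrite lt_def dot_ge0 andbT; apply: contraNneq (h0 Ux) => w0.
by rewrite dotC dot0r.
Qed.

Lemma contact_enorm_gt0 x : U x -> 0 < enorm (w x).
Proof. by move=> Ux; rewrite sqrtr_gt0 contact_dot_gt0. Qed.

Lemma inv_enorm_smooth : smooth_on U (fun x => (enorm (w x))^-1).
Proof.
move=> k; apply: CkV => // [x Ux|]; first by rewrite gt_eqF// contact_enorm_gt0.
by apply: enorm_smooth => //; exact: contact_dot_gt0.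
Qed.

Lemma unit_field_smooth : smooth_field_on U (unit_field w).
Proof. by apply: scale_smooth => //; exact: inv_enorm_smooth. Qed.

Lemma dot_curl_unit x : U x ->
  dot (curl (unit_field w) x) (unit_field w x) =
  (enorm (w x)) ^- 2 * dot (w x) (curl w x).
Proof.
move=> Ux; rewrite {2}/unit_field dotZr (dot_curl_scale oU Ux inv_enorm_smooth sw).
by rewrite mulrA -expr2 exprVn (dotC (curl w x)).
Qed.

Lemma curl_unit_gt0 x : U x -> 0 < dot (curl (unit_field w) x) (curl (unit_field w) x).
Proof.
move=> Ux; rewrite lt_def dot_ge0 andbT; apply/eqP => c0.
have /eqP := dot_curl_unit Ux; rewrite dotC dot0r// eq_sym mulf_eq0.
by rewrite invr_eq0 expf_eq0/= (gt_eqF (contact_enorm_gt0 Ux))/= (negbTE (h0 Ux)).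
Qed.

(** The component of [curl (unit_field w)] along the unit vector [unit_field w] is
[(w . curl w) / |w|^2]. *)
Lemma le_curl_unit x : U x ->
  enorm (w x) ^- 2 * `|dot (w x) (curl w x)| <= enorm (curl (unit_field w) x).
Proof.
move=> Ux; have u1 : enorm (unit_field w x) = 1.
  rewrite enormZ ger0_norm ?invr_ge0 ?enorm_ge0// mulVf// gt_eqF//.
  exact: contact_enorm_gt0.
have := cauchy_schwarz (curl (unit_field w) x) (unit_field w x).
rewrite u1 mulr1; apply: le_trans.
by rewrite dot_curl_unit// normrM ger0_norm// invr_ge0 exprn_ge0// enorm_ge0.
Qed.

Lemma enorm_curl_unit_smooth : smooth_on U (fun x => enorm (curl (unit_field w) x)).
Proof.
apply: enorm_smooth => //; last exact: curl_unit_gt0.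
by apply: curl_smooth => //; exact: unit_field_smooth.
Qed.

End contact_field.

End horizontal_potential.

(** * Measurability of preimages of open sets *)

Section borel.
Context {R : realType} {d : measure_display} {T : measurableType d} {n : nat}.
Variable phi : T -> 'rV[R]_n.
Hypothesis mphi : forall i, measurable_fun setT (fun t => phi t 0 i).
Implicit Types (A U : set 'rV[R]_n) (f : 'rV[R]_n -> R).

(** An open set is the countable union of the rational boxes that it contains. *)
Lemma open_preimage_measurable A : open A -> measurable (phi @^-1` A).
Proof.
move=> oA.
pose box (q : 'rV[rat]_n) (m : nat) :=
  [set t | forall i, `|phi t 0 i - ratr (q 0 i)| < m.+1%:R^-1].
have mbox q m : measurable (box q m).
  rewrite (_ : box q m = \bigcap_(i in [set: 'I_n])
    [set t | `|phi t 0 i - ratr (q 0 i)| < m.+1%:R^-1]); last first.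
    by apply/seteqP; split => [t tq i _|t tq i]; exact: tq.
  apply: fin_bigcap_measurable => // i _.
  rewrite -[X in measurable X]setTI.
  have mf : measurable_fun setT (fun t => `|phi t 0 i - ratr (q 0 i)|).
    by apply: measurableT_comp => //; exact: measurable_funB.
  have := mf measurableT _ (measurable_itv `]-oo, m.+1%:R^-1[).
  by congr (measurable (_ `&` _)); apply/seteqP; split => t /=; rewrite in_itv.
pose F k := if @unpickle ('rV[rat]_n * nat)%type k is Some qm then
  if pselect (box qm.1 qm.2 `<=` phi @^-1` A) then box qm.1 qm.2 else set0
  else set0.
rewrite (_ : phi @^-1` A = \bigcup_k F k); last first.
  apply/seteqP; split => [t /= At|t [k _]]; last first.
    rewrite /F; case: (unpickle k) => // qm; case: pselect => // sub tq.
    exact: (sub t).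
  have /nbhs_ballP[r /= r0 Ar] : nbhs (phi t) A by exact: open_nbhs_nbhs.
  have [m mr] : exists m, m.+1%:R^-1 < r / 2.
    have r20 : 0 < r / 2 by rewrite divr_gt0.
    have [m _ /(_ m (leqnn m)) /= H] := near_infty_natSinv_lt (PosNum r20).
    by exists m.
  have /choice[q qP] (i : 'I_n) : exists q : rat, `|phi t 0 i - ratr q| < m.+1%:R^-1.
    have [|q] := @rat_in_itvoo R (phi t 0 i - m.+1%:R^-1) (phi t 0 i + m.+1%:R^-1).
      by rewrite ltrBlDr -addrA ltrDl addr_gt0.
    rewrite in_itv/= => /andP[q1 q2]; exists q.
    by rewrite ltr_norml ltrBrDr addrC -ltrBrDr opprK q2/= ltrBlDl -ltrBlDr q1.
  exists (pickle (\row_i q i, m)) => //; rewrite /F pickleK /=.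
  case: pselect => [sub|]; first by move=> i; rewrite mxE; exact: qP.
  move=> nsub; exfalso; apply: nsub => s sq; apply: Ar; split => // i j; rewrite ord1 /ball/=.
  have := sq j; have := qP j; rewrite mxE => H1 H2.
  rewrite (_ : _ - _ = (phi t 0 j - ratr (q j)) - (phi s 0 j - ratr (q j))); last by ring.
  apply: le_lt_trans (ler_normB _ _) _; rewrite [r]splitr ltrD//.
  - exact: lt_trans mr.
  - exact: lt_trans mr.
apply: bigcup_measurable => k _; rewrite /F; case: (unpickle k) => [qm|]; last exact: measurable0.
by case: pselect => sub; [exact: mbox|exact: measurable0].
Qed.

Lemma continuous_preimage_measurable U f : open U ->
  (forall x, U x -> {for x, continuous f}) ->
  measurable_fun (phi @^-1` U) (f \o phi).
Proof.
move=> oU cf; apply: (measurability _ (RGenOInfty.measurableE R)).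
move=> _ [_ [a ->] <-].
rewrite (_ : _ `&` _ = phi @^-1` (U `&` [set x | a < f x])); last first.
  by apply/seteqP; split => t /= [Ut]; rewrite ?in_itv/= ?andbT.
apply: open_preimage_measurable; rewrite openE => x [Ux ax].
apply: filterI; first by exact: open_nbhs_nbhs.
exact: (cvgr_gt _ (cf x Ux)).
Qed.

Lemma closed_preimage_measurable A : closed A -> measurable (phi @^-1` A).
Proof.
move=> cA; rewrite (_ : phi @^-1` A = ~` (phi @^-1` (~` A))); last first.
  by rewrite -preimage_setC setCK.
apply: measurableC; exact: (open_preimage_measurable (closed_openC cA)).
Qed.

End borel.

(** * Lebesgue measure and lines parallel to an axis *)

Section lebesgue2.
Context {R : realType}.
Local Notation mu := (@lebesgue_measure R).

(** With this instance Tonelli's theorem applies to [lebesgue3]. *)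
Lemma lebesgue2_sigma_finite : sigma_finite setT (@lebesgue2 R).
Proof.
have /sigma_finiteP[F [TF ndF Foo]] := sigma_finiteT mu.
exists (fun n => F n `*` F n).
  apply/seteqP; split => [[x y] _|//].
  have : (\bigcup_i F i) x by rewrite -TF.
  have : (\bigcup_i F i) y by rewrite -TF.
  move=> [k _ Fy] [n _ Fx]; exists (maxn n k) => //; split => /=.
  - by move: x Fx; exact/subsetPset/ndF/leq_maxl.
  - by move: y Fy; exact/subsetPset/ndF/leq_maxr.
move=> n; have [mF Fn] := Foo n; split; first exact: measurableX.
by rewrite /lebesgue2 product_measure1E// lte_mul_pinfty// ge0_fin_numE.
Qed.

HB.instance Definition _ := Measure.on (@lebesgue2 R).
HB.instance Definition _ := Measure_isSigmaFinite.Build _ _ _ (@lebesgue2 R) lebesgue2_sigma_finite.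
End lebesgue2.

Section lines.
Context {R : realType}.
Local Notation mu := (@lebesgue_measure R).

Lemma pt3_measurable (i : 'I_3) : measurable_fun setT (fun q => @pt3 R q 0 i).
Proof.
case: i => -[|[|[|//]]] h.
- rewrite (_ : (fun q => _) = fst \o fst); first exact: measurableT_comp.
  by apply/funext => q; rewrite mxE.
- rewrite (_ : (fun q => _) = snd \o fst); first exact: measurableT_comp.
  by apply/funext => q; rewrite mxE.
- rewrite (_ : (fun q => _) = snd); first exact: measurable_snd.
  by apply/funext => q; rewrite mxE.
Qed.

Lemma pt2_measurable (i : 'I_2) : measurable_fun setT (fun q => @pt2 R q 0 i).
Proof.
case: i => -[|[|//]] h.
- rewrite (_ : (fun q => _) = fst); first exact: measurable_fst.
  by apply/funext => q; rewrite mxE.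
- rewrite (_ : (fun q => _) = snd); first exact: measurable_snd.
  by apply/funext => q; rewrite mxE.
Qed.

(** The parametrization of the line parallel to axis [k] over the point [y] of the
coordinate plane; [col' k] projects back to [y]. *)
Definition insert_coord (k : 'I_3) (t : R) (y : 'rV[R]_2) : 'rV[R]_3 :=
  \row_i (if unlift k i is Some j then y 0 j else t).

Lemma insert_coordK k t y : col' k (insert_coord k t y) = y.
Proof. by apply/rowP => j; rewrite !mxE liftK. Qed.

Lemma insert_coord_at k t y : insert_coord k t y 0 k = t.
Proof. by rewrite mxE unlift_none. Qed.

Lemma insert_coord_lift k t y j : insert_coord k t y 0 (lift k j) = y 0 j.
Proof. by rewrite mxE liftK. Qed.

Lemma col'_insert k (x : 'rV[R]_3) : insert_coord k (x 0 k) (col' k x) = x.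
Proof.
by apply/rowP => i; rewrite mxE; case: unliftP => [j ->|->]; rewrite ?mxE.
Qed.

Lemma insert_coord_line k t y :
  insert_coord k t y = t *: delta_mx 0 k + insert_coord k 0 y.
Proof.
apply/rowP => i; rewrite !mxE/=; case: unliftP => [j ->|->].
  by rewrite eq_sym (negbTE (neq_lift _ _)) mulr0 add0r.
by rewrite eqxx mulr1 addr0.
Qed.

Lemma insert_coord_pt3 k t a b : insert_coord k t (pt2 (a, b)) =
  pt3 (if k == 0 then ((t, a), b) else if k == 1 then ((a, t), b) else ((a, b), t)).
Proof.
have I3 (i : 'I_3) : [\/ i = 0, i = lift 0 0 | i = lift 0 (lift 0 0)].
  case: i => -[|[|[|//]]] h; [apply: Or31|apply: Or32|apply: Or33]; exact: val_inj.
apply/rowP => i; rewrite !mxE.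
case: unliftP => [j ->|->].
  rewrite mxE; case: j => -[|[|//]] hj; case: k => -[|[|[|//]]] hk; rewrite //=.
by case: k => -[|[|[|//]]] hk.
Qed.

Section tonelli.
Local Open Scope ereal_scope.
Implicit Types (G : R * R * R -> \bar R).

Lemma tonelli3 G : measurable_fun setT G -> (forall q, 0 <= G q) ->
  \int[lebesgue2]_y \int[mu]_t G (y, t) =
  \int[mu]_a \int[mu]_b \int[mu]_c G ((a, b), c).
Proof.
move=> mG G0.
have := @fubini_tonelli1 _ _ _ _ R mu mu (fun y => \int[mu]_t G (y, t)).
rewrite /lebesgue2 => ->//.
- exact: (@measurable_fun_fubini_tonelli_F _ _ _ _ R mu G mG G0).
- by move=> y; exact: integral_ge0.
Qed.

Lemma tonelli_swap23 G : measurable_fun setT G -> (forall q, 0 <= G q) ->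
  \int[mu]_a \int[mu]_b \int[mu]_c G ((a, b), c) =
  \int[mu]_a \int[mu]_c \int[mu]_b G ((a, b), c).
Proof.
move=> mG G0; apply: eq_integral => a _.
apply: (@fubini_tonelli _ _ _ _ R mu mu (fun bc => G ((a, bc.1), bc.2))) => //.
apply: (measurableT_comp mG); apply: measurable_fun_pair => //.
by apply: measurable_fun_pair.
Qed.

Lemma tonelli_swap12 G : measurable_fun setT G -> (forall q, 0 <= G q) ->
  \int[mu]_a \int[mu]_b \int[mu]_c G ((a, b), c) =
  \int[mu]_b \int[mu]_a \int[mu]_c G ((a, b), c).
Proof.
move=> mG G0.
apply: (@fubini_tonelli _ _ _ _ R mu mu (fun ab => \int[mu]_c G (ab, c))) => //.
- exact: (@measurable_fun_fubini_tonelli_F _ _ _ _ R mu G mG G0).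
- by move=> y; exact: integral_ge0.
Qed.

(** Tonelli's theorem, with the [k]-th coordinate as the inner variable. *)
Lemma integral_lines (k : 'I_3) (f : 'rV[R]_3 -> \bar R) :
  measurable_fun setT (f \o pt3) -> (forall x, 0 <= f x) ->
  \int[lebesgue3]_q f (pt3 q) =
  \int[lebesgue2]_y \int[mu]_t f (insert_coord k t (pt2 y)).
Proof.
move=> mf f0.
have -> : \int[lebesgue3]_q f (pt3 q) =
    \int[mu]_a \int[mu]_b \int[mu]_c f (pt3 ((a, b), c)).
  have f0' q : 0 <= (f \o pt3) q by exact: f0.
  rewrite -(@tonelli3 (f \o pt3) mf f0').
  exact: (@fubini_tonelli1 _ _ _ _ R lebesgue2 mu (f \o pt3) mf f0').
have m3 : measurable_fun setT (fun q : R * R * R => (q.1.1, q.2, q.1.2)).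
  apply: measurable_fun_pair; last exact: measurableT_comp.
  by apply: measurable_fun_pair => //; exact: measurableT_comp.
have m3' : measurable_fun setT (fun q : R * R * R => (q.2, q.1.1, q.1.2)).
  apply: measurable_fun_pair; last exact: measurableT_comp.
  by apply: measurable_fun_pair => //; exact: measurableT_comp.
have f0' q : 0 <= (f \o pt3) q by exact: f0.
have mf1 := measurableT_comp mf m3.
have mf0 := measurableT_comp mf m3'.
have [k0|k0] := eqVneq k (0%R : 'I_3).
  transitivity (\int[lebesgue2]_y \int[mu]_t ((f \o pt3) \o
      (fun q : R * R * R => (q.2, q.1.1, q.1.2))) (y, t)); last first.
    apply: eq_integral => -[a b] _; apply: eq_integral => t _.
    by rewrite insert_coord_pt3 k0 eqxx.
  rewrite (tonelli3 mf0 (fun q => f0 _)) (tonelli_swap23 mf0 (fun q => f0 _)).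
  exact: (tonelli_swap12 mf f0').
have [k1|k1] := eqVneq k (1%R : 'I_3).
  transitivity (\int[lebesgue2]_y \int[mu]_t ((f \o pt3) \o
      (fun q : R * R * R => (q.1.1, q.2, q.1.2))) (y, t)); last first.
    apply: eq_integral => -[a b] _; apply: eq_integral => t _.
    by rewrite insert_coord_pt3 k1.
  rewrite (tonelli3 mf1 (fun q => f0 _)).
  exact/esym/(tonelli_swap23 mf1 (fun q => f0 _)).
transitivity (\int[lebesgue2]_y \int[mu]_t (f \o pt3) (y, t)); last first.
  apply: eq_integral => -[a b] _; apply: eq_integral => t _.
  by rewrite insert_coord_pt3 (negbTE k0) (negbTE k1).
exact/esym/(tonelli3 mf f0').
Qed.

End tonelli.
End lines.

(** * Volume integrals over bounded regions *)

Section bounded_region.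
Context {R : realType}.
Local Notation mu := (@lebesgue_measure R).
Implicit Types (U K : set 'rV[R]_3) (f g : 'rV[R]_3 -> R).

Lemma bounded_coord n (U : set 'rV[R]_n) : bounded_set U ->
  exists2 L, 0 < L & forall x, U x -> forall i, - L < x 0 i < L.
Proof.
move=> [M [_ MU]]; exists (`|M| + 1 + 1); first by rewrite ltr_wpDl// addr_ge0.
move=> x Ux i; rewrite -ltr_norml; apply: le_lt_trans (ler_coord_norm x i) _.
apply: (@le_lt_trans _ _ (`|M| + 1)); last by rewrite ltrDl.
by apply: MU Ux; rewrite ltr_pwDr// ler_norm.
Qed.

Definition vol_integral U f : R := \int[lebesgue3]_(q in pt3 @^-1` U) f (pt3 q).

Definition bounded_continuous U f := (forall x, U x -> {for x, continuous f}) /\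
  exists C, forall x, U x -> `|f x| <= C.

Lemma bounded_continuousD U f g : bounded_continuous U f -> bounded_continuous U g ->
  bounded_continuous U (fun x => f x + g x).
Proof.
move=> [cf [C fC]] [cg [D gD]]; split.
  by move=> x Ux; apply: continuousD; [exact: cf|exact: cg].
by exists (C + D) => x Ux; apply: le_trans (ler_normD _ _) _; rewrite lerD// ?fC ?gD.
Qed.

Lemma bounded_continuousM U f g : bounded_continuous U f -> bounded_continuous U g ->
  bounded_continuous U (fun x => f x * g x).
Proof.
move=> [cf [C fC]] [cg [D gD]]; split.
  by move=> x Ux; apply: continuousM; [exact: cf|exact: cg].
by exists (C * D) => x Ux; rewrite normrM ler_pM// ?fC ?gD.
Qed.

Lemma bounded_continuous_cst U c : bounded_continuous U (cst c).
Proof. by split => [x _|]; [exact: (@cst_continuous 'rV[R]_3 R c x)|exists `|c|]. Qed.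

Lemma open_pt3_measurable U : open U -> measurable (@pt3 R @^-1` U).
Proof. exact: (open_preimage_measurable pt3_measurable). Qed.

Lemma bounded_lebesgue3 U : measurable (@pt3 R @^-1` U) -> bounded_set U ->
  (lebesgue3 (pt3 @^-1` U) < +oo)%E.
Proof.
move=> mU /bounded_coord[L L0 UL].
pose J : set R := `[- L, L]%classic.
have mJ : measurable J by exact: measurable_itv.
have m2 : measurable (J `*` J) by exact: measurableX.
have E3 : (lebesgue3 ((J `*` J) `*` J) = lebesgue2 (J `*` J) * mu J)%E.
  exact: (@product_measure1E _ _ _ _ R lebesgue2 mu _ _ m2 mJ).
have E2 : (lebesgue2 (J `*` J) = mu J * mu J)%E.
  exact: (@product_measure1E _ _ _ _ R mu mu _ _ mJ mJ).
apply: (@le_lt_trans _ _ (lebesgue3 ((J `*` J) `*` J))).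
  apply: le_measure; rewrite ?inE//.
    exact: measurableX.
  move=> [[a b] c] /= /UL H; rewrite /J /= !in_itv/=.
  have := H 0; have := H 1; have := H 2; rewrite !mxE/=.
  by move=> /andP[/ltW -> /ltW ->] /andP[/ltW -> /ltW ->] /andP[/ltW -> /ltW ->].
rewrite E3 E2 /J.
rewrite /= lebesgue_measure_itv/= lte_fin; case: ifP => _.
  by rewrite -!EFinD -!EFinM ltry.
by rewrite !mule0 ltry.
Qed.

Lemma bounded_continuous_measurable U f : open U -> bounded_continuous U f ->
  measurable_fun (@pt3 R @^-1` U) (f \o pt3).
Proof.
by move=> oU [cf _]; exact: (continuous_preimage_measurable pt3_measurable).
Qed.

Lemma bounded_continuous_integrable U f : open U -> bounded_set U ->
  bounded_continuous U f ->
  lebesgue3.-integrable (pt3 @^-1` U) (EFin \o (f \o pt3)).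
Proof.
move=> oU bU cf; have mU := open_pt3_measurable oU.
apply: measurable_bounded_integrable => //.
- exact: bounded_lebesgue3.
- exact: bounded_continuous_measurable.
- have [_ [C fC]] := cf; exists `|C|; split; first exact: num_real.
  by move=> r Cr q /= /fC/le_trans; apply; apply: ltW; apply: le_lt_trans Cr; exact: ler_norm.
Qed.

(** The restriction of the derivative to a line is the derivative along the line,
so Fubini's theorem reduces the claim to the fundamental theorem of calculus.  The
constant [C] makes the integrand nonnegative. *)
Lemma integral_pd_eq0 U K f (k : 'I_3) : open U -> bounded_set U -> compact K ->
  K `<=` U -> Ck_on 1 setT f -> (forall x, ~ K x -> f x = 0) ->
  vol_integral U (pd k f) = 0.
Proof.
move=> oU bU cK KU Cf f0.
have oKC : open (~` K).
  exact/closed_openC/(compact_closed (@norm_hausdorff _ 'rV[R]_3) cK).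
have g0 x : ~ K x -> pd k f x = 0.
  move=> Kx; have -> := @pd_ext _ _ (~` K) f (cst 0) x k oKC Kx (fun y Ky => f0 y Ky).
  exact: (@derive_cst _ _ _ (0 : R) x).
have cg : continuous (pd k f).
  by move=> x; exact: (Ck_continuous (Ck_pd k Cf) I).
have [C C0 gC] : exists2 C, 0 <= C & forall x, `|pd k f x| <= C.
  have [M [_ MK]] : bounded_set (pd k f @` K).
    apply: compact_bounded; apply: continuous_compact => //.
    exact: continuous_subspaceT.
  exists (`|M| + 1); first by rewrite addr_ge0.
  move=> x; have [Kx|/g0 ->] := pselect (K x); last by rewrite normr0 addr_ge0.
  by apply: (MK (`|M| + 1)); [rewrite ltr_pwDr// ler_norm|exists x].
have bcg : bounded_continuous U (pd k f).
  by split; [move=> x _; exact: cg|exists C].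
have bcC := bounded_continuous_cst U C.
have mU := open_pt3_measurable oU.
have mg := bounded_continuous_measurable oU (bounded_continuousD bcg bcC).
pose F x := ((fun x => pd k f x + C) \_ U) x.
pose G x := ((cst C : 'rV[R]_3 -> R) \_ U) x.
have F0 x : 0 <= F x.
  rewrite /F patchE; case: ifP => // _.
  by have := gC x; rewrite ler_norml => /andP[]; rewrite -subr_ge0 opprK.
have G0 x : 0 <= G x by rewrite /G patchE; case: ifP.
have patch_pt3 h : (h \_ U) \o pt3 = (h \o @pt3 R) \_ (pt3 @^-1` U).
  apply/funext => q; rewrite /= !patchE/=.
  by congr (if _ then _ else _); apply/idP/idP; rewrite !inE.
have mF : measurable_fun setT (F \o pt3).
  by rewrite /F patch_pt3; apply/(measurable_restrictT _ mU).
have mG : measurable_fun setT (G \o pt3).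
  rewrite /G patch_pt3; apply/(measurable_restrictT _ mU).
  exact: measurable_cst.
have [L L0 UL] := bounded_coord bU.
have inner y : (\int[mu]_t (F (insert_coord k t (pt2 y)))%:E =
    \int[mu]_t (G (insert_coord k t (pt2 y)))%:E)%E.
  pose A := [set t | U (insert_coord k t (pt2 y))].
  pose J : set R := `[- L, L]%classic.
  have mins i : measurable_fun setT (fun t => insert_coord k t (pt2 y) 0 i).
    have [j ->|->] := unliftP k i.
      by under eq_fun do rewrite insert_coord_lift; exact: measurable_cst.
    by under eq_fun do rewrite insert_coord_at; exact: measurable_id.
  have mA : measurable A by exact: (open_preimage_measurable mins oU).
  have AJ : A `<=` J.
    move=> t At; have := UL _ At k; rewrite insert_coord_at.
    by rewrite /J /= in_itv/= => /andP[/ltW -> /ltW ->].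
  have mJ : measurable J by exact: measurable_itv.
  have LL : - L < L by rewrite gtrN.
  have muA : (mu A < +oo)%E.
    apply: (@le_lt_trans _ _ (mu J)); first by apply: le_measure; rewrite ?inE.
    by rewrite /J /= lebesgue_measure_itv/= lte_fin LL -EFinD ltry.
  pose g (t : R) := pd k f (t *: delta_mx 0 k + insert_coord k 0 (pt2 y)).
  have cl : continuous g by exact: line_continuous.
  have igJ : mu.-integrable J (EFin \o g).
    apply: continuous_compact_integrable; first exact: segment_compact.
    exact: continuous_subspaceT.
  have igA : mu.-integrable A (EFin \o g) by exact: integrableS igJ.
  have icA : mu.-integrable A (EFin \o cst C).
    apply: measurable_bounded_integrable => //.
    by exists `|C|; split; [exact: num_real|move=> r Cr t _; exact: ltW].
  have gA : (\int[mu]_(t in A) (g t)%:E = 0)%E.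
    have -> : (\int[mu]_(t in A) (g t)%:E = \int[mu]_(t in J) (g t)%:E)%E.
      rewrite [LHS]integral_mkcond [RHS]integral_mkcond; apply: eq_integral => t _.
      rewrite !patchE; case: ifPn => tA; first by rewrite mem_set//; exact/AJ/set_mem.
      have -> : g t = 0; last by case: ifP.
      rewrite /g -insert_coord_line; apply: g0 => /KU At.
      by move: tA; rewrite mem_set.
    have dl (t : R) : is_derive t 1
        (fun t : R => f (t *: delta_mx 0 k + insert_coord k 0 (pt2 y))) (g t).
      by apply: is_derive_along; exact: (Ck_derivable Cf I).
    have cf : continuous f by move=> x; exact: (Ck_continuous Cf I).
    have cfl := @line_continuous _ _ (delta_mx 0 k) f (insert_coord k 0 (pt2 y)) cf.
    have Fend (t : R) : `|t| = L -> f (t *: delta_mx 0 k + insert_coord k 0 (pt2 y)) = 0.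
      move=> tL; rewrite -insert_coord_line; apply: f0 => /KU /UL/(_ k).
      by rewrite insert_coord_at -ltr_norml tL ltxx.
    rewrite (@continuous_FTC2 _ g
      (fun t : R => f (t *: delta_mx 0 k + insert_coord k 0 (pt2 y)))) //.
    + by rewrite !Fend ?subee// ?normrN gtr0_norm.
    + exact: continuous_subspaceT.
    + split.
      * by move=> t _; have [] := dl t.
      * by apply: cvg_at_right_filter; exact: cfl.
      * by apply: cvg_at_left_filter; exact: cfl.
    + by move=> t _; rewrite derive1E; have [_ ->] := dl t.
  transitivity (\int[mu]_(t in A) (g t + C)%:E)%E.
    rewrite [RHS]integral_mkcond; apply: eq_integral => t _.
    rewrite /F !patchE /g -insert_coord_line.
    have -> : (t \in A) = (insert_coord k t (pt2 y) \in U) by apply/idP/idP; rewrite !inE.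
    by case: ifP.
  transitivity (\int[mu]_(t in A) C%:E)%E.
    under eq_integral do rewrite EFinD.
    by rewrite integralD// gA add0e.
  rewrite integral_mkcond; apply: eq_integral => t _.
  rewrite /G !patchE.
  have -> : (t \in A) = (insert_coord k t (pt2 y) \in U) by apply/idP/idP; rewrite !inE.
  by case: ifP.
have FG : (\int[lebesgue3]_q (F (pt3 q))%:E = \int[lebesgue3]_q (G (pt3 q))%:E)%E.
  rewrite (@integral_lines _ k (EFin \o F)); last 2 first.
  - exact/measurable_EFinP.
  - by move=> x; rewrite lee_fin.
  rewrite (@integral_lines _ k (EFin \o G)); last 2 first.
  - exact/measurable_EFinP.
  - by move=> x; rewrite lee_fin.
  by apply: eq_integral => y _; exact: inner.
have {FG} : \int[lebesgue3]_(q in pt3 @^-1` U) (pd k f (pt3 q) + C) =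
    \int[lebesgue3]_(q in pt3 @^-1` U) C.
  rewrite [LHS]Rintegral_mkcond [RHS]Rintegral_mkcond /Rintegral; congr fine.
  transitivity (\int[lebesgue3]_q (F (pt3 q))%:E)%E.
    apply: eq_integral => q _.
    by rewrite -[F (pt3 q)]/((F \o pt3) q) /F patch_pt3.
  rewrite FG; apply: eq_integral => q _.
  by rewrite -[G (pt3 q)]/((G \o pt3) q) /G patch_pt3.
rewrite RintegralD//; last 2 first.
- exact: (bounded_continuous_integrable oU bU bcg).
- exact: (bounded_continuous_integrable oU bU bcC).
by rewrite -[RHS]add0r => /addIr.
Qed.

End bounded_region.

(** * A step function *)

Section step.
Context {R : realType}.
Implicit Types t : R.

Definition possq t : R := Num.max t 0 ^+ 2.

Lemma is_derive_possq t : is_derive t 1 possq (2 * Num.max t 0).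
Proof.
have [t0|t0|->] := ltgtP t 0.
- rewrite mulr0.
  apply: (@near_eq_is_derive _ _ _ (cst 0)).
  near=> s; rewrite /possq max_r ?expr0n//.
  by apply: ltW; near: s; exact: lt_nbhsl.
- have near_sq : \forall s \near t, (fun s : R => s ^+ 2) s = possq s.
    near=> s; rewrite /possq max_l//.
    by apply: ltW; near: s; exact: lt_nbhsr.
  apply: (near_eq_is_derive near_sq).
  apply: DeriveDef; first exact: exprn_derivable.
  by rewrite exp_derive/= expr1 /GRing.scale/= mulr1.
- rewrite mulr0.
  suff H : h^-1 *: ((possq \o shift 0) (h *: 1) - possq 0) @[h --> 0^'] --> (0 : R).
    by apply: DeriveDef; [apply/cvg_ex; exists 0|exact: cvg_lim H].
  apply/cvgrPdist_le => e e0; near=> h.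
  rewrite /shift/= addr0 [possq 0]/possq maxxx expr0n subr0 sub0r normrN.
  rewrite /GRing.scale/= mulr1 normrM.
  have hn0 : h != 0 by near: h; exact: nbhs_dnbhs_neq.
  rewrite normfV ler_pdivrMl ?normr_gt0// /possq normrX expr2.
  have hm : `|Num.max h 0| <= `|h|.
    by rewrite /Num.max; case: ifP => // _; rewrite normr0.
  apply: ler_pM => //; apply: le_trans hm _.
  by near: h; exact: dnbhs0_le.
Unshelve. all: by end_near. Qed.

(** A piecewise quadratic step of class C^1 that equals 1 below -2 and 0 above -1; the
negative arguments place the transition layer inside the region where the defining
function of the boundary is negative. *)
Definition step t : R :=
  2 * (possq (- 1 - t) - 2 * possq (- 1 - t - 2^-1) + possq (- 1 - t - 1)).

Definition step' t : R := - 4 *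
  (Num.max (- 1 - t) 0 - 2 * Num.max (- 1 - t - 2^-1) 0 + Num.max (- 1 - t - 1) 0).

Lemma is_derive_step t : is_derive t 1 step (step' t).
Proof.
have H (a : R) : is_derive t 1 (fun t => possq (- 1 - t - a))
    (- 2 * Num.max (- 1 - t - a) 0).
  have d1 : is_derive t 1 (fun t : R => - 1 - t - a) (-1).
    have -> : (fun t : R => - 1 - t - a) = (cst (- 1 - a)) - id.
      by apply/funext => s /=; rewrite !fctE/=; ring.
    have H := is_deriveB (is_derive_cst (- 1 - a : R) t 1) (is_derive_id t 1).
    by apply: is_derive_eq H _; rewrite sub0r.
  have := @is_derive1_comp _ possq (fun t => - 1 - t - a) t _ _ (is_derive_possq _) d1.
  by move=> Hc; apply: is_derive_eq Hc _; rewrite mulrN1 mulNr.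
have H0 := H 0; have H1 := H 2^-1; have H2 := H 1.
have E : step = 2 *: ((fun t => possq (- 1 - t - 0)) -
    2 *: (fun t => possq (- 1 - t - 2^-1)) + (fun t => possq (- 1 - t - 1))).
  by apply/funext => s; rewrite /step !fctE/= subr0.
rewrite E.
apply: is_derive_eq (is_deriveZ 2 (is_deriveD (is_deriveB H0 (is_deriveZ 2 H1)) H2)) _.
by rewrite /step' /GRing.scale/= subr0; ring.
Qed.

Lemma step_le t : t <= - 2 -> step t = 1.
Proof.
move=> t2; rewrite /step /possq !max_l; lra.
Qed.

Lemma step_ge t : - 1 <= t -> step t = 0.
Proof.
move=> t1; rewrite /step /possq !max_r; lra.
Qed.

Lemma step'_eq0 t : ~~ (- 2 <= t <= - 1) -> step' t = 0.
Proof.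
rewrite negb_and -!ltNge => /orP[t2|t1]; rewrite /step'.
  rewrite !max_l; lra.
rewrite !max_r; lra.
Qed.

Lemma step'_bound t : `|step' t| <= 2.
Proof.
rewrite /step' ler_norml /Num.max; apply/andP.
by do ! case: ifPn; rewrite -?leNgt => *; split; lra.
Qed.

Lemma step_bound t : `|step t| <= 1.
Proof.
have [t1|t1] := leP (- 1) t; first by rewrite step_ge// normr0.
have [t2|t2] := leP t (- 2); first by rewrite step_le// normr1.
rewrite /step /possq ler_norml [Num.max (_ - 1) 0]max_r; last lra.
rewrite [Num.max (- 1 - t) 0]max_l; last lra.
rewrite /Num.max; case: ifPn; rewrite -?leNgt => h; apply/andP; split; nra.
Qed.

Lemma step'_continuous : continuous step'.
Proof.
have H (a : R) : continuous (fun t : R => Num.max (- 1 - t - a) 0).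
  move=> t.
  have cu : (fun t : R => - 1 - t - a) @ t --> - 1 - t - a.
    by apply: cvgB; [apply: cvgB; [exact: cvg_cst|exact: cvg_id]|exact: cvg_cst].
  have E (x : R) : Num.max x 0 = (x + `|x|) / 2.
    by rewrite /Num.max; case: ltrP => x0; [rewrite ltr0_norm//|rewrite ger0_norm//]; lra.
  rewrite (_ : (fun t => _) = (fun t => (- 1 - t - a + `|- 1 - t - a|) / 2)); last first.
    by apply/funext => s; rewrite E.
  by apply: cvgM; [apply: cvgD => //; exact: cvg_norm|exact: cvg_cst].
move=> t; apply: cvgM; first exact: cvg_cst.
apply: cvgD; last exact: H.
apply: cvgB; last by apply: cvgM; [exact: cvg_cst|exact: H].
have := H 0 t; rewrite /continuous_at subr0; apply: cvg_trans.
by apply: near_eq_cvg; near=> s; rewrite subr0.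
Unshelve. all: by end_near. Qed.

End step.

(** * Graphs over the coordinate planes *)

Section coordinates.
Context {R : realType}.
Implicit Types (gamma : 'rV[R]_2 -> R).

Lemma rV_continuous (T : topologicalType) n (F : T -> 'rV[R]_n) (x : T) :
  (forall i, {for x, continuous (fun y => F y 0 i)}) -> {for x, continuous F}.
Proof.
move=> cF A /nbhs_ballP[r /= r0 rA].
have H (i : 'I_n) : \forall y \near x, `|F x 0 i - F y 0 i| < r.
  by have /cvgrPdist_lt := cF i; apply.
have H2 : \forall y \near x, forall i, `|F x 0 i - F y 0 i| < r.
  exact: (@filter_forall T 'I_n (fun i => [set y | `|F x 0 i - F y 0 i| < r]) (nbhs x) _ H).
suff : \forall y \near x, A (F y) by [].
near=> y; apply: rA; split => // i j; rewrite ord1 /ball/=.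
by move: j; near: y.
Unshelve. all: by end_near. Qed.

Lemma rV_norm_lt n (x : 'rV[R]_n) r : 0 < r -> (forall i, `|x 0 i| < r) -> `|x| < r.
Proof.
move=> r0 xr; rewrite [ltLHS]mx_normrE; apply/bigmax_ltP; split => //= -[i j] _.
by rewrite ord1.
Qed.

Lemma col'_lin (k : 'I_3) (h : R) (x y : 'rV[R]_3) :
  col' k (h *: x + y) = h *: col' k x + col' k y.
Proof. by apply/rowP => j; rewrite !mxE. Qed.

(** Along the axis [k] the function is constant, along any other axis its derivative is
the corresponding one of [gamma]. *)
Lemma Ck_col' m (k : 'I_3) (gamma : 'rV[R]_2 -> R) :
  Ck_on m setT gamma -> Ck_on m setT (gamma \o col' k).
Proof.
have ccol : continuous (col' k : 'rV[R]_3 -> 'rV[R]_2).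
  move=> x; apply: rV_continuous => i.
  rewrite (_ : (fun y => _) = fun y : 'rV[R]_3 => y 0 (lift k i)); last first.
    by apply/funext => y; rewrite mxE.
  exact: coord_continuous.
have pdE (g : 'rV[R]_2 -> R) (v x : 'rV[R]_3) :
    (fun h : R => (g \o col' k) (h *: v + x)) = (fun h => g (h *: col' k v + col' k x)).
  by apply/funext => h; rewrite /= col'_lin.
have delta_lift j : col' k (delta_mx 0 (lift k j) : 'rV[R]_3) = delta_mx 0 j.
  by apply/rowP => i; rewrite !mxE/= (inj_eq (@lift_inj _ k)).
have delta_k : col' k (delta_mx 0 k : 'rV[R]_3) = 0.
  by apply/rowP => i; rewrite !mxE/= eq_sym (negbTE (neq_lift _ _)).
have cc (g : 'rV[R]_2 -> R) : Ck_on 0 setT g -> forall x : 'rV[R]_3, setT x ->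
    {for x, continuous (g \o col' k)}.
  move=> Cg x _.
  apply: (@continuous_comp 'rV[R]_3 'rV[R]_2 R (col' k) g x).
    exact: (ccol x).
  exact: (Ck_continuous Cg I).
have C0 l (g : 'rV[R]_2 -> R) : Ck_on l setT g -> Ck_on 0 setT g by case: l => [|l] [].
elim: m gamma => [|m IH] g Cg; split.
- exact: cc.
- by [].
- exact: cc (C0 _ _ Cg).
- move=> i; have [j ->|->] := unliftP k i; split.
  + move=> x _; apply/derivable1P; rewrite pdE delta_lift.
    exact/(derivable1P _ _ _).1/(Ck_derivable Cg I).
  + apply: (Ck_ext openT _ (IH _ (Ck_pd j Cg))) => x _.
    by rewrite /pd/= [RHS]derive_line pdE delta_lift -derive_line.
  + move=> x _; apply/derivable1P; rewrite pdE delta_k.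
    have -> : (fun h : R => g (h *: 0 + col' k x)) = cst (g (col' k x)).
      by apply/funext => h; rewrite scaler0 add0r.
    exact: derivable_cst.
  + apply: (Ck_ext openT _ (Ck_cst m setT 0)) => x _.
    rewrite /pd/= [RHS]derive_line pdE delta_k.
    have -> : (fun h : R => g (h *: 0 + col' k x)) = cst (g (col' k x)).
      by apply/funext => h; rewrite scaler0 add0r.
    by rewrite derive_cst.
Qed.

Lemma graph_fun_smooth k b (gamma : 'rV[R]_2 -> R) :
  smooth_on setT gamma -> smooth_on setT (graph_fun k b gamma).
Proof.
move=> sg m; apply: CkM; [exact: openT|exact: Ck_cst|].
apply: CkB; [exact: openT|exact: Ck_coord|].
exact: Ck_col' (sg m).
Qed.

Lemma I3_cases (k : 'I_3) : [\/ k = 0, k = 1 | k = 2].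
Proof.
by case: k => -[|[|[|//]]] h; [apply: Or31|apply: Or32|apply: Or33]; exact: val_inj.
Qed.

Definition graph_map (k : 'I_3) (gamma : 'rV[R]_2 -> R) (y : 'rV[R]_2) : 'rV[R]_3 :=
  insert_coord k (gamma y) y.

Lemma component_graph_map k gamma i :
  component (graph_map k gamma) i =
  if unlift k i is Some j then (fun y => y 0 j) else gamma.
Proof.
by apply/funext => y; rewrite /component mxE; case: unlift.
Qed.

Lemma graph_map_smooth k gamma : smooth_on setT gamma ->
  smooth_field_on setT (graph_map k gamma).
Proof.
move=> sg i m; rewrite component_graph_map; case: unlift => [j|]; last exact: sg.
exact: Ck_coord.
Qed.

Lemma graph_map_continuous k gamma : smooth_on setT gamma ->
  continuous (graph_map k gamma).
Proof.
move=> sg y; apply: rV_continuous => i.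
exact: (Ck_continuous (graph_map_smooth k sg i 0%N) I).
Qed.

Lemma graph_map_inj k gamma : injective (graph_map k gamma).
Proof. by move=> y z /(congr1 (col' k)); rewrite !insert_coordK. Qed.

Lemma graph_fun_insert k b gamma t y :
  graph_fun k b gamma (insert_coord k t y) = (-1) ^+ b * (t - gamma y).
Proof. by rewrite /graph_fun insert_coord_at insert_coordK. Qed.

Lemma graph_fun_map k b gamma y : graph_fun k b gamma (graph_map k gamma y) = 0.
Proof. by rewrite graph_fun_insert subrr mulr0. Qed.

Lemma insert_coord_dist k t t' (y : 'rV[R]_2) e :
  `|t - t'| < e -> `|insert_coord k t y - insert_coord k t' y| < e.
Proof.
move=> te; have e0 : 0 < e by apply: le_lt_trans te.
apply: rV_norm_lt => // i; rewrite !mxE; case: unliftP => [j _|_] //.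
by rewrite subrr normr0.
Qed.

(** A graph over a coordinate plane has at least the area of its projection: the
[k]-th component of the normal is 1 or -1. *)
Lemma area_graph_map k gamma y : 1 <= area_element (graph_map k gamma) y.
Proof.
have pdc (i j : 'I_2) : pd i (fun y : 'rV[R]_2 => y 0 j) y = (i == j)%:R.
  rewrite /pd; have [_ ->] := is_derive_coord y (delta_mx 0 i) j.
  by rewrite mxE/= eq_sym.
rewrite /area_element; set c := cross _ _.
apply: le_trans (ler_coord_enorm c k).
suff -> : `|c 0 k| = 1 by [].
have [j [j' [E1 E2 jj]]] : exists j j' : 'I_2,
    [/\ k + 1 = lift k j, k + 2 = lift k j' & (j, j') \in [:: (0, 1); (1, 0)]].
  case: (I3_cases k) => ->.
  - by exists 0, 1; split => //; exact: val_inj.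
  - by exists 1, 0; split => //; exact: val_inj.
  - by exists 0, 1; split => //; exact: val_inj.
have compE l : component (graph_map k gamma) (lift k l) = fun y => y 0 l.
  by rewrite component_graph_map liftK.
rewrite /c !mxE E1 E2 !compE !pdc.
by move: jj; rewrite !inE => /orP[/eqP[-> ->]|/eqP[-> ->]] /=;
  rewrite ?(mulr1, mulr0, subr0, sub0r, normrN, normr1).
Qed.

Lemma graph_fun_continuous k b (gamma : 'rV[R]_2 -> R) :
  smooth_on setT gamma -> continuous (graph_fun k b gamma).
Proof. by move=> sg x; exact: (Ck_continuous (graph_fun_smooth k b sg 0%N) I). Qed.

End coordinates.

(** * Functions on a closure *)

Section closure.
Context {R : realType} {n : nat}.
Implicit Types (U K : set 'rV[R]_n) (v : 'rV[R]_n -> R).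

Lemma compact_closure U : bounded_set U -> compact (closure U).
Proof.
move=> [M [_ MU]]; apply: bounded_closed_compact; last exact: closed_closure.
exists (`|M| + 1); split; first exact: num_real.
move=> r Mr x cx; apply: le_trans (ltW Mr).
have cl : closed [set y : 'rV[R]_n | `|y| <= `|M| + 1].
  apply: (@closed_comp _ _ (fun y : 'rV[R]_n => `|y|) [set z | z <= `|M| + 1]).
    by move=> y _; exact: norm_continuous.
  exact: closed_le.
have sub : closure U `<=` [set y : 'rV[R]_n | `|y| <= `|M| + 1].
  rewrite [X in _ `<=` X]((closure_id _).1 cl); apply: closure_subset => y Uy.
  by apply: MU Uy; rewrite ltr_pwDr// ler_norm.
exact: sub.
Qed.

Lemma within_open_continuous U v x : open U -> {within closure U, continuous v} ->
  U x -> {for x, continuous v}.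
Proof.
move=> oU cv Ux.
have := continuous_subspaceW (@subset_closure _ U) cv.
by rewrite continuous_open_subspace// => /(_ x); apply; rewrite inE.
Qed.

Lemma Ck1_closure_on U v : open U -> Ck_closure 1 U v -> Ck_on 1 U v.
Proof.
move=> oU [cv dv]; split; first by move=> x; exact: within_open_continuous.
move=> i; have [di [g [cg _] gE]] := dv i; split => //; split => // x Ux.
apply: (continuous_ext oU Ux gE).
exact: within_open_continuous oU cg Ux.
Qed.

Lemma within_compact_bounded K v : compact K -> {within K, continuous v} ->
  exists2 C, 0 <= C & forall x, K x -> `|v x| <= C.
Proof.
move=> cK cv; have [M [_ MK]] : bounded_set (v @` K).
  exact/compact_bounded/continuous_compact.
exists (`|M| + 1); first by rewrite addr_ge0.
by move=> x Kx; apply: (MK (`|M| + 1)); [rewrite ltr_pwDr// ler_norm|exists x].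
Qed.

Lemma within_compact_uniform K v eps : compact K -> {within K, continuous v} ->
  0 < eps -> exists2 d, 0 < d & forall x y, K x -> K y -> `|x - y| < d ->
    `|v x - v y| < eps.
Proof.
move=> /compact_near_coveringP/near_covering_withinP cK cv e0.
have e20 : 0 < eps / 2 by rewrite divr_gt0.
have := cK R 0^'+ (fun d x => forall y, K y -> `|x - y| < d -> `|v x - v y| < eps) _.
case.
  move=> x Kx; have /cvgrPdist_lt/(_ _ e20) : v @ within K (nbhs x) --> v x.
    by move/subspace_continuousP : cv; apply.
  rewrite near_withinE => /nbhs_normP[r /= r0 Br].
  have r20 : 0 < r / 2 by rewrite divr_gt0.
  exists ([set y | `|x - y| < r / 2], [set d | d < r / 2]).
    split => /=; last exact: nbhs_right_lt.
    by have := nbhsx_ballx x _ r20; rewrite -ball_normE.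
  move=> [z d] /= [xz dr] Kz y Ky zy.
  have H1 : `|v x - v z| < eps / 2.
    by apply: Br => //=; apply: lt_trans xz _; rewrite ltr_pdivrMr// ltr_pMr// ltr1n.
  have H2 : `|v x - v y| < eps / 2.
    apply: Br => //=; rewrite (_ : x - y = (x - z) + (z - y)); last by rewrite addrA subrK.
    apply: le_lt_trans (ler_normD _ _) _; rewrite [r]splitr ltrD//.
    exact: lt_trans dr.
  rewrite (_ : v z - v y = (v x - v y) - (v x - v z)); last by ring.
  by apply: le_lt_trans (ler_normB _ _) _; rewrite [eps]splitr ltrD.
move=> d /= d0 Hd; exists (d / 2); first by rewrite divr_gt0.
move=> x y Kx Ky xy; apply: (Hd (d / 2)) => //=.
  by rewrite sub0r normrN gtr0_norm ?divr_gt0// ltr_pdivrMr// ltr_pMr// ltr1n.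
by rewrite divr_gt0.
Qed.

End closure.

Section region.
Context {R : realType}.
Variables (Om : set 'rV[R]_3) (oOm : open Om) (bOm : bounded_set Om).
Implicit Types (f v : 'rV[R]_3 -> R) (K : set 'rV[R]_3).

Lemma within_bounded_continuous v : {within closure Om, continuous v} ->
  bounded_continuous Om v.
Proof.
move=> cv; split; first by move=> x; exact: within_open_continuous.
have [C _ vC] := within_compact_bounded (compact_closure bOm) cv.
by exists C => x Ux; apply: vC; exact: subset_closure.
Qed.

Lemma bounded_continuous_ext f g : (forall x, Om x -> f x = g x) ->
  bounded_continuous Om f -> bounded_continuous Om g.
Proof.
move=> fg [cf [C fC]]; split; last by exists C => x Ux; rewrite -fg ?fC.
by move=> x Ux; apply: (continuous_ext oOm Ux fg); exact: cf.
Qed.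

Lemma Ck_closure_bounded v : Ck_closure 1 Om v ->
  bounded_continuous Om v /\ forall i, bounded_continuous Om (pd i v).
Proof.
move=> [cv dv]; split; first exact: within_bounded_continuous.
move=> i; have [_ [g [cg _] gE]] := dv i.
by apply: bounded_continuous_ext gE _; exact: within_bounded_continuous.
Qed.

Lemma Ck_open_bounded V f : closure Om `<=` V -> Ck_on 1 V f ->
  bounded_continuous Om f /\ forall i, bounded_continuous Om (pd i f).
Proof.
move=> cV Cf; have H g : Ck_on 0 V g -> bounded_continuous Om g.
  move=> [cg _]; apply: within_bounded_continuous.
  by apply: continuous_in_subspaceT => x /set_mem/cV; exact: cg.
by split; [exact/H/CkW|move=> i; exact/H/Ck_pd].
Qed.

Lemma vol_integral_ext f g : (forall x, Om x -> f x = g x) ->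
  vol_integral Om f = vol_integral Om g.
Proof. by move=> fg; apply: eq_Rintegral => q /set_mem; exact: fg. Qed.

Lemma vol_integralD f g : bounded_continuous Om f -> bounded_continuous Om g ->
  vol_integral Om (fun x => f x + g x) = vol_integral Om f + vol_integral Om g.
Proof.
move=> bf bg; rewrite /vol_integral RintegralD//.
- exact: open_pt3_measurable.
- exact: (bounded_continuous_integrable oOm bOm bf).
- exact: (bounded_continuous_integrable oOm bOm bg).
Qed.

(** Extension by zero outside [Om] reduces this to [integral_pd_eq0]. *)
Lemma integral_pd_supp_eq0 K f j : closed K -> K `<=` Om -> Ck_on 1 Om f ->
  (forall x, Om x -> ~ K x -> f x = 0) -> vol_integral Om (pd j f) = 0.
Proof.
move=> cK KOm Cf f0.
have compK : compact K.
  apply: (subclosed_compact cK (compact_closure bOm)).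
  by apply: subset_trans KOm _; exact: subset_closure.
pose g := f \_ Om.
have gf x : Om x -> f x = g x by move=> Ux; rewrite /g patchE mem_set.
have g0 x : ~ K x -> g x = 0.
  by move=> Kx; rewrite /g patchE; case: ifP => // /set_mem Ux; exact: f0.
have Cg : Ck_on 1 setT g.
  rewrite (_ : setT = Om `|` ~` K); last first.
    apply/esym/seteqP; split=> // x _.
    by have [/KOm|] := pselect (K x); [left|right].
  apply: Ck_setU; first exact: Ck_ext gf Cf.
  have oK : open (~` K) by exact: closed_openC.
  by apply: (Ck_ext oK _ (Ck_cst 1 (~` K) 0)) => x Kx; rewrite g0.
rewrite -(integral_pd_eq0 j oOm bOm compK KOm Cg g0).
by apply: vol_integral_ext => x Ux; exact: (pd_ext j oOm Ux gf).
Qed.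

End region.

(** * Boundary charts *)

Section chart.
Context {R : realType}.
Local Notation mu := (@lebesgue_measure R).
Variables (Om V : set 'rV[R]_3).
Hypotheses (oOm : open Om) (bOm : bounded_set Om) (oV : open V)
  (cOV : closure Om `<=` V).
Implicit Types (c v : 'rV[R]_3 -> R) (p x : 'rV[R]_3).

(** The contribution of the product [c * v] to the divergence theorem on [Om] is
controlled by the boundary values of [v], with a constant independent of [v]. *)
Definition trace_bounded (j : 'I_3) c := exists2 C : R, 0 < C &
  forall v, Ck_closure 1 Om v -> (forall x, closure Om x -> 0 <= v x) ->
  (`|vol_integral Om (pd j (fun x => c x * v x))|%:E <=
    C%:E * surface_integral (boundary Om) v)%E.

(** The empty family of patches contributes 0 to the supremum. *)
Lemma surface_integral_ge0 (S : set 'rV[R]_3) v : (forall x, S x -> 0 <= v x) ->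
  (0 <= surface_integral S v)%E.
Proof.
move=> v0; apply: ereal_sup_ubound; exists 0%N, (fun _ => set0), (fun _ _ => 0).
split.
- by case.
- by move=> [].
- by rewrite big_ord0.
Qed.

(** Here [c * v] has compact support in [Om]. *)
Lemma trace_bounded_interior j c : Ck_on 1 V c -> closure [set x | c x != 0] `<=` Om ->
  trace_bounded j c.
Proof.
move=> Cc cOm; exists 1 => // v Cv v0.
rewrite (integral_pd_supp_eq0 (K := closure [set x | c x != 0]) oOm bOm)//.
- rewrite normr0 mul1e; apply: surface_integral_ge0 => x [cx _]; exact: v0.
- exact: closed_closure.
- apply: CkM => //; last exact: Ck1_closure_on.
  by apply: Ck_subset Cc; apply: subset_trans cOV; exact: subset_closure.
- move=> x Ux nK; have [->|cx] := eqVneq (c x) 0; first by rewrite mul0r.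
  by exfalso; apply: nK; exact: subset_closure.
Qed.

Section boundary_point.
Variables (p : 'rV[R]_3) (k : 'I_3) (b : bool) (gamma : 'rV[R]_2 -> R) (r : R).
Hypotheses (sgamma : smooth_on setT gamma) (r0 : 0 < r)
  (chart : forall x, `|p - x| < r -> (Om x <-> graph_fun k b gamma x < 0)).
Let phi := graph_fun k b gamma.
Let Phi := graph_map k gamma.
Let D := [set y | `|p - Phi y| < r].

Let cphi : continuous phi. Proof. exact: graph_fun_continuous. Qed.
Let cPhi : continuous Phi. Proof. exact: graph_map_continuous. Qed.

Lemma chart_base_open : open D.
Proof.
have cd : continuous (fun y => `|p - Phi y|).
  move=> y; apply: (@continuous_comp _ _ _ (fun y => p - Phi y) Num.norm).
    apply: rV_continuous => i; rewrite (_ : (fun y => _) = fun y => p 0 i - Phi y 0 i); last first.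
      by apply/funext => z; rewrite !mxE.
    apply: continuousB; first exact: (@cst_continuous 'rV[R]_2 R (p 0 i) y).
    exact: (Ck_continuous (graph_map_smooth k sgamma i 0%N) I).
  exact: norm_continuous.
exact: (open_comp (fun y _ => cd y) (@open_lt R r)).
Qed.

Lemma chart_base_measurable : measurable (pt2 @^-1` D).
Proof. exact: (open_preimage_measurable pt2_measurable chart_base_open). Qed.

Lemma chart_base_finite : (lebesgue2 (pt2 @^-1` D) < +oo)%E.
Proof.
pose L := `|p| + r.
have DL y : D y -> forall i, - L <= y 0 i <= L.
  move=> Dy i; rewrite -ler_norml -(insert_coord_lift k (gamma y) y i).
  apply: le_trans (ler_coord_norm _ _) _.
  rewrite (_ : insert_coord _ _ _ = p - (p - Phi y)); last by rewrite subKr.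
  by apply: le_trans (ler_normB _ _) _; rewrite lerD2l ltW.
pose J : set R := `[- L, L]%classic.
have mJ : measurable J by exact: measurable_itv.
have E2 : (lebesgue2 (J `*` J) = mu J * mu J)%E.
  exact: (@product_measure1E _ _ _ _ R mu mu _ _ mJ mJ).
apply: (@le_lt_trans _ _ (lebesgue2 (J `*` J))).
  apply: le_measure; rewrite ?inE//.
  - exact: chart_base_measurable.
  - exact: measurableX.
  - move=> [y1 y2] /= /DL H; rewrite /J /= !in_itv/=.
    by have := H 0; have := H 1; rewrite !mxE/=.
rewrite E2 /J /= lebesgue_measure_itv/= lte_fin; case: ifP => _.
  by rewrite -!EFinD -!EFinM ltry.
by rewrite !mule0 ltry.
Qed.

(** Moving down from the graph enters [Om], while the graph itself is outside. *)
Lemma chart_point_boundary y : D y -> boundary Om (Phi y).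
Proof.
move=> Dy; split; last first.
  move=> /interior_subset /(chart Dy).
  by rewrite graph_fun_map ltxx.
move=> B nB.
have cl : continuous (fun t => insert_coord k t y).
  move=> t; apply: rV_continuous => i.
  have [j ->|->] := unliftP k i.
    rewrite (_ : (fun t => _) = cst (y 0 j)); first exact: cst_continuous.
    by apply/funext => s; rewrite insert_coord_lift.
  rewrite (_ : (fun t => _) = id); first exact: cvg_id.
  by apply/funext => s; rewrite insert_coord_at.
have cs : (fun t : R => insert_coord k (gamma y - (-1) ^+ b * t) y) @ 0 --> Phi y.
  have -> : Phi y = insert_coord k (gamma y - (-1) ^+ b * 0) y by rewrite mulr0 subr0.
  apply: (@continuous_comp _ _ _ (fun t : R => gamma y - (-1) ^+ b * t)
    (fun t => insert_coord k t y) 0).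
    have : continuous (fun t : R => gamma y - (-1) ^+ b * t).
      by move=> t; apply: cvgB; [exact: cvg_cst|apply: cvgM; [exact: cvg_cst|exact: cvg_id]].
    exact.
  exact: cl.
have nN : nbhs (Phi y) (B `&` [set x | `|p - x| < r]).
  apply: filterI => //.
  have cd : continuous (fun x : 'rV[R]_3 => `|p - x|).
    move=> x; apply: (@continuous_comp _ _ _ (fun x => p - x) Num.norm).
      apply: rV_continuous => i; rewrite (_ : (fun y => _) = fun y : 'rV[R]_3 => p 0 i - y 0 i); last first.
        by apply/funext => z; rewrite !mxE.
      apply: continuousB; first exact: (@cst_continuous 'rV[R]_3 R (p 0 i) x).
      exact: coord_continuous.
    exact: norm_continuous.
  exact: (@cvgr_lt _ _ _ _ _ _ (cd (Phi y)) r Dy).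
have : \forall t \near 0^'+, (B `&` [set x | `|p - x| < r])
    (insert_coord k (gamma y - (-1) ^+ b * t) y).
  exact: (cvg_at_right_filter cs nN).
move=> H; have [t [t0 [Bt pt]]] := filter_ex (filterI (nbhs_right_gt 0) H).
exists (insert_coord k (gamma y - (-1) ^+ b * t) y); split => //.
apply/chart => //; rewrite graph_fun_insert addrAC subrr sub0r mulrN mulrA -expr2.
by rewrite sqrr_sign mul1r oppr_lt0.
Qed.

Lemma area_graph_map_continuous : continuous (area_element Phi).
Proof.
have cpd i j : continuous (pd i (component Phi j)).
  by move=> y; exact: (Ck_continuous (Ck_pd i (graph_map_smooth k sgamma j 1%N)) I).
pose c i y := cross (\row_j pd 0 (component Phi j) y) (\row_j pd 1 (component Phi j) y) 0 i.
have cc i y : {for y, continuous (c i)}.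
  rewrite (_ : c i = fun y => pd 0 (component Phi (i + 1)) y * pd 1 (component Phi (i + 2)) y
      - pd 0 (component Phi (i + 2)) y * pd 1 (component Phi (i + 1)) y); last first.
    by apply/funext => z; rewrite /c !mxE.
  by apply: continuousB; apply: continuousM; exact: cpd.
rewrite (_ : area_element Phi = fun y =>
  Num.sqrt (c 0 y * c 0 y + c 1 y * c 1 y + c 2 y * c 2 y)); last first.
  by apply/funext => y; rewrite /area_element /enorm dot3.
move=> y; apply: (@continuous_comp _ _ _
  (fun y => c 0 y * c 0 y + c 1 y * c 1 y + c 2 y * c 2 y) Num.sqrt).
  by apply: continuousD; [apply: continuousD|]; apply: continuousM; exact: cc.
exact: sqrt_continuous.
Qed.

(** The graph is one of the families of patches of the supremum, and its area element is
at least 1. *)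
Lemma le_chart_surface v : (forall y, D y -> 0 <= v (Phi y)) ->
  measurable_fun (pt2 @^-1` D) (fun q => v (Phi (pt2 q))) ->
  (\int[lebesgue2]_(q in pt2 @^-1` D) (v (Phi (pt2 q)))%:E <=
   surface_integral (boundary Om) v)%E.
Proof.
move=> v0 mv; apply: (@le_trans _ _ (patch_integral D Phi v)).
  apply: ge0_le_integral.
  - exact: chart_base_measurable.
  - by move=> q Dq; rewrite lee_fin; exact: v0.
  - exact/measurable_EFinP.
  - apply/measurable_EFinP; apply: measurable_funM => //.
    apply: (continuous_preimage_measurable pt2_measurable chart_base_open) => y _.
    exact: area_graph_map_continuous.
  - by move=> q Dq; rewrite lee_fin ler_peMr ?v0// area_graph_map.
apply: ereal_sup_ubound; exists 1%N, (fun _ => D), (fun _ => Phi); split.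
- move=> _; split.
  + exact: chart_base_measurable.
  + exact: graph_map_smooth.
  + by move=> y z _ _; exact: graph_map_inj.
  + by move=> _ [y Dy <-]; exact: chart_point_boundary.
- by move=> i j _ _ _; rewrite !ord1.
- by rewrite big_ord1.
Qed.

End boundary_point.
End chart.

(** * The boundary layer of a chart *)

Section step_composition.
Context {R : realType} {n : nat}.
Implicit Types (U : set 'rV[R]_n) (f : 'rV[R]_n -> R).

Lemma is_derive_step_comp f x i : derivable f x (delta_mx 0 i) ->
  is_derive x (delta_mx 0 i : 'rV[R]_n) (fun x => step (f x)) (step' (f x) * pd i f x).
Proof. by move=> df; apply: is_derive_comp; [exact: is_derive_step|]. Qed.

Lemma step_continuous : continuous (@step R).
Proof.
move=> t; apply/differentiable_continuous/derivable1_diffP.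
by have [] := is_derive_step t.
Qed.

Lemma Ck1_step U f : open U -> Ck_on 1 U f -> Ck_on 1 U (fun x => step (f x)).
Proof.
move=> oU Cf; split.
  move=> x Ux; apply: (@continuous_comp _ _ _ f step).
    exact: (Ck_continuous Cf Ux).
  exact: step_continuous.
move=> i; split; first by move=> x Ux; have [] := is_derive_step_comp (Ck_derivable (i := i) Cf Ux).
split => // x Ux.
apply: (continuous_ext (f := fun x => step' (f x) * pd i f x) oU Ux).
  by move=> y Uy; rewrite [RHS]/pd; have [_ ->] := is_derive_step_comp (Ck_derivable (i := i) Cf Uy).
apply: continuousM; last exact: (Ck_continuous (Ck_pd i Cf) Ux).
apply: (@continuous_comp _ _ _ f step'); last exact: step'_continuous.
exact: (Ck_continuous Cf Ux).
Qed.

End step_composition.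

Section chart.
Context {R : realType}.
Local Notation mu := (@lebesgue_measure R).
Variables (Om V : set 'rV[R]_3).
Hypotheses (oOm : open Om) (bOm : bounded_set Om) (oV : open V)
  (cOV : closure Om `<=` V).
Variables (p : 'rV[R]_3) (k : 'I_3) (b : bool) (gamma : 'rV[R]_2 -> R) (r : R).
Hypotheses (sgamma : smooth_on setT gamma) (r0 : 0 < r)
  (chart : forall x, `|p - x| < r -> (Om x <-> graph_fun k b gamma x < 0)).
Let phi := graph_fun k b gamma.
Let Phi := graph_map k gamma.
Let D := [set y | `|p - Phi y| < r].

Let sphi : smooth_on setT phi. Proof. exact: graph_fun_smooth. Qed.

Variables (j : 'I_3) (c v : 'rV[R]_3 -> R).
Hypotheses (Cc : Ck_on 1 V c)
  (cN : closure [set x | c x != 0] `<=` [set x | `|p - x| < r / 2])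
  (Cv : Ck_closure 1 Om v) (v0 : forall x, closure Om x -> 0 <= v x).

Let scale m x := m.+1%:R * phi x.
Let layer m x := c x * v x * (step' (scale m x) * (m.+1%:R * pd j phi x)).

Let r2r : r / 2 < r. Proof. by rewrite ltr_pdivrMr// ltr_pMr// ltr1n. Qed.

Let OmV : Om `<=` V. Proof. exact: subset_trans (@subset_closure _ _) cOV. Qed.
Let CcO : Ck_on 1 Om c. Proof. exact: Ck_subset OmV Cc. Qed.
Let CvO : Ck_on 1 Om v. Proof. exact: Ck1_closure_on. Qed.
Let Ccv : Ck_on 1 Om (fun x => c x * v x). Proof. exact: CkM. Qed.
Let Cscale m : Ck_on 1 setT (scale m).
Proof. by apply: CkM; [exact: openT|exact: Ck_cst|exact: sphi]. Qed.

Let bcv : bounded_continuous Om (fun x => c x * v x).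
Proof.
apply: bounded_continuousM; first exact: (Ck_open_bounded oOm bOm cOV Cc).1.
exact: (Ck_closure_bounded oOm bOm Cv).1.
Qed.

Let bpd : bounded_continuous Om (pd j (fun x => c x * v x)).
Proof.
have [bc bdc] := Ck_open_bounded oOm bOm cOV Cc.
have [bv bdv] := Ck_closure_bounded oOm bOm Cv.
apply: (bounded_continuous_ext oOm (f := fun x => c x * pd j v x + v x * pd j c x)).
  move=> x Ux; rewrite pdM//; first exact: (Ck_derivable CcO Ux).
  exact: (Ck_derivable CvO Ux).
by apply: bounded_continuousD; apply: bounded_continuousM.
Qed.

Let bpdphi : bounded_continuous Om (pd j phi).
Proof. exact: (Ck_open_bounded oOm bOm (@subsetT _ _) (sphi 1%N)).2. Qed.

Let bstep m : bounded_continuous Om (fun x => step (scale m x)).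
Proof.
split; last by exists 1 => x _; exact: step_bound.
by move=> x _; exact: (Ck_continuous (Ck1_step openT (Cscale m)) I).
Qed.

Let bstep' m : bounded_continuous Om (fun x => step' (scale m x)).
Proof.
split; last by exists 2 => x _; exact: step'_bound.
move=> x _; apply: (@continuous_comp _ _ _ (scale m) step').
  exact: (Ck_continuous (Cscale m) I).
exact: step'_continuous.
Qed.

Let blayer m : bounded_continuous Om (layer m).
Proof.
apply: bounded_continuousM => //; apply: bounded_continuousM => //.
by apply: bounded_continuousM => //; exact: bounded_continuous_cst.
Qed.

(** The product of [c * v] with the step function has compact support in [Om], so its
derivative integrates to zero; [layer m] is the term in which the step function is
differentiated. *)
Lemma layer_identity m :
  vol_integral Om (fun x => step (scale m x) * pd j (fun x => c x * v x) x) =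
  - vol_integral Om (layer m).
Proof.
apply/eqP; rewrite -subr_eq0 opprK -vol_integralD//; last exact: bounded_continuousM.
pose f x := c x * v x * step (scale m x).
pose K := closure [set x | c x != 0] `&` [set x | phi x <= - m.+1%:R^-1].
have cK : closed K.
  apply: closedI; first exact: closed_closure.
  apply: (closed_comp _ (@closed_le _ (- m.+1%:R^-1))) => x _.
  exact: (Ck_continuous (sphi 0%N) I).
have KOm : K `<=` Om.
  move=> x [/cN /= px phx]; apply/chart; first exact: lt_trans r2r.
  by apply: le_lt_trans phx _; rewrite oppr_lt0.
have Cs : Ck_on 1 Om (fun x => step (scale m x)).
  by apply: Ck1_step; [exact: oOm|exact: Ck_subset (@subsetT _ _) (Cscale m)].
have Cf : Ck_on 1 Om f by exact: CkM.
have f0 x : Om x -> ~ K x -> f x = 0.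
  move=> Ux nK; rewrite /f.
  have [->|cx] := eqVneq (c x) 0; first by rewrite !mul0r.
  rewrite step_ge ?mulr0// leNgt; apply/negP => sx; apply: nK; split.
    exact: subset_closure.
  rewrite /= -[leLHS](mulKf (_ : m.+1%:R != 0)) ?pnatr_eq0//.
  by rewrite -mulrN1 ler_pM2l ?invr_gt0// ltW.
have := integral_pd_supp_eq0 oOm bOm j cK KOm Cf f0.
move=> E0; apply/eqP; rewrite -[RHS]E0; apply: vol_integral_ext => x Ux.
have dcv : derivable (fun x => c x * v x) x (delta_mx 0 j).
  exact: (Ck_derivable Ccv Ux).
have ds : derivable (fun x => step (scale m x)) x (delta_mx 0 j).
  exact: (Ck_derivable Cs Ux).
have dsc : derivable (scale m) x (delta_mx 0 j).
  exact: (Ck_derivable (Cscale m) (I : setT x)).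
have dphi : derivable phi x (delta_mx 0 j).
  exact: (Ck_derivable (sphi 1%N) (I : setT x)).
have E3 : pd j (scale m) x = m.+1%:R * pd j phi x.
  by have [_ E] := is_deriveZ m.+1%:R (derivableP dphi); exact: E.
have E4 : pd j (fun x => step (scale m x)) x =
    step' (scale m x) * (m.+1%:R * pd j phi x).
  by rewrite -E3; have [_ E] := is_derive_step_comp dsc; exact: E.
by rewrite /f (pdM dcv ds) E4 /layer [RHS]addrC.
Qed.

(** The step functions are bounded by 1 and tend to 1 at every point of [Om] where [c] is
supported. *)
Lemma layer_limit :
  (fun m => vol_integral Om (fun x => step (scale m x) * pd j (fun x => c x * v x) x))
    @ \oo --> vol_integral Om (pd j (fun x => c x * v x)).
Proof.
pose g := pd j (fun x => c x * v x).
have mOm := open_pt3_measurable oOm.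
have ig := bounded_continuous_integrable oOm bOm bpd.
have bsg m := bounded_continuousM (bstep m) bpd.
have ptw q : (pt3 @^-1` Om) q ->
    (fun m => (step (scale m (pt3 q)) * g (pt3 q))%:E) @ \oo --> (g (pt3 q))%:E.
  move=> /= Ux; apply: cvg_EFin; first exact: nearW.
  have [Kx|nK] := pselect (closure [set x | c x != 0] (pt3 q)).
    have ph0 : phi (pt3 q) < 0 by apply/chart => //; apply: lt_trans r2r; exact: cN.
    apply: cvg_near_cst; near=> m.
    rewrite /= step_le ?mul1r// /scale -lerN2 opprK -mulrN.
    rewrite -ler_pdivrMr ?oppr_gt0//.
    apply: (@le_trans _ _ m%:R); last by rewrite ler_nat.
    by near: m; exact: nbhs_infty_ger.
  have -> : g (pt3 q) = 0.
    have oW : open (~` closure [set x | c x != 0]).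
      exact/closed_openC/closed_closure.
    rewrite /g (@pd_ext _ _ _ _ (cst 0) _ j oW nK).
      exact: (@derive_cst _ _ _ (0 : R)).
    move=> y ny; have [->|cy] := eqVneq (c y) 0; first by rewrite mul0r.
    by exfalso; apply: ny; exact: subset_closure.
  by under eq_fun do rewrite mulr0; exact: cvg_cst.
have [C gC] := bpd.2.
have bound q m : (pt3 @^-1` Om) q ->
    (`|(step (scale m (pt3 q)) * g (pt3 q))%:E| <= (C)%:E)%E.
  move=> Ux; rewrite abse_EFin lee_fin normrM -[leRHS]mul1r.
  by apply: ler_pM => //; [exact: step_bound|exact: gC].
have ic := bounded_continuous_integrable oOm bOm (bounded_continuous_cst Om C).
have [|||||_ _ lim] := @dominated_convergence _ _ _ lebesgue3 _ mOm
  (fun m q => (step (scale m (pt3 q)) * g (pt3 q))%:E)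
  (fun q => (g (pt3 q))%:E) (fun q => C%:E).
- move=> m; apply/measurable_EFinP.
  exact: (bounded_continuous_measurable oOm (bsg m)).
- apply/measurable_EFinP; exact: (bounded_continuous_measurable oOm bpd).
- exact: (@aeW _ _ _ lebesgue3 _ ptw).
- exact: ic.
- by apply: (@aeW _ _ _ lebesgue3) => q m Ux; exact: bound.
rewrite /vol_integral /Rintegral; apply: fine_cvg; rewrite fineK.
  exact: lim.
by apply: (integrable_fin_num _ ig).
Unshelve. all: by end_near. Qed.

Lemma graph_value_continuous y : D y -> {for y, continuous (v \o Phi)}.
Proof.
move=> Dy A nA.
have [cv _] := Cv.
have /subspace_continuousP/(_ _ (chart_point_boundary chart Dy).1) cvy := cv.
have N1 : \forall z \near y, closure Om (Phi z) -> A (v (Phi z)).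
  have cP : Phi @ y --> Phi y := @graph_map_continuous _ k gamma sgamma y.
  have := cP _ (cvy _ nA).
  by [].
have N2 : \forall z \near y, D z.
  by apply: open_nbhs_nbhs; split => //; exact: chart_base_open.
have : \forall z \near y, A (v (Phi z)).
  near=> z.
  have Dz : D z by near: z.
  have H : closure Om (Phi z) -> A (v (Phi z)) by near: z.
  apply: H; exact: (chart_point_boundary chart Dz).1.
by [].
Unshelve. all: by end_near. Qed.

Lemma graph_value_measurable :
  measurable_fun (pt2 @^-1` D) (fun q => v (Phi (pt2 q))).
Proof.
have oD : open D by exact: chart_base_open.
exact: (@continuous_preimage_measurable _ _ _ _ _ pt2_measurable D (v \o Phi) oD
  graph_value_continuous).
Qed.

Lemma graph_value_ge0 y : D y -> 0 <= v (Phi y).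
Proof. by move=> Dy; apply/v0/(chart_point_boundary chart Dy).1. Qed.

Variable C0 : R.
Hypotheses (C00 : 0 <= C0) (cC0 : forall x, Om x -> `|c x * pd j phi x| <= C0).

(** In the layer, [v] is close to its value at the nearby boundary point, by
uniform continuity. *)
Lemma layer_pointwise eps : 0 < eps -> \forall m \near \oo, forall x, Om x ->
  layer m x != 0 ->
  [/\ D (col' k x), - 2 <= scale m x <= -1 &
     `|layer m x| <= C0 * 2 * (v (Phi (col' k x)) + eps) * m.+1%:R].
Proof.
move=> e0; have [cv _] := Cv.
have [d d0 Hd] := within_compact_uniform (compact_closure bOm) cv e0.
near=> m => x Ux.
have M0 : 0 < m.+1%:R :> R by [].
have M1 : 2 / m.+1%:R < Num.min d (r / 2).
  rewrite ltr_pdivrMr// -ltr_pdivrMl ?lt_min ?d0 ?divr_gt0//.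
  apply: (@lt_le_trans _ _ m%:R); last by rewrite ler_nat.
  by near: m; exact: nbhs_infty_gtr.
rewrite /layer => h0.
have cx : c x != 0 by apply: contraNneq h0 => ->; rewrite !mul0r.
have s0 : - 2 <= scale m x <= -1.
  apply/negPn/negP => /step'_eq0 s'0; move/eqP: h0; apply.
  by rewrite s'0 mul0r mulr0.
have px : `|p - x| < r / 2 by apply: cN; exact: subset_closure.
have phx : `|phi x| <= 2 / m.+1%:R.
  rewrite ler_pdivlMr// mulrC -[m.+1%:R]ger0_norm// -normrM.
  rewrite -/(scale m x) ler_norml; lra.
have xPhi : `|x - Phi (col' k x)| < Num.min d (r / 2).
  rewrite -{1}(col'_insert k x); apply: insert_coord_dist.
  apply: le_lt_trans M1; apply: le_trans phx.
  by rewrite /phi /graph_fun normrM normrX normrN1 expr1n mul1r.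
have DC : D (col' k x).
  rewrite /D /= (_ : p - _ = (p - x) + (x - Phi (col' k x))); last by rewrite addrA subrK.
  apply: le_lt_trans (ler_normD _ _) _; rewrite [ltRHS]splitr ltrD//.
  by apply: lt_le_trans xPhi _; rewrite ge_min lexx orbT.
split => //.
have vx : v x <= v (Phi (col' k x)) + eps.
  have : `|v x - v (Phi (col' k x))| < eps.
    apply: Hd; first exact: subset_closure.
    - exact: (chart_point_boundary chart DC).1.
    - by apply: lt_le_trans xPhi _; rewrite ge_min lexx.
  by rewrite ltr_norml ltrBlDl => /andP[_ /ltW].
have vx0 : 0 <= v x by apply/v0/subset_closure.
rewrite (_ : c x * v x * _ = (c x * pd j phi x) * step' (scale m x) * v x * m.+1%:R); last by ring.
rewrite normrM (ger0_norm (ltW M0)) normrM (ger0_norm vx0) normrM.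
rewrite ler_pM2r//; apply: ler_pM => //.
by apply: ler_pM => //; [exact: cC0|exact: step'_bound].
Unshelve. all: by end_near. Qed.

(** For a fixed base point the layer is an interval of length [1 / (m + 1)]. *)
Let segment m y : set R := [set t | - 2 <= scale m (insert_coord k t y) <= - 1].

Lemma layer_segment m y :
  measurable (segment m y) /\ mu (segment m y) = (m.+1%:R^-1)%:E.
Proof.
pose M : R := m.+1%:R; have M0 : 0 < M by [].
have Mn0 : M != 0 by rewrite gt_eqF.
pose lo := gamma y + (if b then M^-1 else - (2 / M)).
pose hi := gamma y + (if b then 2 / M else - M^-1).
have key u : (- 2 <= M * u <= - 1) = (- (2 / M) <= u <= - M^-1).
  have k1 : (- 2 <= M * u) = (- (2 / M) <= u) by rewrite -ler_pdivrMl// mulrN mulrC.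
  have k2 : (M * u <= - 1) = (u <= - M^-1) by rewrite -[_ <= - 1]ler_pdivlMl// mulrN1.
  by rewrite k1 k2.
have -> : segment m y = `[lo, hi]%classic.
  apply/seteqP; split => t /=;
    rewrite in_itv/= /segment /= /scale /phi graph_fun_insert -/M key /lo /hi;
    case: (b); rewrite /= ?expr0 ?expr1 ?mul1r ?mulN1r => /andP[A B]; apply/andP;
    move: A B; move: (2 / M) (M^-1) (gamma y) => z2 z g A B; split; lra.
split; first exact: measurable_itv.
rewrite lebesgue_measure_itv/= lte_fin.
have -> : lo < hi.
  rewrite /lo /hi ltrD2l; case: (b).
    by rewrite -[ltLHS]mul1r ltr_pM2r ?invr_gt0// ltr1n.
  by rewrite ltrN2 -[ltLHS]mul1r ltr_pM2r ?invr_gt0// ltr1n.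
by rewrite -EFinD; congr EFin; rewrite /lo /hi -/M; case: (b); field.
Qed.

(** The factor [m + 1] in the bound of [layer_pointwise] cancels against the length of the
layer over each base point, which leaves an integral over the base [D] of the graph. *)
Lemma layer_integral_bound eps : 0 < eps -> \forall m \near \oo,
  (`|vol_integral Om (layer m)|%:E <=
    (C0 * 2)%:E * (surface_integral (boundary Om) v + eps%:E * lebesgue2 (pt2 @^-1` D)))%E.
Proof.
move=> e0; have := layer_pointwise e0; apply: filterS => m Hm.
have mOm := open_pt3_measurable oOm.
have mD := chart_base_measurable p k r sgamma.
have M0 : 0 < m.+1%:R :> R by [].
pose H y := C0 * 2 * (v (Phi y) + eps).
have H0 y : D y -> 0 <= H y.
  by move=> Dy; rewrite mulr_ge0 ?mulr_ge0// addr_ge0 ?graph_value_ge0// ltW.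
pose W := [set x | D (col' k x) /\ - 2 <= scale m x <= - 1].
pose Q x : \bar R := (((fun x => H (col' k x) * m.+1%:R) \_ W) x)%:E.
have Q0 x : (0 <= Q x)%E.
  rewrite lee_fin patchE; case: ifPn => // /set_mem[DC _].
  by rewrite mulr_ge0 ?H0.
have mcol i : measurable_fun setT (fun q => (col' k (@pt3 R q) : 'rV[R]_2) 0 i).
  by under eq_fun do rewrite mxE; exact: pt3_measurable.
have mvcol : measurable_fun ((fun q => col' k (@pt3 R q)) @^-1` D)
    (fun q => v (Phi (col' k (pt3 q)))).
  have oD : open D by exact: chart_base_open.
  exact: (@continuous_preimage_measurable _ _ _ _ _ mcol D (v \o Phi) oD
    graph_value_continuous).
have mcolD : measurable ((fun q => col' k (@pt3 R q) : 'rV[R]_2) @^-1` D).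
  have oD : open D by exact: chart_base_open.
  exact: (@open_preimage_measurable _ _ _ _ _ mcol D oD).
have mW : measurable (@pt3 R @^-1` W).
  rewrite (_ : _ @^-1` W = ((fun q => col' k (@pt3 R q)) @^-1` D) `&`
     (@pt3 R @^-1` [set x | - 2 <= scale m x <= - 1])); last by [].
  apply: measurableI.
    exact: mcolD.
  apply: (closed_preimage_measurable pt3_measurable).
  rewrite (_ : [set x | _] = scale m @^-1` `[- 2, - 1]%classic); last first.
    by apply/seteqP; split => x /=; rewrite in_itv.
  have cl : closed (`[- 2, - 1]%classic : set R) by exact: itv_closed.
  apply: (closed_comp _ cl) => x _.
  exact: (Ck_continuous (Cscale m) I).
have mQ : measurable_fun setT (Q \o pt3).
  have -> : Q \o pt3 = EFin \o
      ((fun q => H (col' k (@pt3 R q)) * m.+1%:R) \_ (@pt3 R @^-1` W)).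
    apply/funext => q; rewrite /= /Q !patchE.
    by congr (if _ then _ else _)%:E; apply/idP/idP; rewrite !inE.
  apply/measurable_EFinP.
  apply/(measurable_restrictT _ mW); apply: measurable_funM => //.
  apply: measurable_funM => //; apply: measurable_funD => //.
  by apply: (measurable_funS mcolD _ mvcol) => q [].
have step1 : (`|vol_integral Om (layer m)|%:E <= \int[lebesgue3]_q Q (pt3 q))%E.
  have il := bounded_continuous_integrable oOm bOm (blayer m).
  have ml := bounded_continuous_measurable oOm (blayer m).
  rewrite /vol_integral EFin_normr_Rintegral//.
  apply: le_trans; first by apply: le_abse_integral => //; exact/measurable_EFinP.
  rewrite integral_mkcond; apply: ge0_le_integral => //.
  - by move=> q _; rewrite patchE; case: ifP.
  - apply/(measurable_restrictT _ mOm); apply: measurableT_comp => //.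
    exact/measurable_EFinP.
  - move=> q _; rewrite patchE; case: ifPn => [/set_mem Ux|_]; last exact: Q0.
    have [->|/(Hm _ Ux)[DC sx lx]] := eqVneq (layer m (pt3 q)) 0.
      by rewrite abse0; exact: Q0.
    by rewrite /Q patchE mem_set.
apply: le_trans step1 _.
rewrite (integral_lines k mQ Q0).
have inner y : (\int[mu]_t Q (insert_coord k t (pt2 y)) =
    ((fun q => (H (pt2 q))%:E) \_ (pt2 @^-1` D)) y)%E.
  have [mJ muJ] := layer_segment m (pt2 y).
  rewrite patchE; case: ifPn => Dy.
    have {}Dy : D (pt2 y) by move: Dy; rewrite inE.
    transitivity (\int[mu]_(t in segment m (pt2 y)) (H (pt2 y) * m.+1%:R)%:E)%E.
      rewrite [RHS]integral_mkcond; apply: eq_integral => t _.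
      rewrite /Q !patchE insert_coordK.
      have -> : (insert_coord k t (pt2 y) \in W) = (t \in segment m (pt2 y)).
        apply/idP/idP; rewrite !inE /W /segment /= insert_coordK; by [case|split].
      by case: ifP.
    rewrite integral_cst// -[X in X = _]/(_ * mu _)%E muJ -EFinM.
    by rewrite -mulrA mulfV ?mulr1// pnatr_eq0.
  apply: integral0_eq => t _; rewrite /Q patchE ifF//.
  apply/negP => /set_mem[]; rewrite insert_coordK => Dy' _.
  by move: Dy; rewrite mem_set.
under eq_integral do rewrite inner.
rewrite -integral_mkcond.
have mv := graph_value_measurable.
under eq_integral do rewrite EFinM EFinD.
rewrite ge0_integralZl//; last 3 first.
- exact/measurable_EFinP/measurable_funD.
- by move=> q Dq; rewrite -EFinD lee_fin addr_ge0 ?graph_value_ge0// ltW.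
- by rewrite lee_fin mulr_ge0.
rewrite lee_wpmul2l ?lee_fin ?mulr_ge0//.
rewrite ge0_integralD//; last 3 first.
- by move=> q Dq; rewrite lee_fin graph_value_ge0.
- exact/measurable_EFinP.
- by move=> q Dq; rewrite lee_fin ltW.
rewrite integral_cst// leeD2r//.
by apply: (le_chart_surface sgamma chart) => //; exact: graph_value_ge0.
Qed.

End chart.

(** * A divergence theorem bounded by boundary values *)

Section global.
Context {R : realType}.
Variables (Om V : set 'rV[R]_3).
Hypotheses (oOm : open Om) (bOm : bounded_set Om) (oV : open V)
  (cOV : closure Om `<=` V).
Implicit Types (c v f : 'rV[R]_3 -> R) (p x : 'rV[R]_3).

Let OmV : Om `<=` V. Proof. exact: subset_trans (@subset_closure _ _) cOV. Qed.

(** The bound of [layer_integral_bound] is independent of [m], and [eps] is arbitrary. *)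
Lemma trace_bounded_chart p k b gamma r j c : smooth_on setT gamma -> 0 < r ->
  (forall x, `|p - x| < r -> (Om x <-> graph_fun k b gamma x < 0)) ->
  Ck_on 1 V c -> closure [set x | c x != 0] `<=` [set x | `|p - x| < r / 2] ->
  trace_bounded Om j c.
Proof.
move=> sgamma r0 chart Cc cN.
have bphi := (Ck_open_bounded oOm bOm (@subsetT _ _) (graph_fun_smooth k b sgamma 1%N)).2 j.
have [_ [K0 HK0]] := bounded_continuousM (Ck_open_bounded oOm bOm cOV Cc).1 bphi.
pose C0 := `|K0|.
have cC0 x : Om x -> `|c x * pd j (graph_fun k b gamma) x| <= C0.
  by move=> Ux; apply: le_trans (HK0 _ Ux) _; exact: ler_norm.
have C00 : 0 <= C0 * 2 by rewrite mulr_ge0// normr_ge0.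
exists (C0 * 2 + 1); first by rewrite ltr_wpDl.
move=> v Cv v0; set E := vol_integral _ _.
have S0 : (0 <= surface_integral (boundary Om) v)%E.
  by apply: surface_integral_ge0 => x [cx _]; exact: v0.
have bnd eps := @layer_integral_bound _ Om V oOm bOm cOV p k b gamma r sgamma r0
  chart j c v Cc cN Cv v0 C0 (normr_ge0 _) cC0 eps.
have lim := @layer_limit _ Om V oOm bOm cOV p k b gamma r sgamma r0 chart j c v Cc cN Cv.
have ident := @layer_identity _ Om V oOm bOm cOV p k b gamma r sgamma r0 chart j c v Cc cN Cv.
have Lf := chart_base_finite p k r sgamma.
have L0 : (0 <= lebesgue2 (pt2 @^-1` [set y | (`|p - graph_map k gamma y| < r)%R]))%E.
  exact: measure_ge0.
move: S0 bnd Lf L0.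
case: (surface_integral _ _) => [s s0|_ _ _ _|//]; last first.
  by rewrite gt0_muley ?leey// lte_fin ltr_wpDl.
case: (lebesgue2 _) => [l bnd _ l0|//|//].
rewrite -EFinM lee_fin.
apply: (@le_trans _ _ (C0 * 2 * s)); last first.
  by rewrite ler_wpM2r ?lerDl//; rewrite lee_fin in s0.
rewrite lee_fin in s0; rewrite lee_fin in l0.
apply/ler_addgt0Pr => e e0.
pose eps := e / (C0 * 2 * l + 1).
have d0 : 0 < C0 * 2 * l + 1 by rewrite ltr_wpDl// mulr_ge0.
have eps0 : 0 < eps by rewrite divr_gt0.
have /cvgrPdist_lt/(_ _ eps0) H1 := lim.
have [m [Hm1 Hm2]] := filter_ex (filterI H1 (bnd eps eps0)).
rewrite /= ident in Hm1.
move: Hm2; rewrite -[X in (_ <= X)%E]/((C0 * 2 * (s + eps * l))%:E) lee_fin => Hm2.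
rewrite -/E in Hm1.
have : `|E| <= eps + C0 * 2 * (s + eps * l).
  rewrite -[E](subrK (- vol_integral Om (fun x => c x * v x *
    (step' (m.+1%:R * graph_fun k b gamma x) *
      (m.+1%:R * pd j (graph_fun k b gamma) x))))).
  apply: le_trans (ler_normD _ _) _; rewrite normrN; apply: lerD => //.
  exact: ltW.
move/le_trans; apply.
have -> : e = eps * (C0 * 2 * l + 1) by rewrite divfK// gt_eqF.
by rewrite le_eqVlt; apply/orP; left; apply/eqP; ring.
Qed.

Lemma trace_boundedD j c1 c2 : Ck_on 1 V c1 -> Ck_on 1 V c2 ->
  trace_bounded Om j c1 -> trace_bounded Om j c2 ->
  trace_bounded Om j (fun x => c1 x + c2 x).
Proof.
move=> Cc1 Cc2 [C1 C10 H1] [C2 C20 H2]; exists (C1 + C2); first by rewrite addr_gt0.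
move=> v Cv v0.
have [bv bdv] := Ck_closure_bounded oOm bOm Cv.
have CvO := Ck1_closure_on oOm Cv.
have bpd c : Ck_on 1 V c -> bounded_continuous Om (pd j (fun x => c x * v x)).
  move=> Cc; have [bc bdc] := Ck_open_bounded oOm bOm cOV Cc.
  apply: (bounded_continuous_ext oOm (f := fun x => c x * pd j v x + v x * pd j c x)).
    move=> x Ux; have dc := Ck_derivable (i := j) Cc (OmV Ux).
    by rewrite (pdM dc (Ck_derivable (i := j) CvO Ux)).
  by apply: bounded_continuousD; apply: bounded_continuousM.
have -> : vol_integral Om (pd j (fun x => (c1 x + c2 x) * v x)) =
    vol_integral Om (pd j (fun x => c1 x * v x)) +
    vol_integral Om (pd j (fun x => c2 x * v x)).
  rewrite -(vol_integralD oOm bOm (bpd _ Cc1) (bpd _ Cc2)); apply: vol_integral_ext => x Ux.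
  have d1 := Ck_derivable (i := j) (CkM oOm (Ck_subset OmV Cc1) CvO) Ux.
  have d2 := Ck_derivable (i := j) (CkM oOm (Ck_subset OmV Cc2) CvO) Ux.
  have <- := deriveD d1 d2.
  by congr ('D_ _ _ x); apply/funext => y; rewrite mulrDl.
apply: (@le_trans _ _ (`|vol_integral Om (pd j (fun x => c1 x * v x))|%:E +
    `|vol_integral Om (pd j (fun x => c2 x * v x))|%:E)%E).
  by rewrite -EFinD lee_fin ler_normD.
apply: le_trans (leeD (H1 v Cv v0) (H2 v Cv v0)) _.
by rewrite EFinD ge0_muleDl ?lexx// lee_fin ltW.
Qed.

Lemma trace_bounded_ext j c1 c2 : (forall x, Om x -> c1 x = c2 x) ->
  trace_bounded Om j c1 -> trace_bounded Om j c2.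
Proof.
move=> E [C C0 H]; exists C; first exact: C0.
move=> v Cv v0.
rewrite (_ : vol_integral Om _ = vol_integral Om (pd j (fun x => c1 x * v x))).
  exact: H.
apply: vol_integral_ext => x Ux; apply: (pd_ext _ oOm Ux) => y Uy.
by rewrite E.
Qed.

(** A point of the closure is either interior or covered by a chart. *)
Lemma trace_bounded_local p : smooth_boundary Om -> closure Om p ->
  exists N, [/\ open N, N p & forall j c, Ck_on 1 V c ->
    closure [set x | c x != 0] `<=` N -> trace_bounded Om j c].
Proof.
move=> sOm cp; have [Up|nUp] := pselect (Om p).
  by exists Om; split => // j c; exact: trace_bounded_interior.
have bp : boundary Om p by split => // /interior_subset.
have [k [b [gamma [sgamma /nbhs_normP[r /= r0 chart]]]]] := sOm p bp.
exists (ball p (r / 2)); split.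
- exact: ball_open.
- by apply: ballxx; rewrite divr_gt0.
- move=> j c Cc cN; apply: (trace_bounded_chart j sgamma r0 chart Cc).
  by move: cN; rewrite -ball_normE.
Qed.

(** With bump functions [b p] over a finite cover of the closure, the product of all
[1 - b p] vanishes on [Om].  Passing from [c - c * rest t] to [c - c * rest (p :: t)] adds
the localized term [b p * (c * rest t)]. *)
Lemma trace_bounded_C1 j c : smooth_boundary Om -> Ck_on 1 V c -> trace_bounded Om j c.
Proof.
move=> sOm Cc.
have /choice[b bP] p : exists b : 'rV[R]_3 -> R, closure Om p ->
  [/\ smooth_on setT b, \forall x \near p, b x = 1 &
      forall c, Ck_on 1 V c -> trace_bounded Om j (fun x => b x * c x)].
  have [cp|ncp] := pselect (closure Om p); last by exists (cst 0).
  have [N [oN Np HN]] := trace_bounded_local sOm cp.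
  have [b [sb b1 bN]] := bump_exists oN Np; exists b => _; split => // c' Cc'.
  have Cb : Ck_on 1 V b by apply: Ck_subset (sb 1%N).
  apply: HN; first exact: CkM.
  apply: subset_trans bN; apply: closure_subset => x /=.
  by apply: contraNneq => ->; rewrite mul0r.
have [s sK Ks] := compact_nbhs_cover (N := fun p => [set x | b p x = 1])
  (compact_closure bOm) (fun p Kp => let: And3 _ H _ := bP p Kp in H).
pose rest s x := \prod_(p <- s) (1 - b p x).
have Crest t : {subset t <= s} -> Ck_on 1 V (rest t).
  elim: t => [_|p t IH ts].
    by apply: (Ck_ext oV _ (Ck_cst 1 V 1)) => x _; rewrite /rest big_nil.
  have [sb _ _] := bP p (sK _ (ts _ (mem_head _ _))).
  apply: (Ck_ext oV (f := fun x => (1 - b p x) * rest t x)).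
    by move=> x _; rewrite /rest big_cons.
  apply: CkM; [exact: oV| |].
    by apply: CkB; [exact: oV|exact: Ck_cst|exact: Ck_subset (sb 1%N)].
  by apply: IH => q qt; apply: ts; rewrite in_cons qt orbT.
have telescope t : {subset t <= s} -> trace_bounded Om j (fun x => c x - c x * rest t x).
  elim: t => [_|p t IH ts].
    apply: (trace_bounded_ext (c1 := cst 0)).
      by move=> x _; rewrite /rest big_nil mulr1 subrr.
    apply: (trace_bounded_interior oOm bOm cOV j (Ck_cst 1 V 0)).
    rewrite (_ : [set x | _] = set0) ?closure0//.
    by apply/seteqP; split => x //=; rewrite eqxx.
  have tss : {subset t <= s} by move=> q qt; apply: ts; rewrite in_cons qt orbT.
  have [sb _ Hb] := bP p (sK _ (ts _ (mem_head _ _))).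
  have Cct : Ck_on 1 V (fun x => c x * rest t x) by apply: CkM; [exact: oV|exact: Cc|exact: Crest].
  have Cbct : Ck_on 1 V (fun x => b p x * (c x * rest t x)).
    by apply: CkM; [exact: oV|exact: Ck_subset (sb 1%N)|exact: Cct].
  have := trace_boundedD (CkB oV Cc Cct) Cbct (IH tss) (Hb _ Cct).
  apply: trace_bounded_ext => x _; rewrite /rest big_cons; ring.
apply: trace_bounded_ext (telescope s (fun _ => id)) => x Ux.
rewrite [rest s x](_ : _ = 0) ?mulr0 ?subr0//.
have [p ps bpx] := Ks _ (subset_closure Ux).
rewrite /rest (perm_big _ (perm_to_rem ps)) big_cons.
have -> : 1 - b p x = 0 by rewrite [b p x]bpx subrr.
exact: mul0r.
Qed.

(** The integrand is the divergence of [v *: a], split into the partial derivatives to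
which [trace_bounded_C1] applies. *)
Lemma divergence_trace_bound (a : 'rV[R]_3 -> 'rV[R]_3) : smooth_boundary Om ->
  (forall j, Ck_on 1 V (component a j)) -> exists2 C : R, 0 < C &
  forall v, Ck_closure 1 Om v -> (forall x, closure Om x -> 0 <= v x) ->
  (`|vol_integral Om (fun x => \sum_j (component a j x * pd j v x + v x * pd j (component a j) x))|%:E <=
    C%:E * surface_integral (boundary Om) v)%E.
Proof.
move=> sOm Ca.
have [C0 C00 H0] := trace_bounded_C1 0 sOm (Ca 0).
have [C1 C10 H1] := trace_bounded_C1 1 sOm (Ca 1).
have [C2 C20 H2] := trace_bounded_C1 2 sOm (Ca 2).
exists (C0 + C1 + C2); first by rewrite !addr_gt0.
move=> v Cv v0.
have [bv bdv] := Ck_closure_bounded oOm bOm Cv.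
have CvO := Ck1_closure_on oOm Cv.
pose T j x := component a j x * pd j v x + v x * pd j (component a j) x.
have bT j : bounded_continuous Om (T j).
  have [ba bda] := Ck_open_bounded oOm bOm cOV (Ca j).
  by apply: bounded_continuousD; apply: bounded_continuousM.
have TE j : vol_integral Om (pd j (fun x => component a j x * v x)) = vol_integral Om (T j).
  apply: vol_integral_ext => x Ux; have da := Ck_derivable (i := j) (Ca j) (OmV Ux).
  exact: (pdM da (Ck_derivable (i := j) CvO Ux)).
have -> : vol_integral Om (fun x => \sum_j T j x) =
    vol_integral Om (T 0) + vol_integral Om (T 1) + vol_integral Om (T 2).
  rewrite -(vol_integralD oOm bOm (bT 0) (bT 1)).
  rewrite -(vol_integralD oOm bOm (bounded_continuousD (bT 0) (bT 1)) (bT 2)).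
  by apply: vol_integral_ext => x _; exact: sum3.
rewrite -!TE; set I0 := vol_integral _ _; set I1 := vol_integral _ _.
set I2 := vol_integral _ _.
apply: (@le_trans _ _ (`|I0|%:E + `|I1|%:E + `|I2|%:E)%E).
  rewrite -!EFinD lee_fin; apply: le_trans (ler_normD _ _) _.
  by rewrite lerD2r ler_normD.
apply: le_trans (leeD (leeD (H0 v Cv v0) (H1 v Cv v0)) (H2 v Cv v0)) _.
by rewrite !EFinD !ge0_muleDl ?lexx// ?adde_ge0// lee_fin ltW.
Qed.

End global.

(** * The L^2 norm *)

Section L2.
Context {R : realType}.
Variable Om : set 'rV[R]_3.
Hypothesis mOm : measurable (@pt3 R @^-1` Om).
Implicit Types f g h : 'rV[R]_3 -> R.
Let D := @pt3 R @^-1` Om.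

Lemma L2norm_sqrte f :
  L2norm Om f = sqrte (\int[lebesgue3]_(q in D) (f (pt3 q) ^+ 2)%:E).
Proof.
rewrite /L2norm unlock poweR12_sqrt; last first.
  by apply: integral_ge0 => q _; exact: poweR_ge0.
congr sqrte; rewrite [RHS]integral_mkcond; apply: eq_integral => q _.
rewrite /= !patchE; case: ifP => _.
  by rewrite ?poweR_EFin (powR_mulrn 2)// real_normK ?num_real.
by rewrite normr0 ?poweR_EFin powR0.
Qed.

Lemma L2norm_sqr f :
  (L2norm Om f ^+ 2 = \int[lebesgue3]_(q in D) (f (pt3 q) ^+ 2)%:E)%E.
Proof.
rewrite L2norm_sqrte sqr_sqrte//.
by apply: integral_ge0 => q _; rewrite lee_fin sqr_ge0.
Qed.

Lemma L2norm_ge0 f : (0 <= L2norm Om f)%E.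
Proof. exact: Lnorm_ge0. Qed.

Lemma le_L2norm f g : measurable_fun D (f \o pt3) -> measurable_fun D (g \o pt3) ->
  (forall x, Om x -> `|f x| <= `|g x|) -> (L2norm Om f <= L2norm Om g)%E.
Proof.
move=> mf mg fg; rewrite !L2norm_sqrte lee_sqrt; last first.
  by apply: integral_ge0 => q _; rewrite lee_fin sqr_ge0.
apply: ge0_le_integral => //.
- by move=> q _; rewrite lee_fin sqr_ge0.
- by apply/measurable_EFinP; exact: measurable_funX.
- by apply/measurable_EFinP; exact: measurable_funX.
- move=> q Uq; rewrite lee_fin -[leLHS]real_normK ?num_real// -[leRHS]real_normK ?num_real//.
  by rewrite ler_sqr ?nnegrE//; exact: fg.
Qed.

Lemma L2norm_triangle f g h : measurable_fun D (f \o pt3) ->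
  measurable_fun D (g \o pt3) -> measurable_fun D (h \o pt3) ->
  (forall x, Om x -> `|f x| <= `|g x| + `|h x|) ->
  (L2norm Om f <= L2norm Om g + L2norm Om h)%E.
Proof.
move=> mf mg mh fgh.
have mng : measurable_fun D ((fun x => `|g x|) \o pt3) by exact: measurableT_comp.
have mnh : measurable_fun D ((fun x => `|h x|) \o pt3) by exact: measurableT_comp.
apply: (@le_trans _ _ (L2norm Om (fun x => `|g x| + `|h x|))).
  apply: le_L2norm => //; first exact: measurable_funD.
  by move=> x Ux; rewrite [leRHS]ger0_norm ?addr_ge0//; exact: fgh.
apply: (@le_trans _ _ (L2norm Om (fun x => `|g x|%R) + L2norm Om (fun x => `|h x|%R))%E).
  have E : (((fun x => `|g x| + `|h x|) \o pt3) \_ D) =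
     (((fun x => `|g x|) \o pt3) \_ D \+ ((fun x => `|h x|) \o pt3) \_ D).
    by apply/funext => q; rewrite /= !patchE; case: ifP => // _; rewrite addr0.
  rewrite /L2norm -/D E; apply: minkowski_EFin.
  - exact/(measurable_restrictT _ mOm).
  - exact/(measurable_restrictT _ mOm).
  - by rewrite ler1n.
by apply: leeD; apply: le_L2norm => // x _; rewrite normr_id.
Qed.

Lemma L2norm_holder f g : measurable_fun D (f \o pt3) ->
  measurable_fun D (g \o pt3) ->
  (\int[lebesgue3]_(q in D) (`|f (pt3 q) * g (pt3 q)|%R)%:E <= L2norm Om f * L2norm Om g)%E.
Proof.
move=> mf mg.
have mf' := (measurable_restrictT _ mOm).1 mf.
have mg' := (measurable_restrictT _ mOm).1 mg.
have := @hoelder _ _ _ lebesgue3 _ _ 2 2 mf' mg'.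
have two0 : 0 < 2 :> R by [].
move=> /(_ two0 two0) H.
have /H : (2^-1 + 2^-1)%R = 1 :> R by lra.
apply: le_trans; rewrite Lnorm1 [leLHS]integral_mkcond le_eqVlt; apply/orP; left.
apply/eqP; apply: eq_integral => q _; rewrite /= !patchE; case: ifP => _ //.
by rewrite mulr0 normr0.
Qed.

Lemma bounded_L2norm_lty f : open Om -> bounded_set Om -> bounded_continuous Om f ->
  (L2norm Om f < +oo)%E.
Proof.
move=> oOm bOm bf.
have b2 := bounded_continuousM bf bf.
have ib := bounded_continuous_integrable oOm bOm b2.
have H : (\int[lebesgue3]_(q in D) (f (pt3 q) ^+ 2)%:E)%E \is a fin_num.
  by apply: (integrable_fin_num _ ib).
rewrite -ge0_fin_numE ?L2norm_ge0// L2norm_sqrte sqrte_fin_num//.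
by apply: integral_ge0 => q _; rewrite lee_fin sqr_ge0.
Qed.

Lemma fine_L2norm_sqr f : open Om -> bounded_set Om -> bounded_continuous Om f ->
  fine (L2norm Om f) ^+ 2 = vol_integral Om (fun x => f x ^+ 2).
Proof.
move=> oOm bOm bf.
have : L2norm Om f \is a fin_num.
  by rewrite ge0_fin_numE ?L2norm_ge0// bounded_L2norm_lty.
have := L2norm_sqr f; rewrite /vol_integral /Rintegral -/D => <-.
by case: (L2norm Om f).
Qed.

End L2.

(** * The estimate for functions that are C^1 up to the boundary *)

Section closure_product.
Context {R : realType} {n : nat}.

(** The continuous extensions of the partial derivatives are combined by the product
rule. *)
Lemma Ck_closureM (U : set 'rV[R]_n) f g : open U -> Ck_closure 1 U f ->
  Ck_closure 1 U g -> Ck_closure 1 U (fun x => f x * g x).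
Proof.
move=> oU Cf Cg; have [cf df] := Cf; have [cg dg] := Cg.
have cM (F G : 'rV[R]_n -> R) : {within closure U, continuous F} ->
    {within closure U, continuous G} -> {within closure U, continuous (fun x => F x * G x)}.
  by move=> cF cG x; apply: continuousM; [exact: cF|exact: cG].
have cD (F G : 'rV[R]_n -> R) : {within closure U, continuous F} ->
    {within closure U, continuous G} -> {within closure U, continuous (fun x => F x + G x)}.
  by move=> cF cG x; apply: continuousD; [exact: cF|exact: cG].
split; first exact: cM.
move=> i; have [dfi [f' [cf' _] f'E]] := df i; have [dgi [g' [cg' _] g'E]] := dg i.
split; first by move=> x Ux; apply: derivableM; [exact: dfi|exact: dgi].
exists (fun x => f x * g' x + g x * f' x).
  by split => //; apply: cD; apply: cM.
by move=> x Ux; rewrite (pdM (dfi x Ux) (dgi x Ux)) f'E// g'E.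
Qed.

End closure_product.

Section estimate.
Context {R : realType}.
Variables (Om V : set 'rV[R]_3) (w a : 'rV[R]_3 -> 'rV[R]_3) (c0 nu : R).
Hypotheses (oOm : open Om) (bOm : bounded_set Om) (oV : open V)
  (cOV : closure Om `<=` V) (sOm : smooth_boundary Om).
Hypotheses (nu0 : 0 <= nu) (sw : smooth_field_on V w) (w0 : forall x, V x -> 0 < dot (w x) (w x)).
Hypotheses (sa : smooth_field_on V a) (aw : forall x, V x -> dot (a x) (w x) = 0)
  (diva : forall x, Om x -> c0 <= divergence a x)
  (anu : forall x, Om x -> enorm (a x) <= nu).
Implicit Types (u v f g : 'rV[R]_3 -> R) (F G : 'rV[R]_3 -> 'rV[R]_3).

Let OmV : Om `<=` V. Proof. exact: subset_trans (@subset_closure _ _) cOV. Qed.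
Let mOm := open_pt3_measurable oOm.

Lemma grad_perpE u x : V x ->
  grad_perp w u x = grad u x - ((dot (w x) (w x))^-1 * dot (w x) (grad u x)) *: w x.
Proof.
move=> Vx; rewrite /grad_perp enorm_sqr cross_cross scalerBr !scalerA.
by rewrite mulVf ?scale1r// gt_eqF// w0.
Qed.

(** The orthogonal gradient differs from the gradient by a multiple of [w], to which
[a] is orthogonal. *)
Lemma dot_grad_perp u x : V x -> dot (a x) (grad_perp w u x) = dot (a x) (grad u x).
Proof.
move=> Vx; rewrite grad_perpE// dotC dotBl dotZl (dotC (w x) (a x)) aw//.
by rewrite mulr0 subr0 dotC.
Qed.

Lemma bounded_continuous_dot F G :
  (forall i, bounded_continuous Om (component F i)) ->
  (forall i, bounded_continuous Om (component G i)) ->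
  bounded_continuous Om (fun x => dot (F x) (G x)).
Proof.
move=> bF bG; apply: (bounded_continuous_ext oOm (f := fun x =>
    component F 0 x * component G 0 x + component F 1 x * component G 1 x +
    component F 2 x * component G 2 x)).
  by move=> x _; rewrite dot3.
by apply: bounded_continuousD; [apply: bounded_continuousD|]; apply: bounded_continuousM.
Qed.

Lemma bounded_continuous_enorm F : (forall i, bounded_continuous Om (component F i)) ->
  bounded_continuous Om (fun x => enorm (F x)).
Proof.
move=> bF; have [cd [C dC]] := bounded_continuous_dot bF bF.
split.
  move=> x Ux; apply: (@continuous_comp _ _ _ (fun x => dot (F x) (F x)) Num.sqrt).
    exact: cd.
  exact: sqrt_continuous.
exists (Num.sqrt C) => x Ux; rewrite ger0_norm ?enorm_ge0// ler_wsqrtr//.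
by apply: le_trans (dC x Ux); exact: ler_norm.
Qed.

Lemma smooth_bounded f : smooth_on V f -> bounded_continuous Om f.
Proof. by move=> sf; exact: (Ck_open_bounded oOm bOm cOV (sf 1%N)).1. Qed.

Lemma grad_perp_bounded u : (forall i, bounded_continuous Om (pd i u)) ->
  forall i, bounded_continuous Om (component (grad_perp w u) i).
Proof.
move=> bu i.
have bw j : bounded_continuous Om (component w j) by exact: smooth_bounded.
have bg j : bounded_continuous Om (component (grad u) j).
  apply: (bounded_continuous_ext oOm (f := pd j u)) => // x _.
  by rewrite /component mxE.
have bi : bounded_continuous Om (fun x => (dot (w x) (w x))^-1).
  apply: smooth_bounded => k; apply: CkV => //; last exact: dot_smooth.
  by move=> x Vx; rewrite gt_eqF// w0.
apply: (bounded_continuous_ext oOm (f := fun x => component (grad u) i x +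
   (- 1) * (((dot (w x) (w x))^-1 * dot (w x) (grad u x)) * component w i x))).
  move=> x Ux; rewrite /component grad_perpE; last exact: OmV.
  by rewrite !mxE mulN1r.
apply: bounded_continuousD => //; apply: bounded_continuousM.
  exact: bounded_continuous_cst.
apply: bounded_continuousM => //; apply: bounded_continuousM => //.
exact: bounded_continuous_dot.
Qed.

Lemma le_vol_integral f g : bounded_continuous Om f -> bounded_continuous Om g ->
  (forall x, Om x -> f x <= g x) -> vol_integral Om f <= vol_integral Om g.
Proof.
move=> bf bg fg; apply: le_Rintegral => //.
- exact: (bounded_continuous_integrable oOm bOm bf).
- exact: (bounded_continuous_integrable oOm bOm bg).
- by move=> q; exact: fg.
Qed.

Lemma vol_integralZ k f : bounded_continuous Om f ->
  vol_integral Om (fun x => k * f x) = k * vol_integral Om f.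
Proof.
move=> bf; apply: RintegralZl => //.
exact: (bounded_continuous_integrable oOm bOm bf).
Qed.

Lemma vol_integral_holder f g : bounded_continuous Om f -> bounded_continuous Om g ->
  vol_integral Om (fun x => `|f x * g x|) <= fine (L2norm Om f) * fine (L2norm Om g).
Proof.
move=> bf bg.
have H h : bounded_continuous Om h -> L2norm Om h \is a fin_num.
  by move=> bh; rewrite ge0_fin_numE ?L2norm_ge0// bounded_L2norm_lty.
have := L2norm_holder mOm (bounded_continuous_measurable oOm bf)
  (bounded_continuous_measurable oOm bg).
rewrite /vol_integral /Rintegral -(fineK (H _ bf)) -(fineK (H _ bg)) -EFinM => le1.
have fI : (\int[lebesgue3]_(q in @pt3 R @^-1` Om) `|f (pt3 q) * g (pt3 q)|%:E)%E \is a fin_num.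
  rewrite ge0_fin_numE; last first.
    by apply: integral_ge0 => q _; rewrite lee_fin.
  by apply: (le_lt_trans le1); exact: ltry.
by rewrite -lee_fin (fineK fI).
Qed.

(** The integral of the divergence of [u ^+ 2 *: a] is bounded below by the left-hand side:
the term with [divergence a] by [c0], the other one by Hoelder's inequality. *)
Lemma energy_estimate : exists2 C : R, 0 < C & forall u, Ck_closure 1 Om u ->
  ((c0 * fine (L2norm Om u) ^+ 2 - 2 * nu * fine (L2norm Om u) *
      fine (L2norm_field Om (grad_perp w u)))%:E <=
   C%:E * surface_integral (boundary Om) (fun x => (u x ^+ 2)%R))%E.
Proof.
have Ca j : Ck_on 1 V (component a j) by exact: sa.
have [C C0 HC] := divergence_trace_bound oOm bOm oV cOV sOm Ca.
exists C => // u Cu.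
set n0 := fine (L2norm _ _); set n1 := fine (L2norm_field _ _).
have Cu2 : Ck_closure 1 Om (fun x => u x ^+ 2) by exact: Ck_closureM.
have := HC _ Cu2 (fun x _ => sqr_ge0 (u x)); apply: le_trans; rewrite lee_fin.
set T := fun x => \sum_j _.
have [bu bdu] := Ck_closure_bounded oOm bOm Cu.
have bg := bounded_continuous_enorm (grad_perp_bounded bdu).
pose g x := enorm (grad_perp w u x).
have ba i : bounded_continuous Om (component a i) by exact: smooth_bounded.
have bdot : bounded_continuous Om (fun x => dot (a x) (grad_perp w u x)).
  by apply: bounded_continuous_dot => //; exact: grad_perp_bounded.
have bdiv : bounded_continuous Om (divergence a).
  apply: smooth_bounded => k; apply: Ck_sum => // i.
  exact: smooth_pd (sa i) k.
have bu2 : bounded_continuous Om (fun x => u x ^+ 2) by exact: bounded_continuousM.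
have TE x : Om x -> T x = u x ^+ 2 * divergence a x + 2 * (u x * dot (a x) (grad_perp w u x)).
  move=> Ux; rewrite (dot_grad_perp _ (OmV Ux)) /T /divergence /dot.
  rewrite !mulr_sumr -big_split/=; apply: eq_bigr => j _.
  have du := Ck_derivable (i := j) (Ck1_closure_on oOm Cu) Ux.
  rewrite (pdM du du) mxE /component.
  move: (pd j u x) (pd j _ x) => p q; ring.
have b1 : bounded_continuous Om (fun x => u x ^+ 2 * divergence a x).
  exact: bounded_continuousM.
have b2 : bounded_continuous Om (fun x => u x * dot (a x) (grad_perp w u x)).
  exact: bounded_continuousM.
have b2' : bounded_continuous Om (fun x => 2 * (u x * dot (a x) (grad_perp w u x))).
  by apply: bounded_continuousM => //; exact: bounded_continuous_cst.
have -> : vol_integral Om T = vol_integral Om (fun x => u x ^+ 2 * divergence a x) +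
    2 * vol_integral Om (fun x => u x * dot (a x) (grad_perp w u x)).
  by rewrite -vol_integralZ// -vol_integralD//; exact: vol_integral_ext.
have I1 : c0 * n0 ^+ 2 <= vol_integral Om (fun x => u x ^+ 2 * divergence a x).
  rewrite /n0 fine_L2norm_sqr// -vol_integralZ//; apply: le_vol_integral => //.
    by apply: bounded_continuousM => //; exact: bounded_continuous_cst.
  by move=> x Ux; rewrite mulrC ler_wpM2l ?sqr_ge0// diva.
have I2 : `|vol_integral Om (fun x => u x * dot (a x) (grad_perp w u x))| <= nu * (n0 * n1).
  have bn : bounded_continuous Om (fun x => `|u x * g x|).
    have [cug [K ugK]] := bounded_continuousM bu bg; split.
      by move=> x Ux; apply: continuous_comp; [exact: cug|exact: norm_continuous].
    by exists K => x Ux; rewrite normr_id; exact: ugK.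
  have bn2 : bounded_continuous Om (fun x => `|u x * dot (a x) (grad_perp w u x)|).
    have [cug [K ugK]] := b2; split.
      by move=> x Ux; apply: continuous_comp; [exact: cug|exact: norm_continuous].
    by exists K => x Ux; rewrite normr_id; exact: ugK.
  have H1 : `|vol_integral Om (fun x => u x * dot (a x) (grad_perp w u x))| <=
      nu * vol_integral Om (fun x => `|u x * g x|).
    apply: (@le_trans _ _ (vol_integral Om (fun x => `|u x * dot (a x) (grad_perp w u x)|))).
      apply: le_normr_Rintegral => //.
      exact: (bounded_continuous_integrable oOm bOm b2).
    rewrite -vol_integralZ//; apply: le_vol_integral => //.
      by apply: bounded_continuousM => //; exact: bounded_continuous_cst.
    move=> x Ux; rewrite !normrM mulrCA ler_wpM2l//.
    apply: le_trans (cauchy_schwarz _ _) _.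
    by rewrite [`|g x|]ger0_norm ?enorm_ge0// ler_wpM2r ?enorm_ge0// anu.
  apply: le_trans H1 _.
  by rewrite ler_wpM2l//; exact: vol_integral_holder.
move: I1 I2; rewrite ler_norml => I1 /andP[I2 _].
apply: le_trans (ler_norm _); lra.
Qed.

End estimate.

(** * Functions with zero trace *)

Section limits.
Context {R : realType}.

(** Read [x], [y] as the norms of the limit and [p], [q] as those of an approximation with
error [t]; the inequality for [x], [y] then holds up to [K * t]. *)
Lemma quadratic_limit (c k C x y : R) : 0 < c -> 0 <= k -> 0 < C -> 0 <= x -> 0 <= y ->
  (forall t, 0 < t -> t <= 1 -> exists p q,
    [/\ 0 <= p, x <= p + t, p <= x + t, q <= y + t & c * p ^+ 2 - k * p * q <= C * t]) ->
  c * x ^+ 2 <= k * x * y.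
Proof.
move=> c0 k0 C0 x0 y0 H.
pose K := c * (2 * x + 1) + k * (x + y + 1) + C.
have K0 : 0 < K by rewrite ltr_wpDl// addr_ge0// mulr_ge0//; lra.
apply/ler_addgt0Pr => e e0.
pose t := Num.min 1 (e / K).
have t0 : 0 < t by rewrite lt_min ltr01 divr_gt0.
have t1 : t <= 1 by rewrite ge_min lexx.
have te : t * K <= e by rewrite -ler_pdivlMr// ge_min lexx orbT.
have [p [q [p0 xp px qy E]]] := H t t0 t1.
have h1 : x ^+ 2 <= p ^+ 2 + t * (2 * x + 1).
  have : 0 <= (p + t - x) * (p + x) by apply: mulr_ge0; lra.
  have : t * (p + x) <= t * (2 * x + 1) by apply: ler_wpM2l; lra.
  by rewrite !expr2; lra.
have h2 : p * q <= x * y + t * (x + y + 1).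
  apply: (@le_trans _ _ (p * (y + t))); first by rewrite ler_wpM2l.
  apply: (@le_trans _ _ ((x + t) * (y + t))); first by apply: ler_wpM2r => //; lra.
  have : t * t <= t * 1 by rewrite ler_wpM2l// ltW.
  lra.
have h1' := ler_wpM2l (ltW c0) h1.
have h2' := ler_wpM2l k0 h2.
move: te E h1' h2'; rewrite /K; lra.
Qed.

Lemma cvge0_lt (f : nat -> \bar R) (e : R) : f @ \oo --> 0%E -> 0 < e ->
  \forall m \near \oo, (f m < e%:E)%E.
Proof.
move=> cf e0; apply: (cf [set z | (z < e%:E)%E]).
by apply: open_nbhs_nbhs; split; [exact: open_ereal_lt_ereal|rewrite /= lte_fin].
Qed.

Lemma sqre_le (x y : \bar R) (t : R) : (0 <= x)%E -> (0 <= y)%E -> 0 < t ->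
  (x ^+ 2 + y ^+ 2 < (t ^+ 2)%:E)%E -> (x <= t%:E)%E.
Proof.
case: x => [x| |] //; case: y => [y| |] // x0 y0 t0.
rewrite -!EFin_expe -EFinD lte_fin lee_fin => h.
rewrite -(@ler_sqr _ x t) ?nnegrE// ?(ltW t0)//; have := sqr_ge0 y; lra.
Qed.

Lemma measurable_enorm (D : set (R * R * R)) (F : 'rV[R]_3 -> 'rV[R]_3) : measurable D ->
  (forall i, measurable_fun D (component F i \o pt3)) ->
  measurable_fun D ((fun x => enorm (F x)) \o pt3).
Proof.
move=> mD mF.
have -> : (fun x => enorm (F x)) \o pt3 = Num.sqrt \o
    (((component F 0 \o pt3) \* (component F 0 \o pt3) \+
      (component F 1 \o pt3) \* (component F 1 \o pt3)) \+
      (component F 2 \o pt3) \* (component F 2 \o pt3)).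
  by apply/funext => q; rewrite /= /enorm dot3.
apply: measurableT_comp.
  by apply: continuous_measurable_fun; exact: sqrt_continuous.
by apply: measurable_funD; [apply: measurable_funD|]; apply: measurable_funM.
Qed.

End limits.

Section trace_zero.
Context {R : realType}.
Variables (Om V : set 'rV[R]_3) (w a : 'rV[R]_3 -> 'rV[R]_3) (c0 nu : R).
Hypotheses (oOm : open Om) (bOm : bounded_set Om) (oV : open V)
  (cOV : closure Om `<=` V) (sOm : smooth_boundary Om).
Hypotheses (c00 : 0 < c0) (nu0 : 0 <= nu).
Hypotheses (sw : smooth_field_on V w) (w0 : forall x, V x -> 0 < dot (w x) (w x)).
Hypotheses (sa : smooth_field_on V a) (aw : forall x, V x -> dot (a x) (w x) = 0)
  (diva : forall x, Om x -> c0 <= divergence a x)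
  (anu : forall x, Om x -> enorm (a x) <= nu).
Let mOm := open_pt3_measurable oOm.

(** [energy_estimate] for approximations whose boundary values tend to zero.  When
[nu = 0] the constant is 0 by the convention on division by zero. *)
Lemma Hperp0_poincare u G : Hperp0 Om w u G ->
  ((c0 / (2 * nu))%:E * L2norm Om u <= L2norm_field Om G)%E.
Proof.
move=> [[[mu u_lty] [L2G _] _] [_ [um [Cum cvu cvS]]]].
have [C C0 HC] := energy_estimate oOm bOm oV cOV sOm nu0 sw w0 sa aw diva anu.
have mG : measurable_fun (pt3 @^-1` Om) ((fun x => enorm (G x)) \o pt3).
  by apply: measurable_enorm => // i; have [] := L2G i.
have fu : L2norm Om u \is a fin_num by rewrite ge0_fin_numE ?L2norm_ge0.
have y0' : (0 <= L2norm_field Om G)%E := L2norm_ge0 _ _.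
case yE : (L2norm_field Om G) y0' => [y| |]; [|by move=> _; exact: leey|by []].
rewrite lee_fin => y0.
have [x xE] : exists x, L2norm Om u = x%:E by exists (fine (L2norm Om u)); rewrite fineK.
have x0 : 0 <= x by rewrite -lee_fin -xE L2norm_ge0.
rewrite xE -EFinM lee_fin.
suff H : c0 * x ^+ 2 <= (2 * nu) * x * y.
  have [->|xn0] := eqVneq x 0; first by rewrite mulr0.
  have [->|nun0] := eqVneq nu 0; first by rewrite mulr0 invr0 mulr0 mul0r.
  have xp : 0 < x by rewrite lt_def xn0.
  have np : 0 < 2 * nu by rewrite mulr_gt0// lt_def nun0.
  rewrite mulrAC ler_pdivrMr// -(ler_pM2r xp); move: H; rewrite expr2; lra.
apply: (quadratic_limit c00 _ C0 x0 y0); first by rewrite mulr_ge0.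
move=> t t0 t1.
have [m [/= Hm Sm]] := filter_ex (filterI (cvge0_lt cvu (exprn_gt0 2 t0)) (cvge0_lt cvS t0)).
have [bu bdu] := Ck_closure_bounded oOm bOm (Cum m).
have bg := grad_perp_bounded oOm bOm oV cOV sw w0 bdu.
have bn := bounded_continuous_enorm oOm bg.
have mum := bounded_continuous_measurable oOm bu.
have fum : L2norm Om (um m) \is a fin_num.
  by rewrite ge0_fin_numE ?L2norm_ge0// bounded_L2norm_lty.
have fgm : L2norm_field Om (grad_perp w (um m)) \is a fin_num.
  by rewrite ge0_fin_numE ?L2norm_ge0// bounded_L2norm_lty.
have du : (L2norm Om (fun x => um m x - u x)%R <= t%:E)%E.
  exact: sqre_le (L2norm_ge0 _ _) (L2norm_ge0 _ _) t0 Hm.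
have dG : (L2norm_field Om (fun x => grad_perp w (um m) x - G x)%R <= t%:E)%E.
  apply: sqre_le (L2norm_ge0 _ _) (L2norm_ge0 _ _) t0 _; last first.
    by rewrite addeC; exact: Hm.
have md : measurable_fun (pt3 @^-1` Om) ((fun x => um m x - u x) \o pt3).
  exact: measurable_funB.
have mdG : measurable_fun (pt3 @^-1` Om)
    ((fun x => enorm (grad_perp w (um m) x - G x)) \o pt3).
  apply: measurable_enorm => // i.
  have -> : component (fun x => grad_perp w (um m) x - G x) i \o pt3 =
      (component (grad_perp w (um m)) i \o pt3) \- (component G i \o pt3).
    by apply/funext => q; rewrite /= /component !mxE.
  apply: measurable_funB; first exact: bounded_continuous_measurable.
  by have [] := L2G i.
exists (fine (L2norm Om (um m))), (fine (L2norm_field Om (grad_perp w (um m)))).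
split.
- by rewrite fine_ge0// L2norm_ge0.
- rewrite -lee_fin EFinD fineK// -xE.
  apply: le_trans (leeD2l _ du); apply: (L2norm_triangle mOm) => //.
  by move=> z _; rewrite -{1}(subKr (um m z) (u z)) ler_normB.
- rewrite -lee_fin EFinD fineK// -xE.
  apply: le_trans (leeD2l _ du); apply: (L2norm_triangle mOm) => //.
  by move=> z _; rewrite -{1}(subrK (u z) (um m z)) addrC ler_normD.
- rewrite -lee_fin EFinD fineK// -yE.
  apply: le_trans (leeD2l _ dG); apply: (L2norm_triangle mOm) => //.
    exact: bounded_continuous_measurable.
  move=> z _; rewrite !ger0_norm ?enorm_ge0//.
  by rewrite -{1}(subrK (G z) (grad_perp w (um m) z)) addrC ler_enormD.
- rewrite -lee_fin; apply: le_trans (HC _ (Cum m)) _.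
  rewrite EFinM; apply: lee_wpmul2l; first by rewrite lee_fin ltW.
  apply: ltW; apply: le_lt_trans Sm.
  by rewrite le_eqVlt; apply/orP; left; apply/eqP; congr surface_integral; apply/funext => z; rewrite subr0.
Qed.

End trace_zero.

(** * The Poincare inequality *)

Section sup_inf.
Context {R : realType}.
Implicit Types (K U : set 'rV[R]_3) (F : 'rV[R]_3 -> 'rV[R]_3).

(** A point of [closure U] outside [U] and [V] would lie on both boundaries. *)
Lemma closure_sub_disjoint_boundary U V : open V -> U `<=` V ->
  boundary V `&` boundary U = set0 -> open U -> closure U `<=` V.
Proof.
move=> oV UV dVU oU x cx.
have [Ux|nUx] := pselect (U x); first exact: UV.
have [//|nVx] := pselect (V x).
suff : set0 x by [].
rewrite -dVU; split; split.
- exact: closureS UV _ cx.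
- by move/interior_subset.
- exact: cx.
- by move/interior_subset.
Qed.

Lemma enorm_sup_closure U V F : bounded_set U -> U !=set0 ->
  closure U `<=` V -> smooth_field_on V F ->
  forall x, closure U x -> enorm (F x) <= sup [set enorm (F x) | x in closure U].
Proof.
move=> bU [x0 Ux0] cUV sF x cx; apply: ub_le_sup; last by exists x.
have H i : exists2 C, 0 <= C & forall x, closure U x -> `|component F i x| <= C.
  apply: within_compact_bounded; first exact: compact_closure.
  apply: continuous_in_subspaceT => y /set_mem/cUV; exact: (sF i 0%N).1.
have [C0 C00 H0] := H 0; have [C1 C10 H1] := H 1; have [C2 C20 H2] := H 2.
exists (Num.sqrt (C0 ^+ 2 + C1 ^+ 2 + C2 ^+ 2)) => _ [y cy <-].
have sq (p q : R) : `|p| <= q -> p * p <= q ^+ 2.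
  move=> pq; rewrite -expr2 -[leLHS]real_normK ?num_real//.
  by rewrite lerXn2r ?nnegrE ?normr_ge0//; apply: le_trans pq.
by apply: ler_wsqrtr; rewrite dot3 !lerD// sq//; [exact: H0|exact: H1|exact: H2].
Qed.

End sup_inf.

Theorem theoremV1 (R : realType)
  (Omegat Omega : set 'rV[R]_3) (n w : 'rV[R]_3 -> 'rV[R]_3) (delta : R)
  (hOmegat : bounded_domain Omegat)
  (hOmega : bounded_domain Omega) (hsmooth : smooth_boundary Omega)
  (hsub : Omega `<=` Omegat)
  (hdisj : boundary Omegat `&` boundary Omega = set0)
  (hn : outward_unit_normal Omega n)
  (hw : smooth_field_on Omegat w)
  (hnw : forall x, boundary Omega x -> dot (n x) (w x) = 0)
  (hdelta : 0 < delta)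
  (hh : forall x, Omegat x -> delta <= `|dot (w x) (curl w x)|) :
  let what := unit_field w in
  let eps := inf [set `|dot (w x) (curl w x)| | x in closure Omega] in
  let M := sup [set enorm (w x) | x in closure Omega] in
  exists a : 'rV[R]_3 -> 'rV[R]_3,
    [/\ smooth_field_closure Omega a,
        forall x, Omega x ->
          [/\ dot (a x) (w x) = 0,
              divergence a x = enorm (curl what x) &
              M ^- 2 * eps <= enorm (curl what x)],
        0 < M ^- 2 * eps &
        let nu := sup [set enorm (a x) | x in closure Omega] in
        forall u G, Hperp0 Omega w u G ->
          ((eps / (2 * M ^+ 2 * nu))%:E * L2norm Omega u
             <= L2norm_field Omega G)%E].
Proof.
move=> what eps M.
have [oV _ _ bV] := hOmegat; have [oU _ [x0 Ux0] bU] := hOmega.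
have cUV := closure_sub_disjoint_boundary oV hsub hdisj oU.
have cU0 : closure Omega x0 by exact: subset_closure.
have h0 x : Omegat x -> dot (w x) (curl w x) != 0.
  by move=> Vx; rewrite -normr_gt0 (lt_le_trans hdelta)// hh.
have [a [sa aw diva]] := horizontal_potential oV bV (compact_closure bU) cUV hw
  (fun x Vx => eq_ind_r (fun t => t != 0) (h0 x Vx) (dotC _ _))
  (enorm_curl_unit_smooth oV hw h0).
have eps0 : 0 < eps.
  apply: lt_le_trans hdelta _; apply: lb_le_inf.
    by exists `|dot (w x0) (curl w x0)|; exists x0.
  by move=> _ [x /cUV Vx <-]; exact: hh.
have epsh x : Omega x -> eps <= `|dot (w x) (curl w x)|.
  move=> Ux; apply: ge_inf; last by exists x => //; exact: subset_closure.
  by exists 0 => _ [y _ <-].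
have wM x : closure Omega x -> enorm (w x) <= M.
  by apply: enorm_sup_closure bU _ cUV hw x; exists x0.
have M0 : 0 < M.
  apply: lt_le_trans (wM _ cU0); apply: (contact_enorm_gt0 h0); exact: cUV.
have curlge x : Omega x -> M ^- 2 * eps <= enorm (curl what x).
  move=> Ux; have Vx := hsub _ Ux; have wp := contact_enorm_gt0 h0 Vx.
  apply: le_trans (le_curl_unit oV hw h0 Vx).
  apply: ler_pM; last exact: epsh; first by rewrite invr_ge0 exprn_ge0// ltW.
    exact: ltW.
  rewrite lef_pV2 ?posrE ?exprn_gt0// ler_sqr ?nnegrE ?(ltW wp) ?(ltW M0)//.
  by apply: wM; exact: subset_closure.
have c00 : 0 < M ^- 2 * eps by rewrite mulr_gt0// invr_gt0 exprn_gt0.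
exists a; split => //.
- by move=> i k; apply: (Ck_closureW oU hsub cUV oV); exact: sa.
- move=> x Ux; split; [exact: aw (hsub _ Ux)| |exact: curlge].
  by apply: diva; exact: subset_closure.
- move=> nu u G HuG.
  have anu x : closure Omega x -> enorm (a x) <= nu.
    by apply: enorm_sup_closure bU _ cUV sa x; exists x0.
  have nu0 : 0 <= nu := le_trans (enorm_ge0 _) (anu _ cU0).
  have -> : eps / (2 * M ^+ 2 * nu) = (M ^- 2 * eps) / (2 * nu).
    move: (M ^+ 2) => m; rewrite !invfM.
    by move: m^-1 nu^-1 2^-1 => p q r; ring.
  apply: (Hperp0_poincare oU bU oV cUV hsmooth c00 nu0 hw (contact_dot_gt0 h0) sa aw) => //.
  + by move=> x Ux; rewrite diva; [exact: curlge|exact: subset_closure].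
  + by move=> x Ux; apply: anu; exact: subset_closure.
Qed.
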